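(* Suppose $0<p<1$. For $g$ analytic on the unit disc $\mathbb{D}$ let $J_g(f)(z)=\int_0^z f(w)g'(w)\,dw$. (1) If $0<q<p$ and $g\in\mathcal{Q}_q$, then $J_g:\mathcal{D}_p^{q/p}\to\mathcal{D}_p^{q/p}$ is bounded. (2) If $0<\lambda<1$ and $g\in\mathcal{W}_p$, then $J_g:\mathcal{D}_p^{\lambda}\to\mathcal{D}_p^{\lambda}$ is bounded.
   Context: $\mathbb{D}$ is the open unit disc in $\mathbb{C}$, $dm$ is planar Lebesgue measure normalized so that $m(\mathbb{D})=1$, and $\mathcal{H}ol(\mathbb{D})$ is the space of analytic functions on $\mathbb{D}$. For $a\in\mathbb{D}$, $\varphi_a(z)=\frac{a-z}{1-\bar a z}$. For $p\ge 0$, the weighted Dirichlet space $\mathcal{D}_p$ consists of all $f\in\mathcal{H}ol(\mathbb{D})$ with $\|f\|_{\mathcal{D}_p}^2=|f(0)|^2+\int_{\mathbb{D}}|f'(z)|^2(1-|z|^2)^p\,dm(z)<\infty$. For $0<p<1$, $\mathcal{Q}_p$ is the space of all $f\in\mathcal{H}ol(\mathbb{D})$ with $\|f\|_{\mathcal{Q}_p}=|f(0)|+\sup_{a\in\mathbb{D}}\|f\circ\varphi_a-f(a)\|_{\mathcal{D}_p}<\infty$. A positive Borel measure $\mu$ on $\mathbb{D}$ is a $\mathcal{D}_p$-Carleson measure if there is a constant $C=C(\mu)$ such that $\int_{\mathbb{D}}|f(z)|^2\,d\mu(z)\le C\|f\|_{\mathcal{D}_p}^2$ for all $f\in\mathcal{D}_p$.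 $\mathcal{W}_p$ is the space of all $g\in\mathcal{H}ol(\mathbb{D})$ such that $d\mu_g(z)=|g'(z)|^2(1-|z|^2)^p\,dm(z)$ is a $\mathcal{D}_p$-Carleson measure. For $\lambda,p\in[0,1]$, the Dirichlet-Morrey space $\mathcal{D}_p^{\lambda}$ consists of all $f\in\mathcal{H}ol(\mathbb{D})$ with $$\|f\|_{\mathcal{D}_p^{\lambda}}=|f(0)|+\sup_{a\in\mathbb{D}}(1-|a|^2)^{\frac p2(1-\lambda)}\|f\circ\varphi_a-f(a)\|_{\mathcal{D}_p}<\infty ;$$ it is a Banach space under this norm. ''Bounded'' means that the operator maps the space into itself and is a bounded linear operator for its norm. *)

(* Defs.v *)
From HB Require Import structures.
From mathcomp Require Import all_boot all_order all_algebra.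
From mathcomp Require Import all_classical all_reals all_analysis.
From mathcomp Require Import complex.

Set Implicit Arguments.
Unset Strict Implicit.
Unset Printing Implicit Defensive.

Import Order.TTheory GRing.Theory Num.Theory numFieldNormedType.Exports.

Local Open Scope classical_set_scope.
Local Open Scope ring_scope.
Local Open Scope complex_scope.

(* Functions on the unit disc are represented by total functions R[i] -> R[i];
   nothing below depends on their values off the open disc. *)

Section DirichletMorrey.
Variable R : realType.
Implicit Types (p q lambda : R) (a z : R[i]) (f g h : R[i] -> R[i]).

Definition modulus (z : R[i]) : R := ComplexField.Normc.normc z.

Definition unit_disc : set R[i] := [set z | modulus z < 1].

(* [R[i]^o] is [R[i]] as a normed module over itself, so that the increments in
   [derivable] and [derive] are complex. *)
Definition analytic f : Prop :=
  forall z, unit_disc z -> derivable (f : R[i]^o -> R[i]^o) z 1.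

Definition cderiv f : R[i] -> R[i] := 'D_1 (f : R[i]^o -> R[i]^o).

Definition phi a z : R[i] := (a - z) / (1 - a^* * z).

Definition recenter f a : R[i] -> R[i] := fun z => f (phi a z) - f a.

(* Borel sets and measures of the plane live on [R * R]. *)
Definition toC (w : R * R) : R[i] := w.1 +i* w.2.

Definition planeD : set (R * R) := toC @^-1` unit_disc.

(* Integration against dm = (1 / pi) dx dy. *)
Definition area_integral (A : set (R * R)) (F : R[i] -> R) : \bar R :=
  ((pi^-1)%:E * \int[lebesgue_measure \x lebesgue_measure]_(w in A)
                   (F (toC w))%:E)%E.

Definition dirichlet_density p f z : R :=
  modulus (cderiv f z) ^+ 2 * (1 - modulus z ^+ 2) `^ p.

Definition Dp_norm2 p f : \bar R :=
  ((modulus (f 0) ^+ 2)%:E + area_integral planeD (dirichlet_density p f))%E.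

Definition Dp_norm p f : \bar R := sqrte (Dp_norm2 p f).

Definition Dp p : set (R[i] -> R[i]) :=
  [set f | analytic f /\ (Dp_norm2 p f < +oo)%E].

Definition Qp_norm p f : \bar R :=
  ((modulus (f 0))%:E
   + ereal_sup [set Dp_norm p (recenter f a)
               | a in unit_disc])%E.

Definition Qp p : set (R[i] -> R[i]) :=
  [set f | analytic f /\ (Qp_norm p f < +oo)%E].

Definition carleson_measure p (mu : {measure set (R * R) -> \bar R}) : Prop :=
  exists C : R, forall f, Dp p f ->
    (\int[mu]_(w in planeD) (modulus (f (toC w)) ^+ 2)%:E
      <= C%:E * Dp_norm2 p f)%E.

Definition mu_ p g (A : set (R * R)) : \bar R :=
  area_integral (A `&` planeD) (dirichlet_density p g).

(* The set function [mu_ p g] is countably additive on Borel sets whenever [g]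
   is analytic; the existential packages it as a measure. *)
Definition Wp p : set (R[i] -> R[i]) :=
  [set g | analytic g /\
    exists mu : {measure set (R * R) -> \bar R},
      (forall A, measurable A -> mu A = mu_ p g A) /\ carleson_measure p mu].

Definition morrey_norm p lambda f : \bar R :=
  ((modulus (f 0))%:E
   + ereal_sup [set ((1 - modulus a ^+ 2) `^ (p / 2 * (1 - lambda)))%:E
                    * Dp_norm p (recenter f a)
               | a in unit_disc])%E.

Definition morrey p lambda : set (R[i] -> R[i]) :=
  [set f | analytic f /\ (morrey_norm p lambda f < +oo)%E].

Definition integral01 (F : R -> R[i]) : R[i] :=
  (\int[lebesgue_measure]_(t in `[0, 1]) complex.Re (F t))%R +i*
  (\int[lebesgue_measure]_(t in `[0, 1]) complex.Im (F t))%R.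

(* Integral along the segment from 0 to z, parametrized by w = t z. *)
Definition J g f z : R[i] :=
  integral01 (fun t => f (t%:C * z) * cderiv g (t%:C * z) * z).

Definition bounded_operator (X : set (R[i] -> R[i]))
    (N : (R[i] -> R[i]) -> \bar R)
    (T : (R[i] -> R[i]) -> (R[i] -> R[i])) : Prop :=
  [/\ forall f, X f -> X (T f),
      forall (c : R[i]) f h, X f -> X h -> forall z, unit_disc z ->
        T (fun w => c * f w + h w) z = c * T f z + T h z
    & exists C : R, forall f, X f -> (N (T f) <= C%:E * N f)%E].

End DirichletMorrey.

(* Main.v *)
(** Write [F = J_g f], [u(z) = 1 - |z|^2] and [phi = phi_a], so that
    [(F o phi)' = (f o phi) (g o phi)'].  A function of the Dirichlet-Morrey
    space satisfies [|f(z)| <= C ||f|| u(z)^(-p(1-lambda)/2)]; this follows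
    from the sub-mean value property of [(f o phi_a)'] at 0, integrated along
    a radius.

    If [g] is in [Q_q] and [lambda = q/p], the growth bound and
    [u(phi z) = u(a) u(z) / |1 - conj(a) z|^2] give
    [|f(phi z)|^2 u(z)^p <= C ||f||^2 u(a)^(q-p) u(z)^q], and what is left is
    the [Q_q] norm of [g].

    If [g] is in [W_p], the change of variables [w = phi z] turns the integral
    of [|(F o phi)'|^2 u^p] into [u(a)^p] times the integral of [|f P|^2]
    against the Carleson measure of [g], where [P = (1 - conj(a) w)^(-p)].  In
    the Dirichlet norm of [f P] the term [f' P] is, by the same change of
    variables, the Dirichlet integral of [f o phi], and the term [f P'] is
    bounded by the growth estimate and the Forelli-Rudin estimate for the
    integral of [|1 - conj(a) w|^(-2-c)].

    Of the change of variables only an inequality up to an absolute constant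
    is needed; it is proved by Riemann sums over a square grid.  Cauchy's
    formula is used on squares only. *)

Require Import Defs.
From HB Require Import structures.
From mathcomp Require Import all_boot all_order all_algebra.
From mathcomp Require Import all_classical all_reals all_analysis.
From mathcomp Require Import measurable_realfun.
From mathcomp Require Import complex ring lra.

Set Implicit Arguments.
Unset Strict Implicit.
Unset Printing Implicit Defensive.

Import Order.TTheory GRing.Theory Num.Theory numFieldNormedType.Exports.

Local Open Scope classical_set_scope.
Local Open Scope ring_scope.
Local Open Scope complex_scope.

(** [analytic] only says that the complex derivative exists at each point, so even the continuity of
    g' in the integrand of [J] has to be earned. Cauchy's formula is accessible only for
    continuously differentiable functions; Goursat's theorem supplies a primitive, which is one, and
    its Cauchy integral passes the regularity back to the function. Squares with sides parallel to
    the axes make the mean over half-sides an application of Tonelli, with no polar coordinates.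
    Constants are never sharp: they only have to be independent of a and f.

    In the W_p case the exponent of P is forced by (u o phi)^p = u(a)^p |P|^2 u^p. The exponents
    then close up. In the term f P' the growth bound leaves u^(p lambda), and u <= 2 |1 - conj(a) w|
    leads to Forelli-Rudin with c = p (2 - lambda). The term f' P gives the same power u(a)^(-c),
    and u(a)^p u(a)^(-c) = u(a)^(-p(1 - lambda)) is the Morrey weight. That lambda < 1 makes the
    growth bound a genuine power rather than a logarithm. *)

Arguments modulus : simpl never.

(** * Modulus, real part and imaginary part *)

Section Modulus.
Variable R : realType.
Implicit Types (z w : R[i]).

Lemma normCE z : `|z| = (modulus z)%:C.
Proof. by rewrite normc_def; case: z. Qed.

Lemma modulus_ge0 z : 0 <= modulus z.
Proof. by rewrite -lecR -normCE normr_ge0. Qed.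

Lemma modulusM z w : modulus (z * w) = modulus z * modulus w.
Proof. by apply: complexI; rewrite rmorphM /= -!normCE normrM. Qed.

Lemma modulusD z w : modulus (z + w) <= modulus z + modulus w.
Proof. by rewrite -lecR rmorphD /= -!normCE ler_normD. Qed.

Lemma modulusN z : modulus (- z) = modulus z.
Proof. by apply: complexI; rewrite -!normCE normrN. Qed.

Lemma modulusB z w : modulus (z - w) = modulus (w - z).
Proof. by rewrite -opprB modulusN. Qed.

Lemma modulus0 : modulus (0 : R[i]) = 0.
Proof. by apply: complexI; rewrite -!normCE normr0. Qed.

Lemma modulus1 : modulus (1 : R[i]) = 1.
Proof. by apply: complexI; rewrite -!normCE normr1. Qed.

Lemma modulus_eq0 z : (modulus z == 0) = (z == 0).
Proof. by rewrite -(inj_eq (@complexI R)) -normCE normr_eq0. Qed.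

Lemma modulus_gt0 z : (0 < modulus z) = (z != 0).
Proof. by rewrite lt0r modulus_eq0 modulus_ge0 andbT. Qed.

Lemma modulusV z : modulus z^-1 = (modulus z)^-1.
Proof. by apply: complexI; rewrite -normCE normfV normCE fmorphV. Qed.

Lemma modulusX z n : modulus (z ^+ n) = modulus z ^+ n.
Proof. by apply: complexI; rewrite -normCE normrX normCE rmorphXn. Qed.

Lemma modulusJ z : modulus z^* = modulus z.
Proof. by apply: complexI; rewrite -!normCE normcJ. Qed.

Lemma modulus_real (x : R) : modulus x%:C = `|x|.
Proof. by rewrite /modulus /= expr0n addr0 sqrtr_sqr. Qed.

Lemma modulus_nat n : modulus (n%:R : R[i]) = n%:R.
Proof. by rewrite -(rmorph_nat (real_complex R)) modulus_real ger0_norm. Qed.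

Lemma sqr_modulus z : modulus z ^+ 2 = complex.Re z ^+ 2 + complex.Im z ^+ 2.
Proof.
by case: z => x y; rewrite /modulus /= sqr_sqrtr// addr_ge0 ?sqr_ge0.
Qed.

Lemma Re_le_modulus z : `|complex.Re z| <= modulus z.
Proof.
by rewrite -(ler_pXn2r (n:=2)) ?nnegrE ?modulus_ge0// sqr_modulus real_normK
  ?num_real// lerDl sqr_ge0.
Qed.

Lemma Im_le_modulus z : `|complex.Im z| <= modulus z.
Proof.
by rewrite -(ler_pXn2r (n:=2)) ?nnegrE ?modulus_ge0// sqr_modulus real_normK
  ?num_real// lerDr sqr_ge0.
Qed.

Lemma modulus_i : modulus ('i : R[i]) = 1.
Proof. by rewrite /modulus /= expr0n add0r expr1n sqrtr1. Qed.

Lemma modulus_le_ReIm z : modulus z <= `|complex.Re z| + `|complex.Im z|.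
Proof.
rewrite {1}(complexE z); apply: (le_trans (modulusD _ _)).
by rewrite modulusM modulus_i mul1r !modulus_real.
Qed.

Lemma ler_modulusB z w : modulus z - modulus w <= modulus (z - w).
Proof. by rewrite lerBlDr; apply: le_trans (modulusD _ _); rewrite subrK. Qed.

Lemma ReD z w : complex.Re (z + w) = complex.Re z + complex.Re w.
Proof. by case: z; case: w. Qed.
Lemma ImD z w : complex.Im (z + w) = complex.Im z + complex.Im w.
Proof. by case: z; case: w. Qed.
Lemma ReN z : complex.Re (- z) = - complex.Re z.
Proof. by case: z. Qed.
Lemma ImN z : complex.Im (- z) = - complex.Im z.
Proof. by case: z. Qed.
Lemma ReM z w : complex.Re (z * w) =
  complex.Re z * complex.Re w - complex.Im z * complex.Im w.
Proof. by case: z; case: w. Qed.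
Lemma ImM z w : complex.Im (z * w) =
  complex.Re z * complex.Im w + complex.Im z * complex.Re w.
Proof. by case: z; case: w. Qed.

Lemma complexP z w : complex.Re z = complex.Re w -> complex.Im z = complex.Im w ->
  z = w.
Proof. by case: z; case: w => /= a b c d -> ->. Qed.

End Modulus.

(** * Differentiability and continuity by explicit estimates *)

Section Gdiff.
Variable R : realType.

(* [emb] is the identity of [R[i]] or the embedding of [R], so that complex
   derivatives and velocities of paths share one calculus. *)
Definition gdiff (E : zmodType) (emb : E -> R[i]) (f : E -> R[i]) (x : E)
    (c : R[i]) : Prop :=
  forall e : R, 0 < e -> exists2 d : R, 0 < d &
    forall y, modulus (emb (y - x)) < d ->
      modulus (f y - f x - emb (y - x) * c) <= e * modulus (emb (y - x)).

Definition gcont (E : zmodType) (emb : E -> R[i]) (f : E -> R[i]) (x : E)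
    : Prop :=
  forall e : R, 0 < e -> exists2 d : R, 0 < d &
    forall y, modulus (emb (y - x)) < d -> modulus (f y - f x) < e.

Definition cdiff := @gdiff R[i] id.
Definition pdiff := @gdiff R (real_complex R).
Definition ccont := @gcont R[i] id.
Definition pcont := @gcont R (real_complex R).

Section Rules.
Variables (E : zmodType) (emb : E -> R[i]).
Implicit Types (f g : E -> R[i]) (x : E) (c : R[i]).

Lemma gdiff_cst c x : gdiff emb (fun=> c) x 0.
Proof.
move=> e e0; exists 1 => // y _.
by rewrite subrr sub0r mulr0 oppr0 modulus0 mulr_ge0 ?modulus_ge0// ltW.
Qed.

Lemma gdiff_ext f g x c (r : R) : 0 < r ->
  (forall y, modulus (emb (y - x)) < r -> f y = g y) -> f x = g x ->
  gdiff emb f x c -> gdiff emb g x c.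
Proof.
move=> r0 fg fgx df e e0; have [d d0 H] := df e e0.
exists (Num.min d r); first by rewrite lt_min d0.
by move=> y; rewrite lt_min => /andP[yd yr]; rewrite -fg// -fgx; exact: H.
Qed.

Lemma gdiffD f g x c c' : gdiff emb f x c -> gdiff emb g x c' ->
  gdiff emb (fun y => f y + g y) x (c + c').
Proof.
move=> df dg e e0; have e2 : 0 < e / 2 by rewrite divr_gt0.
have [d d0 H] := df _ e2; have [d' d'0 H'] := dg _ e2.
exists (Num.min d d'); first by rewrite lt_min d0.
move=> y; rewrite lt_min => /andP[/H h /H' h'].
have -> : f y + g y - (f x + g x) - emb (y - x) * (c + c') =
  (f y - f x - emb (y - x) * c) + (g y - g x - emb (y - x) * c') by ring.
apply: (le_trans (modulusD _ _)); move: (lerD h h'); lra.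
Qed.

Lemma gdiff_cont f x c : gdiff emb f x c -> gcont emb f x.
Proof.
move=> df e e0; have [d d0 H] := df 1 ltr01.
have cp : 0 < 1 + modulus c by have := modulus_ge0 c; lra.
exists (Num.min d (e / (1 + modulus c))).
  by rewrite lt_min d0 divr_gt0.
move=> y; rewrite lt_min ltr_pdivlMr// => /andP[yd ye].
rewrite -(subrK (emb (y - x) * c) (f y - f x)).
apply: (le_lt_trans (modulusD _ _)); rewrite modulusM.
by apply: le_lt_trans ye; rewrite mulrDr mulr1 lerD2r (le_trans (H _ yd))// mul1r.
Qed.

Lemma gcont_bnd f x : gcont emb f x -> exists2 d : R, 0 < d &
  forall y, modulus (emb (y - x)) < d -> modulus (f y) <= modulus (f x) + 1.
Proof.
move=> /(_ 1 ltr01)[d d0 H]; exists d => // y /H /ltW h.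
rewrite -(subrK (f x) (f y)); apply: (le_trans (modulusD _ _)).
by rewrite addrC lerD2l.
Qed.

Lemma gdiffM f g x c c' : gdiff emb f x c -> gdiff emb g x c' ->
  gdiff emb (fun y => f y * g y) x (c * g x + f x * c').
Proof.
move=> df dg e e0.
have [d1 d10 B] := gcont_bnd (gdiff_cont dg).
(* The Leibniz error splits into three terms whose extra factors are |g y| <= |g x| + 1, |f x| and
   |c|; [K] dominates each of them. *)
pose K := modulus (g x) + 1 + modulus (f x) + modulus c + 1.
have K0 : 0 < K.
  by rewrite /K; have := modulus_ge0 (g x); have := modulus_ge0 (f x);
    have := modulus_ge0 c; lra.
have e3 : 0 < e / 3 / K by rewrite !divr_gt0.
have [d d0 H] := df _ e3; have [d' d'0 H'] := dg _ e3.
have [d2 d20 H2] := gdiff_cont dg e3.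
exists (Num.min (Num.min d d') (Num.min d1 d2)).
  by rewrite !lt_min d0 d'0 d10 d20.
move=> y; rewrite !lt_min => /andP[/andP[/H h /H' h'] /andP[/B b /H2 h2]].
set E0 := emb (y - x) in h h' *.
have -> : f y * g y - f x * g x - E0 * (c * g x + f x * c') =
  (f y - f x - E0 * c) * g y + f x * (g y - g x - E0 * c')
  + E0 * c * (g y - g x) by ring.
apply: (le_trans (modulusD _ _)).
have -> : e * modulus E0 = (e / 3 * modulus E0 + e / 3 * modulus E0) + e / 3 * modulus E0.
  by field.
have eK X : 0 <= X -> X <= K -> e / 3 / K * modulus E0 * X <= e / 3 * modulus E0.
  move=> X0 XK; rewrite -mulrA (mulrC (modulus E0)) mulrA ler_wpM2r ?modulus_ge0//.
  by rewrite mulrAC ler_pdivrMr// ler_wpM2l// divr_ge0// ltW.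
have G0 := modulus_ge0 (g x). have F0 := modulus_ge0 (f x). have C0 := modulus_ge0 c.
apply: lerD.
  apply: (le_trans (modulusD _ _)); rewrite !modulusM; apply: lerD.
    apply: (le_trans (ler_pM _ _ h b)); rewrite ?modulus_ge0//.
    by apply: eK; rewrite /K; lra.
  rewrite mulrC.
  apply: (le_trans (ler_wpM2r _ h')); rewrite ?modulus_ge0//.
  by apply: eK; rewrite /K; lra.
rewrite !modulusM -mulrA mulrC.
apply: (le_trans (ler_wpM2r (modulus_ge0 _) (ler_wpM2l (modulus_ge0 _) (ltW h2)))).
have -> : modulus c * (e / 3 / K) * modulus E0 = e / 3 / K * modulus E0 * modulus c by ring.
by apply: eK; rewrite /K; lra.
Qed.

Lemma gdiff_comp (f : R[i] -> R[i]) g x c c' : cdiff f (g x) c ->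
  gdiff emb g x c' -> gdiff emb (f \o g) x (c' * c).
Proof.
move=> df dg e e0.
pose K := 1 + modulus c' + modulus c.
have c0 := modulus_ge0 c; have c'0 := modulus_ge0 c'.
have K0 : 0 < K by rewrite /K; lra.
have e2 : 0 < e / 2 / K by rewrite !divr_gt0.
have [d d0 H] := df _ e2.
have [d1 d10 H1] := dg _ e2; have [d2 d20 H2] := gdiff_cont dg d0.
have [d3 d30 H3] := dg _ ltr01.
exists (Num.min (Num.min d1 d2) d3); first by rewrite !lt_min d10 d20 d30.
move=> y; rewrite !lt_min => /andP[/andP[/H1 h1 /H2 /H h2] /H3 h3] /=.
set E0 := emb (y - x) in h1 h3 *.
have -> : f (g y) - f (g x) - E0 * (c' * c) =
  (f (g y) - f (g x) - (g y - g x) * c) + (g y - g x - E0 * c') * c by ring.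
apply: (le_trans (modulusD _ _)); rewrite modulusM.
have -> : e * modulus E0 = e / 2 * modulus E0 + e / 2 * modulus E0 by field.
have eK X : 0 <= X -> X <= K -> e / 2 / K * modulus E0 * X <= e / 2 * modulus E0.
  move=> X0 XK; rewrite -mulrA (mulrC (modulus E0)) mulrA ler_wpM2r ?modulus_ge0//.
  by rewrite mulrAC ler_pdivrMr// ler_wpM2l// divr_ge0// ltW.
apply: lerD.
  have h4 : modulus (g y - g x) <= modulus E0 * (1 + modulus c').
    rewrite -(subrK (E0 * c') (g y - g x)); apply: (le_trans (modulusD _ _)).
    by rewrite modulusM mulrDr mulr1 lerD2r (le_trans h3)// mul1r.
  apply: (le_trans h2); apply: le_trans (ler_wpM2l (ltW e2) h4) _.
  by rewrite mulrA; apply: eK; rewrite /K; lra.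
apply: (le_trans (ler_wpM2r c0 h1)); apply: eK; rewrite /K; lra.
Qed.

Lemma gcont_cst c x : gcont emb (fun=> c) x.
Proof. by move=> e e0; exists 1 => // y _; rewrite subrr modulus0. Qed.

Lemma gcontD f g x : gcont emb f x -> gcont emb g x ->
  gcont emb (fun y => f y + g y) x.
Proof.
move=> cf cg e e0; have e2 : 0 < e / 2 by rewrite divr_gt0.
have [d d0 H] := cf _ e2; have [d' d'0 H'] := cg _ e2.
exists (Num.min d d'); first by rewrite lt_min d0.
move=> y; rewrite lt_min => /andP[/H h /H' h'].
have -> : f y + g y - (f x + g x) = (f y - f x) + (g y - g x) by ring.
by apply: (le_lt_trans (modulusD _ _)); move: (ltrD h h'); lra.
Qed.

Lemma gcontM f g x : gcont emb f x -> gcont emb g x ->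
  gcont emb (fun y => f y * g y) x.
Proof.
move=> cf cg e e0; pose K := modulus (f x) + modulus (g x) + 2.
have F0 := modulus_ge0 (f x); have G0 := modulus_ge0 (g x).
have K0 : 0 < K by rewrite /K; lra.
have e2 : 0 < e / 2 / K by rewrite !divr_gt0.
have [d d0 H] := cf _ e2; have [d' d'0 H'] := cg _ e2; have [d2 d20 B] := gcont_bnd cg.
exists (Num.min (Num.min d d') d2); first by rewrite !lt_min d0 d'0.
move=> y; rewrite !lt_min => /andP[/andP[/H h /H' h'] /B b].
have -> : f y * g y - f x * g x = (f y - f x) * g y + f x * (g y - g x) by ring.
apply: (le_lt_trans (modulusD _ _)); rewrite !modulusM.
have h1 : modulus (f y - f x) * modulus (g y) <= e / 2 / K * (modulus (g x) + 1).
  by apply: ler_pM => //; rewrite ?modulus_ge0// ltW.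
have h2 : modulus (f x) * modulus (g y - g x) <= modulus (f x) * (e / 2 / K).
  by apply: ler_wpM2l => //; rewrite ltW.
apply: le_lt_trans (lerD h1 h2) _.
have -> : e / 2 / K * (modulus (g x) + 1) + modulus (f x) * (e / 2 / K) =
  e / 2 * ((K - 1) / K) by rewrite /K; field; apply: lt0r_neq0.
have : (K - 1) / K < 1 by rewrite ltr_pdivrMr// mul1r; lra.
nra.
Qed.

Lemma gcont_comp (f : R[i] -> R[i]) g x : gcont id f (g x) -> gcont emb g x ->
  gcont emb (f \o g) x.
Proof.
move=> cf cg e /cf[d d0 Hd]; have [d' d'0 Hd'] := cg d d0.
by exists d' => // y /Hd'; exact: Hd.
Qed.

Lemma gdiff_sum n (f : nat -> E -> R[i]) (c : nat -> R[i]) x :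
  (forall k, (k < n)%N -> gdiff emb (f k) x (c k)) ->
  gdiff emb (fun y => \sum_(k < n) f k y) x (\sum_(k < n) c k).
Proof.
elim: n => [|n IH] H.
  rewrite big_ord0 (_ : (fun y => _) = fun=> 0); first exact: gdiff_cst.
  by apply: funext => y; rewrite big_ord0.
rewrite big_ord_recr (_ : (fun y => _) = fun y => \sum_(k < n) f k y + f n y).
  by apply: gdiffD; [apply: IH => k kn; apply: H; exact: ltnW|exact: H].
by apply: funext => y; rewrite big_ord_recr.
Qed.

End Rules.

Lemma cdiff_id (x : R[i]) : cdiff id x 1.
Proof.
move=> e e0; exists 1 => // y _.
by rewrite /= mulr1 subrr modulus0 mulr_ge0 ?modulus_ge0// ltW.
Qed.

Lemma cdiff_inv (z : R[i]) : z != 0 -> cdiff (@GRing.inv _) z (- (z ^+ 2)^-1).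
Proof.
move=> z0 e e0; have mz : 0 < modulus z by rewrite modulus_gt0.
(* The error is exactly (w - z)^2 / (z^2 w). The first bound gives |w| > |z|/2, and the second then
   makes the error at most e |w - z|. *)
exists (Num.min (modulus z / 2) (e * modulus z ^+ 3 / 2)).
  by rewrite lt_min !divr_gt0// mulr_gt0// exprn_gt0.
move=> w; rewrite lt_min => /andP[h1 h2].
have mw : modulus z / 2 < modulus w.
  have := ler_modulusB z w; rewrite modulusB; move: h1; lra.
have w0 : w != 0 by rewrite -modulus_gt0; apply: lt_trans mw; rewrite divr_gt0.
have -> : w^-1 - z^-1 - (w - z) * - (z ^+ 2)^-1 = (w - z) * ((w - z) / (z ^+ 2 * w)).
  by field; rewrite w0 z0.
rewrite modulusM mulrC ler_wpM2r ?modulus_ge0//.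
have mw0 : 0 < modulus w by rewrite modulus_gt0.
rewrite modulusM modulusV modulusM modulusX ler_pdivrMr ?mulr_gt0 ?exprn_gt0//.
apply: (le_trans (ltW h2)); have : e * modulus z ^+ 2 * (modulus z / 2) <= e * modulus z ^+ 2 * modulus w.
  by rewrite ler_wpM2l ?(ltW mw)// mulr_ge0 ?exprn_ge0 ?modulus_ge0// ltW.
rewrite (_ : _ * (modulus z / 2) = e * modulus z ^+ 3 / 2); last by ring.
by rewrite (mulrA e (modulus z ^+ 2)).
Qed.

(** Multiplying the difference quotient out removes the punctured neighbourhood. Over a general
    [numFieldType] the equivalence serves both [R] and [R[i]], where [e] and [d] are themselves
    complex. *)
Lemma num_diffP (K : numFieldType) (f : K^o -> K^o) (z c : K) :
  is_derive (z : K^o) 1 f c <-> forall e : K, 0 < e -> exists2 d : K, 0 < d &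
    forall w, `|w - z| < d -> `|f w - f z - (w - z) * c| <= e * `|w - z|.
Proof.
have E : is_derive (z : K^o) 1 f c <->
    (h^-1 *: (f (h *: 1 + z) - f z)) @[h --> (0 : K^o)^'] --> (c : K^o).
  split=> [[df <-]|H]; first exact: df.
  by split; [apply/cvg_ex; exists c|apply/cvg_lim => //; exact: norm_hausdorff].
apply: (iff_trans E); split=> [/cvgrPdist_le H e e0|H].
  have /= := H e e0; rewrite near_withinE => /nbhs_normP[d /= d0 Hd].
  exists d => // w wz; have [->|wzN] := eqVneq w z.
    by rewrite !subrr mul0r subrr normr0 mulr0.
  have := Hd (w - z); rewrite /= sub0r normrN subr_eq0 => /(_ wz wzN).
  rewrite /GRing.scale /= mulr1 subrK => h.
  have wz0 : w - z != 0 by rewrite subr_eq0.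
  have -> : f w - f z - (w - z) * c = - ((w - z) * (c - (w - z)^-1 * (f w - f z))).
    by field.
  by rewrite normrN normrM mulrC ler_wpM2r.
apply/cvgrPdist_le => e e0 /=; have [d d0 Hd] := H e e0.
rewrite near_withinE; apply/nbhs_normP; exists d => //= h; rewrite /ball_ /=.
rewrite sub0r normrN => hd h0; rewrite /GRing.scale /= mulr1.
have := Hd (h + z); rewrite addrK => /(_ hd) k.
have -> : c - h^-1 * (f (h + z) - f z) = - (h^-1 * (f (h + z) - f z - h * c)).
  by field.
by rewrite normrN normrM normfV mulrC ler_pdivrMr ?normr_gt0.
Qed.

Lemma real_diffP (f : R -> R) (z c : R) :
  is_derive z 1 f c <-> forall e : R, 0 < e -> exists2 d : R, 0 < d &
    forall w, `|w - z| < d -> `|f w - f z - (w - z) * c| <= e * `|w - z|.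
Proof. exact: (@num_diffP R f z c). Qed.

Lemma cdiff_is_derive (f : R[i] -> R[i]) z c :
  cdiff f z c <-> is_derive (z : R[i]^o) 1 (f : R[i]^o -> R[i]^o) c.
Proof.
apply: iff_sym; apply: (iff_trans (@num_diffP _ f z c)); split=> H e e0.
  have ec : 0 < e%:C :> R[i] by rewrite -[0]/(0%:C) ltcR.
  have [d d0 Hd] := H _ ec.
  (* A positive element of [R[i]] has zero imaginary part, so a complex radius is a real one. *)
  have dE : d = (complex.Re d)%:C by case: d d0 {Hd} => a b; rewrite ltcE /= => /andP[/eqP -> _].
  exists (complex.Re d); first by move: d0; rewrite {1}dE -[0]/(0%:C) ltcR.
  move=> w; rewrite -ltcR -dE -normCE => /Hd.
  by rewrite !normCE -rmorphM lecR.
have eE : e = (complex.Re e)%:C by case: e e0 => a b; rewrite ltcE /= => /andP[/eqP -> _].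
have er : 0 < complex.Re e by move: e0; rewrite {1}eE -[0]/(0%:C) ltcR.
have [d d0 Hd] := H _ er; exists (d%:C); first by rewrite -[0]/(0%:C) ltcR.
move=> w; rewrite normCE ltcR => /Hd; rewrite eE !normCE -rmorphM lecR.
by [].
Qed.

Lemma cdiff_cderiv (f : R[i] -> R[i]) z c : cdiff f z c -> cderiv f z = c.
Proof. by move=> /cdiff_is_derive[]. Qed.

Lemma cdiff_derivable (f : R[i] -> R[i]) z c : cdiff f z c ->
  derivable (f : R[i]^o -> R[i]^o) z 1.
Proof. by move=> /cdiff_is_derive[]. Qed.

Lemma analytic_cdiff (f : R[i] -> R[i]) z : analytic f -> unit_disc z ->
  cdiff f z (cderiv f z).
Proof. by move=> /[apply] df; apply/cdiff_is_derive; exact/derivableP. Qed.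

Lemma gdiff_unique (f : R[i] -> R[i]) z c c' : cdiff f z c -> cdiff f z c' -> c = c'.
Proof. by move=> /cdiff_cderiv <- /cdiff_cderiv <-. Qed.

Lemma pdiff_is_derive (f : R -> R[i]) t c : pdiff f t c <->
  is_derive t 1 (fun t => complex.Re (f t)) (complex.Re c) /\
  is_derive t 1 (fun t => complex.Im (f t)) (complex.Im c).
Proof.
split=> [H|[/real_diffP HR /real_diffP HI] e e0].
  split; apply/real_diffP => e e0; have [d d0 Hd] := H e e0; exists d => // w.
    move: (Hd w); rewrite modulus_real => /[apply]; apply: le_trans.
    apply: le_trans (Re_le_modulus _).
    by rewrite !ReD !ReN ReM /= mul0r subr0.
  move: (Hd w); rewrite modulus_real => /[apply]; apply: le_trans.
  apply: le_trans (Im_le_modulus _).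
  by rewrite !ImD !ImN ImM /= mul0r addr0.
have e2 : 0 < e / 2 by rewrite divr_gt0.
have [d d0 Hd] := HR _ e2; have [d' d'0 Hd'] := HI _ e2.
exists (Num.min d d'); first by rewrite lt_min d0.
move=> s; rewrite modulus_real lt_min => /andP[/Hd h /Hd' h'].
apply: (le_trans (modulus_le_ReIm _)).
rewrite !ReD !ReN ReM !ImD !ImN ImM /= !mul0r subr0 addr0.
by move: (lerD h h'); lra.
Qed.

End Gdiff.

(** * Integrals over [0, 1] and along segments *)

Section SegmentIntegral.
Variable R : realType.
Implicit Types (F G : R -> R[i]) (f : R[i] -> R[i]) (s t : R).

Definition path_cont F := forall t : R, 0 <= t <= 1 -> pcont F t.

Lemma real_contP (f : R -> R) (x : R) :
  {for x, continuous f} <-> forall e : R, 0 < e -> exists2 d : R, 0 < d &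
    forall y, `|y - x| < d -> `|f y - f x| < e.
Proof.
split=> [/cvgrPdist_lt H e e0|H].
  have /= := H e e0 => /nbhs_normP[d /= d0 Hd]; exists d => // y yd.
  by rewrite distrC; apply: Hd; rewrite /ball_ /= distrC.
apply/cvgrPdist_lt => e e0; have [d d0 Hd] := H e e0.
by apply/nbhs_normP; exists d => // y; rewrite /ball_ /= distrC => /Hd; rewrite distrC.
Qed.

Lemma pcont_Re F t : pcont F t -> {for t, continuous (fun t => complex.Re (F t))}.
Proof.
move=> cF; apply/real_contP => e /cF[d d0 Hd]; exists d => // y.
rewrite -modulus_real => /Hd; apply: le_lt_trans.
by apply: le_trans (Re_le_modulus _); rewrite ReD ReN.
Qed.

Lemma pcont_Im F t : pcont F t -> {for t, continuous (fun t => complex.Im (F t))}.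
Proof.
move=> cF; apply/real_contP => e /cF[d d0 Hd]; exists d => // y.
rewrite -modulus_real => /Hd; apply: le_lt_trans.
by apply: le_trans (Im_le_modulus _); rewrite ImD ImN.
Qed.

Lemma pcont_ReIm F t : {for t, continuous (fun t => complex.Re (F t))} ->
  {for t, continuous (fun t => complex.Im (F t))} -> pcont F t.
Proof.
move=> /real_contP HR /real_contP HI e e0; have e2 : 0 < e / 2 by rewrite divr_gt0.
have [d d0 Hd] := HR _ e2; have [d' d'0 Hd'] := HI _ e2.
exists (Num.min d d'); first by rewrite lt_min d0.
move=> s; rewrite modulus_real lt_min => /andP[/Hd h /Hd' h'].
apply: (le_lt_trans (modulus_le_ReIm _)); rewrite !ReD !ReN !ImD !ImN.
by move: (ltrD h h'); lra.
Qed.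

Lemma within01 (f : R -> R) :
  (forall t, 0 <= t <= 1 -> {for t, continuous f}) -> {within `[0, 1], continuous f}.
Proof.
by move=> cf; apply: continuous_in_subspaceT => t; rewrite inE /= in_itv /=; exact: cf.
Qed.

Lemma cont01_integrable (f : R -> R) :
  (forall t, 0 <= t <= 1 -> {for t, continuous f}) ->
  lebesgue_measure.-integrable `[0%R, 1%R] (EFin \o f).
Proof.
move=> cf; apply: continuous_compact_integrable; first exact: segment_compact.
exact: within01.
Qed.

Lemma path_Re_integrable F : path_cont F ->
  lebesgue_measure.-integrable `[0%R, 1%R] (EFin \o (fun t => complex.Re (F t))).
Proof. by move=> cF; apply: cont01_integrable => t /cF; exact: pcont_Re. Qed.

Lemma path_Im_integrable F : path_cont F ->
  lebesgue_measure.-integrable `[0%R, 1%R] (EFin \o (fun t => complex.Im (F t))).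
Proof. by move=> cF; apply: cont01_integrable => t /cF; exact: pcont_Im. Qed.

Lemma eq_integral01 F G : (forall t, 0 <= t <= 1 -> F t = G t) ->
  integral01 F = integral01 G.
Proof.
move=> FG; rewrite /integral01; congr Complex; apply: eq_Rintegral => t;
  by rewrite inE /= in_itv /= => /FG ->.
Qed.

Lemma integral01D F G : path_cont F -> path_cont G ->
  integral01 (fun t => F t + G t) = integral01 F + integral01 G.
Proof.
move=> cF cG; apply: complexP; rewrite ?ReD ?ImD /=.
  rewrite -RintegralD//; [|exact: path_Re_integrable|exact: path_Re_integrable].
  by apply: eq_Rintegral => t _; rewrite ReD.
rewrite -RintegralD//; [|exact: path_Im_integrable|exact: path_Im_integrable].
by apply: eq_Rintegral => t _; rewrite ImD.
Qed.

Lemma integral01Z c F : path_cont F ->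
  integral01 (fun t => c * F t) = c * integral01 F.
Proof.
move=> cF.
have I r G : path_cont G -> lebesgue_measure.-integrable `[0%R, 1%R]
    (EFin \o (fun t => r * complex.Re (G t))).
  by move=> cG; apply: cont01_integrable => t /cG /pcont_Re H; apply: continuousM => //; exact: cst_continuous.
have J r G : path_cont G -> lebesgue_measure.-integrable `[0%R, 1%R]
    (EFin \o (fun t => r * complex.Im (G t))).
  by move=> cG; apply: cont01_integrable => t /cG /pcont_Im H; apply: continuousM => //; exact: cst_continuous.
apply: complexP; rewrite ?ReM ?ImM /=.
  rewrite -!RintegralZl//; [|exact: path_Im_integrable|exact: path_Re_integrable].
  rewrite -RintegralB//; [|exact: I|exact: J].
  by apply: eq_Rintegral => t _; rewrite ReM.
rewrite -!RintegralZl//; [|exact: path_Re_integrable|exact: path_Im_integrable].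
rewrite -RintegralD//; [|exact: J|exact: I].
by apply: eq_Rintegral => t _; rewrite ImM.
Qed.

Lemma Rintegral01_le (f : R -> R) M :
  (forall t, 0 <= t <= 1 -> {for t, continuous f}) ->
  (forall t, 0 <= t <= 1 -> `|f t| <= M) ->
  `|\int[lebesgue_measure]_(t in `[0%R, 1%R]) f t| <= M.
Proof.
move=> cf fM; have fi := cont01_integrable cf.
apply: le_trans (le_normr_Rintegral _ fi) _ => //.
have -> : M = \int[lebesgue_measure]_(t in `[0%R, 1%R]) (cst M t).
  rewrite Rintegral_cst//= lebesgue_measure_itv /= lte_fin ltr01.
  by rewrite oppr0 adde0 /= mulr1.
apply: le_Rintegral => //.
- exact: (integrable_norm fi).
- by apply: (@cont01_integrable (cst M)) => t _; exact: cst_continuous.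
Qed.

(** The factor 2 comes from bounding the real and imaginary parts separately. *)
Lemma integral01_le F M : path_cont F ->
  (forall t, 0 <= t <= 1 -> modulus (F t) <= M) -> modulus (integral01 F) <= 2 * M.
Proof.
move=> cF FM; apply: (le_trans (modulus_le_ReIm _)); rewrite mulr_natl mulr2n.
apply: lerD => /=; apply: Rintegral01_le => t t01.
- exact/pcont_Re/cF.
- exact: le_trans (Re_le_modulus _) (FM _ t01).
- exact/pcont_Im/cF.
- exact: le_trans (Im_le_modulus _) (FM _ t01).
Qed.

Lemma is_derive_cont (f : R -> R) (x c : R) : is_derive x 1 f c ->
  {for x, continuous f}.
Proof. by move=> [df _]; apply/differentiable_continuous/derivable1_diffP. Qed.

Lemma real_FTC01 (g f : R -> R) :
  (forall t : R, 0 <= t <= 1 -> {for t, continuous f}) ->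
  (forall t, 0 <= t <= 1 -> is_derive t 1 g (f t)) ->
  \int[lebesgue_measure]_(t in `[0%R, 1%R]) f t = g 1 - g 0.
Proof.
move=> cf dg; rewrite /Rintegral (@continuous_FTC2 _ f g 0 1) //=.
- exact: within01.
- split.
  + move=> t; rewrite in_itv /= => /andP[t0 t1].
    by have [] := dg t; rewrite ?(ltW t0) ?(ltW t1).
  + by apply: cvg_at_right_filter; apply: is_derive_cont (dg 0 _); rewrite lexx ler01.
  + by apply: cvg_at_left_filter; apply: is_derive_cont (dg 1 _); rewrite lexx ler01.
- move=> t; rewrite in_itv /= => /andP[t0 t1]; rewrite derive1E.
  by have [|_ ->//] := dg t; rewrite ?(ltW t0) ?(ltW t1).
Qed.

Lemma integral01_FTC F G : path_cont F ->
  (forall t, 0 <= t <= 1 -> pdiff G t (F t)) -> integral01 F = G 1 - G 0.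
Proof.
move=> cF dG; apply: complexP; rewrite ?ReD ?ImD ?ReN ?ImN /=.
  apply: (real_FTC01 (g := fun t => complex.Re (G t))) => t t01.
    exact/pcont_Re/cF.
  by have /pdiff_is_derive[] := dG t t01.
apply: (real_FTC01 (g := fun t => complex.Im (G t))) => t t01.
  exact/pcont_Im/cF.
by have /pdiff_is_derive[] := dG t t01.
Qed.

(** The retraction of the line onto [0, 1]: composing with it extends a function continuous at the
    points of [0, 1] to one continuous everywhere. *)
Definition clamp (t : R) : R := Num.max 0 (Num.min 1 t).

Lemma clamp01 t : 0 <= clamp t <= 1.
Proof. by rewrite /clamp le_max lexx /= ge_max ler01 ge_min lexx. Qed.

Lemma clamp_id t : 0 <= t <= 1 -> clamp t = t.
Proof. by move=> /andP[t0 t1]; rewrite /clamp (min_idPr t1) (max_idPr t0). Qed.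

Lemma clamp_lip s t : `|clamp s - clamp t| <= `|s - t|.
Proof.
have H x : [\/ x <= 0 /\ clamp x = 0, 0 <= x <= 1 /\ clamp x = x | 1 <= x /\ clamp x = 1].
  case/orP: (le_total x 0) => x0.
    by constructor 1; split=> //; rewrite /clamp (min_idPr (le_trans x0 ler01)) (max_idPl x0).
  case/orP: (le_total x 1) => x1; first by constructor 2; rewrite clamp_id x0.
  by constructor 3; rewrite /clamp (min_idPl x1) (max_idPr ler01).
rewrite ler_norml.
by case: (H s) => -[/=]; case: (H t) => -[/=]; try move=> /andP[+ +];
  case: (ger0P (s - t)) => ? ? ?; try (move=> ?); try (move=> /andP[? ?]);
  move=> *; do ?[match goal with K : is_true (_ && _) |- _ => move/andP: K => [] end];
  move=> *; do ?[match goal with K : clamp _ = _ |- _ => rewrite {}K end]; apply/andP; split; lra.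
Qed.

Lemma real_antiderivative (f : R -> R) :
  (forall t, 0 <= t <= 1 -> {for t, continuous f}) ->
  exists g : R -> R, forall t, 0 <= t <= 1 -> is_derive t 1 g (f (clamp t)).
Proof.
move=> cf; pose h := f \o clamp.
have ch t : {for t, continuous h}.
  apply: continuous_comp; last exact/cf/clamp01.
  apply/real_contP => e e0; exists e => // y; apply: le_lt_trans.
  exact: clamp_lip.
(* With -1 as base point all of [0, 1] is interior to the interval of integration, so the derivative
   is two-sided at 0 and 1 as well. *)
exists (fun x => \int[lebesgue_measure]_(t in `[-1, x]) h t) => t /andP[t0 t1].
have [||||dG E] := @continuous_FTC1_closed _ h (-1) t 2.
- by apply: le_lt_trans t1 _; rewrite ltr1n.
- apply: continuous_compact_integrable; first exact: segment_compact.
  by apply: continuous_subspaceT => x; exact: ch.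
- by apply: lt_le_trans t0; rewrite oppr_lt0.
- exact: ch.
by split; [exact: dG|rewrite -derive1E; exact: E].
Qed.

Lemma path_antiderivative F : path_cont F ->
  exists G, forall t, 0 <= t <= 1 -> pdiff G t (F t).
Proof.
move=> cF.
have [gr Hr] := @real_antiderivative (fun t => complex.Re (F t))
  (fun t t01 => pcont_Re (cF t t01)).
have [gi Hi] := @real_antiderivative (fun t => complex.Im (F t))
  (fun t t01 => pcont_Im (cF t t01)).
exists (fun t => gr t +i* gi t) => t t01; apply/pdiff_is_derive; split => /=.
  by have := Hr t t01; rewrite clamp_id.
by have := Hi t t01; rewrite clamp_id.
Qed.

Lemma pdiff_affine (a b : R[i]) t : pdiff (fun t : R => a + t%:C * b) t b.
Proof.
move=> e e0; exists 1 => // y _.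
have -> : a + y%:C * b - (a + t%:C * b) - (y - t)%:C * b = 0.
  by rewrite rmorphB /=; ring.
by rewrite modulus0 mulr_ge0 ?modulus_ge0// ltW.
Qed.

Lemma pcont_comp f (g : R -> R[i]) t : ccont f (g t) -> pcont g t -> pcont (f \o g) t.
Proof. exact: gcont_comp. Qed.

Lemma pcontM F G t : pcont F t -> pcont G t -> pcont (fun t => F t * G t) t.
Proof. exact: gcontM. Qed.

Lemma pcontD F G t : pcont F t -> pcont G t -> pcont (fun t => F t + G t) t.
Proof. exact: gcontD. Qed.

Lemma pcont_cst (c : R[i]) t : pcont (fun=> c : R[i]) t.
Proof. exact: gcont_cst. Qed.

Lemma path_cont_reparam F (al be : R) : path_cont F ->
  (forall t, 0 <= t <= 1 -> 0 <= al + be * t <= 1) ->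
  path_cont (fun t => F (al + be * t)).
Proof.
move=> cF H t t01; apply: pcont_ReIm.
  apply: (@continuous_comp _ _ _ (fun t => al + be * t) (fun s => complex.Re (F s))).
    by apply: continuousD; [exact: cst_continuous|apply: continuousM; [exact: cst_continuous|exact: cvg_id]].
  exact/pcont_Re/cF/H.
apply: (@continuous_comp _ _ _ (fun t => al + be * t) (fun s => complex.Im (F s))).
  by apply: continuousD; [exact: cst_continuous|apply: continuousM; [exact: cst_continuous|exact: cvg_id]].
exact/pcont_Im/cF/H.
Qed.

(** Affine substitution, by the chain rule for the antiderivative [G]. Keeping [be] as a factor on
    the left avoids a division, so that reversal ([be = -1]) and degenerate pieces ([be = 0]) are
    covered alike. *)
Lemma integral01_reparam F G (al be : R) : path_cont F ->
  (forall t, 0 <= t <= 1 -> pdiff G t (F t)) ->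
  (forall t, 0 <= t <= 1 -> 0 <= al + be * t <= 1) ->
  be%:C * integral01 (fun t => F (al + be * t)) = G (al + be) - G al.
Proof.
move=> cF dG H; have cH := path_cont_reparam cF H.
rewrite -integral01Z// (integral01_FTC (G := fun t => G (al + be * t))).
- by rewrite mulr1 mulr0 addr0.
- by move=> t t01; apply: pcontM; [exact: pcont_cst|exact: cH].
move=> t t01; have /pdiff_is_derive[dr di] := dG _ (H t t01).
have da : is_derive t 1 (fun t => al + be * t) be.
  apply/real_diffP => e e0; exists 1 => // w _.
  by rewrite (_ : _ - _ - _ = 0) ?normr0 ?mulr_ge0// 1?ltW//; ring.
apply/pdiff_is_derive; split.
  have := @is_derive1_comp _ (fun s => complex.Re (G s)) (fun t => al + be * t) t _ _ dr da.
  by rewrite ReM /= mul0r subr0 mulrC.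
have := @is_derive1_comp _ (fun s => complex.Im (G s)) (fun t => al + be * t) t _ _ di da.
by rewrite ImM /= mul0r addr0 mulrC.
Qed.

Definition seg f (a b : R[i]) : R[i] :=
  (b - a) * integral01 (fun t : R => f (a + t%:C * (b - a))).

Lemma pcont_affine (a b : R[i]) t : pcont (fun t : R => a + t%:C * b) t.
Proof. exact: gdiff_cont (pdiff_affine _ _ _). Qed.

Definition seg_cont f a b :=
  forall t : R, 0 <= t <= 1 -> ccont f (a + t%:C * (b - a)).

Lemma seg_path_cont f a b : seg_cont f a b ->
  path_cont (fun t : R => f (a + t%:C * (b - a))).
Proof.
move=> cf t t01; apply: (@pcont_comp f (fun t : R => a + t%:C * (b - a))).
  exact: cf.
exact: pcont_affine.
Qed.

Lemma seg_FTC f g a b : seg_cont f a b ->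
  (forall t : R, 0 <= t <= 1 ->
     cdiff g (a + t%:C * (b - a)) (f (a + t%:C * (b - a)))) ->
  seg f a b = g b - g a.
Proof.
move=> cf dg; rewrite /seg -integral01Z; last exact: seg_path_cont.
rewrite (integral01_FTC (G := fun t : R => g (a + t%:C * (b - a)))).
- by rewrite rmorph1 rmorph0 mul1r mul0r addr0 (addrC a) subrK.
- by move=> t t01; apply: pcontM; [exact: pcont_cst|exact: seg_path_cont].
move=> t t01; apply: (@gdiff_comp _ _ _ g (fun t : R => a + t%:C * (b - a))).
  exact: dg.
exact: pdiff_affine.
Qed.

Lemma seg_le f a b M : seg_cont f a b ->
  (forall t : R, 0 <= t <= 1 -> modulus (f (a + t%:C * (b - a))) <= M) ->
  modulus (seg f a b) <= 2 * M * modulus (b - a).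
Proof.
move=> cf fM; rewrite /seg modulusM mulrC ler_wpM2r ?modulus_ge0//.
by apply: integral01_le; first exact: seg_path_cont.
Qed.

Lemma segD f g a b : seg_cont f a b -> seg_cont g a b ->
  seg (fun z => f z + g z) a b = seg f a b + seg g a b.
Proof.
by move=> cf cg; rewrite /seg integral01D ?mulrDr//; exact: seg_path_cont.
Qed.

Lemma segZ f c a b : seg_cont f a b -> seg (fun z => c * f z) a b = c * seg f a b.
Proof. by move=> cf; rewrite /seg (@integral01Z c _ (seg_path_cont cf)) mulrCA. Qed.

Lemma seg_anti f a b : seg_cont f a b -> seg f b a = - seg f a b.
Proof.
move=> cf; have cp := seg_path_cont cf.
have [G dG] := path_antiderivative cp.
rewrite {2}/seg (integral01_FTC cp dG) /seg.
have H : - integral01 (fun t => f (a + (1 + -1 * t)%:C * (b - a))) = G 0 - G 1.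
  have := @integral01_reparam _ G 1 (-1) cp dG.
  rewrite subrr rmorphN rmorph1 mulN1r; apply => t /andP[? ?]; lra.
rewrite -(opprB (G 0)) mulrN opprK -H mulrN -mulNr opprB; congr (_ * _).
apply: eq_integral01 => t _; congr f.
rewrite rmorphD rmorphM rmorphN rmorph1; ring.
Qed.

Lemma seg_split f a b (r : R) : 0 <= r <= 1 -> seg_cont f a b ->
  seg f a b = seg f a (a + r%:C * (b - a)) + seg f (a + r%:C * (b - a)) b.
Proof.
move=> /andP[r0 r1] cf; have cp := seg_path_cont cf.
have [G dG] := path_antiderivative cp.
rewrite {1}/seg (integral01_FTC cp dG).
have H1 := @integral01_reparam _ G 0 r cp dG.
have H2 := @integral01_reparam _ G r (1 - r) cp dG.
have -> : seg f a (a + r%:C * (b - a)) = (b - a) * (G r - G 0).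
  move: H1; rewrite add0r => <-; last first.
    by move=> t /andP[t0 t1]; rewrite add0r mulr_ge0//= mulr_ile1.
  rewrite mulrA (mulrC (b - a)) /seg (addrC a) addrK; congr (_ * _).
  apply: eq_integral01 => t _; congr f.
  rewrite rmorphD rmorphM rmorph0; ring.
have -> : seg f (a + r%:C * (b - a)) b = (b - a) * (G 1 - G r).
  move: H2; rewrite (addrC r) subrK => <-; last first.
    move=> t /andP[t0 t1]; apply/andP; split.
      by rewrite addr_ge0// mulr_ge0// subr_ge0.
    have : (1 - r) * t <= (1 - r) * 1 by rewrite ler_wpM2l// subr_ge0.
    lra.
  rewrite mulrA /seg.
  have -> : b - (a + r%:C * (b - a)) = (b - a) * (1 - r)%:C.
    by rewrite rmorphB rmorph1; ring.
  congr (_ * _); apply: eq_integral01 => t _; congr f.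
  rewrite [in RHS]rmorphD [in RHS]rmorphM; ring.
ring.
Qed.

End SegmentIntegral.

(** * Goursat's theorem and primitives on the disc *)

Section Goursat.
Variable R : realType.
Implicit Types (f : R[i] -> R[i]) (a b c z w : R[i]) (r d e t : R).

Lemma seg_modulus_le a b t r : 0 <= t <= 1 -> modulus a <= r -> modulus b <= r ->
  modulus (a + t%:C * (b - a)) <= r.
Proof.
move=> /andP[t0 t1] ar br.
have -> : a + t%:C * (b - a) = (1 - t)%:C * a + t%:C * b.
  by rewrite rmorphB rmorph1; ring.
apply: (le_trans (modulusD _ _)); rewrite !modulusM !modulus_real.
rewrite !ger0_norm// ?subr_ge0//.
have : (1 - t) * modulus a <= (1 - t) * r by rewrite ler_wpM2l// subr_ge0.
have : t * modulus b <= t * r by rewrite ler_wpM2l.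
lra.
Qed.

Lemma seg_dist_le a b c t r : 0 <= t <= 1 -> modulus (a - c) <= r ->
  modulus (b - c) <= r -> modulus (a + t%:C * (b - a) - c) <= r.
Proof.
move=> t01 ar br; rewrite (_ : _ - c = (a - c) + t%:C * ((b - c) - (a - c))); last ring.
exact: seg_modulus_le.
Qed.

Lemma analytic_ccont f z : analytic f -> unit_disc z -> ccont f z.
Proof. by move=> fa zD; exact: gdiff_cont (analytic_cdiff fa zD). Qed.

Lemma disc_seg a b t : unit_disc a -> unit_disc b -> 0 <= t <= 1 ->
  unit_disc (a + t%:C * (b - a)).
Proof.
rewrite /unit_disc /= => aD bD t01.
have : Num.max (modulus a) (modulus b) < 1 by rewrite gt_max aD.
by apply: le_lt_trans; apply: seg_modulus_le; rewrite // le_max lexx ?orbT.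
Qed.

Lemma disc_seg_cont f a b : (forall z, unit_disc z -> ccont f z) ->
  unit_disc a -> unit_disc b -> seg_cont f a b.
Proof. by move=> fc aD bD t t01; apply: fc; exact: disc_seg. Qed.

Definition tri f a b c := seg f a b + seg f b c + seg f c a.

Definition mid a b : R[i] := a + (2^-1)%:C * (b - a).

Lemma half01 : 0 <= (2^-1 : R) <= 1.
Proof. by rewrite invr_ge0 ler0n invf_le1 ?ler1n. Qed.

Lemma midC a b : mid a b = mid b a.
Proof.
apply/eqP; rewrite -subr_eq0 /mid.
have -> : a + (2^-1)%:C * (b - a) - (b + (2^-1)%:C * (a - b)) =
  (1 - 2 * (2^-1)%:C) * (a - b) by ring.
by rewrite fmorphV rmorph_nat mulfV ?pnatr_eq0// subrr mul0r.
Qed.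

Lemma disc_mid a b : unit_disc a -> unit_disc b -> unit_disc (mid a b).
Proof. by move=> aD bD; exact: disc_seg half01. Qed.

(** The middle triangle is oriented so that each of its sides is run in the opposite direction by
    one corner triangle. *)
Lemma tri_split f a b c : (forall z, unit_disc z -> ccont f z) ->
  unit_disc a -> unit_disc b -> unit_disc c ->
  tri f a b c = tri f a (mid a b) (mid c a) + tri f (mid a b) b (mid b c)
    + tri f (mid c a) (mid b c) c + tri f (mid a b) (mid b c) (mid c a).
Proof.
move=> fc aD bD cD; have S x y := @disc_seg_cont f x y fc.
have [m1 m2 m3] := And3 (disc_mid aD bD) (disc_mid bD cD) (disc_mid cD aD).
rewrite /tri (seg_split half01 (S _ _ aD bD)) (seg_split half01 (S _ _ bD cD))
  (seg_split half01 (S _ _ cD aD)) -!/(mid _ _).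
rewrite (seg_anti (S _ _ m1 m2)) (seg_anti (S _ _ m2 m3)) (seg_anti (S _ _ m3 m1)).
ring.
Qed.

Lemma modulus4 (x1 x2 x3 x4 : R[i]) (M : R) : M <= modulus (x1 + x2 + x3 + x4) ->
  [\/ M / 4 <= modulus x1, M / 4 <= modulus x2, M / 4 <= modulus x3 |
      M / 4 <= modulus x4].
Proof.
move=> H.
have [?|h1] := leP (M / 4) (modulus x1); first by constructor 1.
have [?|h2] := leP (M / 4) (modulus x2); first by constructor 2.
have [?|h3] := leP (M / 4) (modulus x3); first by constructor 3.
have [?|h4] := leP (M / 4) (modulus x4); first by constructor 4.
have := modulusD (x1 + x2 + x3) x4; have := modulusD (x1 + x2) x3.
have := modulusD x1 x2; lra.
Qed.

Definition triple := (R[i] * R[i] * R[i])%type.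

Definition small_tri r d (T : triple) : Prop := let: (a, b, c) := T in
  [/\ modulus a <= r, modulus b <= r & modulus c <= r] /\
  [/\ modulus (a - b) <= d, modulus (b - c) <= d & modulus (c - a) <= d].

Definition tri_int f (T : triple) := tri f T.1.1 T.1.2 T.2.

Lemma mid_dist a b d : modulus (a - b) <= d -> modulus (mid a b - a) <= d / 2.
Proof.
move=> H; rewrite /mid addrAC subrr add0r modulusM modulus_real modulusB.
by rewrite ger0_norm ?invr_ge0// mulrC ler_wpM2r// invr_ge0.
Qed.

Lemma mid_mid a b c d : modulus (a - c) <= d -> modulus (mid a b - mid b c) <= d / 2.
Proof.
move=> H; rewrite (midC b c) /mid.
have -> : a + (2^-1)%:C * (b - a) - (c + (2^-1)%:C * (b - c)) =
  (1 - (2^-1)%:C) * (a - c) by ring.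
rewrite -(rmorph1 (real_complex R)) -rmorphB modulusM modulus_real mulrC.
rewrite (_ : 1 - 2^-1 = 2^-1 :> R); last by field.
by rewrite ger0_norm ?invr_ge0// ler_wpM2r// invr_ge0.
Qed.

Lemma goursat_step f r d M (T : triple) : (forall z, unit_disc z -> ccont f z) ->
  r < 1 -> small_tri r d T -> M <= modulus (tri_int f T) ->
  exists T', [/\ small_tri r (d / 2) T', M / 4 <= modulus (tri_int f T') &
    modulus (T'.1.1 - T.1.1) <= d].
Proof.
move=> fc r1; case: T => [[a b] c] /= [[ar br cr] [ab bc ca]].
have D x : modulus x <= r -> unit_disc x by move=> /le_lt_trans; exact.
rewrite /tri_int /= tri_split; [|exact: fc|exact: D|exact: D|exact: D].
have mr x y : modulus x <= r -> modulus y <= r -> modulus (mid x y) <= r.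
  by move=> *; apply: seg_modulus_le half01 _ _.
have [m1 m2 m3] := And3 (mr _ _ ar br) (mr _ _ br cr) (mr _ _ cr ar).
have d0 : 0 <= d by exact: le_trans (modulus_ge0 _) ab.
have dd : d / 2 <= d by lra.
have ba : modulus (b - a) <= d by rewrite modulusB.
have cb : modulus (c - b) <= d by rewrite modulusB.
have ac : modulus (a - c) <= d by rewrite modulusB.
have K x y z : modulus (x - z) <= d -> modulus (mid x y - mid y z) <= d / 2 by exact: mid_mid.
case/modulus4 => H.
- exists (a, mid a b, mid c a); split=> //=; last by rewrite subrr modulus0.
  split=> //; split.
  + by rewrite modulusB; exact: mid_dist.
  + by rewrite modulusB; apply: K.
  + by rewrite midC; exact: mid_dist.
- exists (mid a b, b, mid b c); split=> //=; last exact: le_trans (mid_dist ab) dd.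
  split=> //; split.
  + by rewrite midC; exact: mid_dist.
  + by rewrite modulusB; exact: mid_dist.
  + by rewrite modulusB; apply: K.
- exists (mid c a, mid b c, c); split=> //=; last by rewrite midC; exact: le_trans (mid_dist ac) dd.
  split=> //; split.
  + by rewrite modulusB; apply: K.
  + by rewrite midC; exact: mid_dist.
  + by rewrite modulusB; exact: mid_dist.
- exists (mid a b, mid b c, mid c a); split=> //=; last exact: le_trans (mid_dist ab) dd.
  by split=> //; split; apply: K.
Qed.

Lemma geo_small (d e : R) : 0 < e -> exists n, d / 2 ^+ n < e.
Proof.
move=> e0; exists (Num.bound (`|d| / e)).
rewrite ltr_pdivrMr ?exprn_gt0// mulrC -ltr_pdivrMr//.
apply: (@le_lt_trans _ _ (`|d| / e)); first by rewrite ler_wpM2r ?ler_norm// invr_ge0 ltW.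
apply: lt_trans (archi_boundP _) _; first by rewrite divr_ge0// ltW.
by rewrite -natrX ltr_nat ltn_expl.
Qed.

(** The radius 2 d / 2^n is the tail of the geometric series, so u n minus it increases and u n plus
    it decreases; the supremum of the lower bounds lies below all upper bounds. *)
Lemma geo_limit (u : nat -> R) d : 0 <= d ->
  (forall n, `|u n.+1 - u n| <= d / 2 ^+ n) ->
  exists l, forall n, `|u n - l| <= 2 * d / 2 ^+ n.
Proof.
move=> d0 H; pose v n := 2 * d / 2 ^+ n.
have vS n : v n = v n.+1 + d / 2 ^+ n.
  by rewrite /v exprS; field; rewrite expf_neq0.
have v0 n : 0 <= v n by rewrite /v divr_ge0 ?mulr_ge0// exprn_ge0.
have lo n k : u n - v n <= u (n + k)%N - v (n + k)%N.
  elim: k => [|k IH]; first by rewrite addn0.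
  by apply: le_trans IH _; rewrite addnS vS; move: (H (n + k)%N); rewrite ler_norml => /andP[? ?]; lra.
have hi n k : u (n + k)%N + v (n + k)%N <= u n + v n.
  elim: k => [|k IH]; first by rewrite addn0.
  by apply: le_trans _ IH; rewrite addnS (vS (n + k)%N); move: (H (n + k)%N); rewrite ler_norml => /andP[? ?]; lra.
have cross n m : u n - v n <= u m + v m.
  apply: (le_trans (lo n m)); apply: le_trans _ (hi m n); rewrite addnC.
  by have := v0 (m + n)%N; lra.
pose A := [set u n - v n | n in [set: nat]].
have A0 : A !=set0 by exists (u 0%N - v 0%N), 0%N.
have ubA n : ubound A (u n + v n) by move=> _ [m _ <-].
have bA : has_sup A by split=> //; exists (u 0%N + v 0%N).
exists (sup A) => n; rewrite ler_distlC; apply/andP; split.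
  by apply: sup_upper_bound => //; exists n.
by apply: ge_sup.
Qed.

(** An affine function has a quadratic primitive, so its integral round a triangle is 0. This
    removes the first-order part of [f] at the limit point in Goursat's argument. *)
Lemma tri_affine0 f a b c (x k m : R[i]) : (forall z, unit_disc z -> ccont f z) ->
  unit_disc a -> unit_disc b -> unit_disc c ->
  tri f a b c = tri (fun z => f z - k - (z - x) * m) a b c.
Proof.
move=> fc aD bD cD.
pose g z : R[i] := k + (z - x) * m.
pose G z : R[i] := k * z + (z * z * (1 / 2) - x * z) * m.
have dG z : cdiff G z (g z).
  have H0 y : cdiff (fun=> y : R[i]) z 0 := gdiff_cst _ _ _.
  have dz := @cdiff_id R z.
  have H := gdiffD (gdiffM (H0 k) dz)
    (gdiffM (gdiffD (gdiffM (gdiffM dz dz) (H0 (1 / 2))) (gdiffM (H0 (- x)) dz)) (H0 m)).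
  rewrite /cdiff.
  have -> : G = (fun y => k * id y + (id y * id y * (1 / 2) + - x * id y) * m).
    by apply: funext => y; rewrite /G /= mulNr.
  by move: H; congr (gdiff _ _ _ _); rewrite /g /=; field.
have gc z : ccont g z.
  have H0 y : cdiff (fun=> y : R[i]) z 0 := gdiff_cst _ _ _.
  exact: gdiff_cont (gdiffD (H0 k) (gdiffM (gdiffD (@cdiff_id R z) (H0 (- x))) (H0 m))).
have Sg x1 x2 : seg g x1 x2 = G x2 - G x1.
  by apply: seg_FTC => [t _|t _]; [exact: gc|exact: dG].
pose h z : R[i] := f z - k - (z - x) * m.
have hc z : unit_disc z -> ccont h z.
  move=> zD e e0; have e2 : 0 < e / 2 by rewrite divr_gt0.
  have [d d0 Hd] := fc z zD _ e2; have [d' d'0 Hd'] := gc z _ e2.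
  exists (Num.min d d'); first by rewrite lt_min d0.
  move=> y; rewrite lt_min => /andP[/Hd H1 /Hd' H2].
  have -> : h y - h z = (f y - f z) - (g y - g z) by rewrite /h /g; ring.
  by apply: (le_lt_trans (modulusD _ _)); rewrite modulusN; move: (ltrD H1 H2); lra.
have E x1 x2 : unit_disc x1 -> unit_disc x2 -> seg f x1 x2 = seg h x1 x2 + (G x2 - G x1).
  move=> D1 D2; rewrite -Sg -segD; last first.
    by move=> t _; exact: gc.
    exact: disc_seg_cont.
  have hg z : f z = h z + g z by rewrite /h /g; move: (f z) => y; ring.
  exact: (congr1 (fun u => seg u x1 x2) (funext hg)).
rewrite /tri !E// -/h; ring.
Qed.

Lemma goursat f a b c : analytic f -> unit_disc a -> unit_disc b -> unit_disc c ->
  tri f a b c = 0.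
Proof.
move=> fa aD bD cD; have fc z : unit_disc z -> ccont f z by exact: analytic_ccont.
pose r := Num.max (modulus a) (Num.max (modulus b) (modulus c)).
have r1 : r < 1 by rewrite !gt_max; apply/and3P; split.
pose d := modulus (a - b) + modulus (b - c) + modulus (c - a).
have [g1 g2 g3] := And3 (modulus_ge0 (a - b)) (modulus_ge0 (b - c)) (modulus_ge0 (c - a)).
have d0 : 0 <= d by rewrite /d; lra.
pose M := modulus (tri f a b c).
(* The hypotheses are placed under the existential so that [choice] yields a step function on all
   pairs; [inv] then discharges them along the orbit. *)
have step (nT : nat * triple) : exists T' : triple,
    small_tri r (d / 2 ^+ nT.1) nT.2 -> M / 4 ^+ nT.1 <= modulus (tri_int f nT.2) ->
    [/\ small_tri r (d / 2 ^+ nT.1.+1) T', M / 4 ^+ nT.1.+1 <= modulus (tri_int f T') &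
    modulus (T'.1.1 - nT.2.1.1) <= d / 2 ^+ nT.1].
  case: nT => n T /=.
  have [H1|H1] := pselect (small_tri r (d / 2 ^+ n) T); last by exists T.
  have [H2|H2] := pselect (M / 4 ^+ n <= modulus (tri_int f T)); last by exists T.
  have [T' HT'] := goursat_step fc r1 H1 H2; exists T' => _ _.
  by move: HT'; rewrite -!mulrA -!invfM -!exprSr.
have [s Hs] := choice step.
pose T := fix T n : triple := if n is m.+1 then s (m, T m) else (a, b, c).
have inv n : small_tri r (d / 2 ^+ n) (T n) /\ M / 4 ^+ n <= modulus (tri_int f (T n)).
  elim: n => [|n [IH1 IH2]].
    rewrite !expr0 !divr1; split; last exact: lexx.
    split; split; rewrite ?le_max ?lexx ?orbT//; rewrite /d; lra.
  by have [? ? _] := Hs (n, T n) IH1 IH2.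
have incr n : modulus ((T n.+1).1.1 - (T n).1.1) <= d / 2 ^+ n.
  by have [IH1 IH2] := inv n; have [_ _] := Hs (n, T n) IH1 IH2.
have [lr Hlr] : exists l, forall n, `|complex.Re (T n).1.1 - l| <= 2 * d / 2 ^+ n.
  apply: geo_limit => // n; apply: le_trans (incr n).
  by apply: le_trans (Re_le_modulus _); rewrite ReD ReN.
have [li Hli] : exists l, forall n, `|complex.Im (T n).1.1 - l| <= 2 * d / 2 ^+ n.
  apply: geo_limit => // n; apply: le_trans (incr n).
  by apply: le_trans (Im_le_modulus _); rewrite ImD ImN.
pose x := lr +i* li.
have Hx n : modulus ((T n).1.1 - x) <= 4 * (d / 2 ^+ n).
  apply: (le_trans (modulus_le_ReIm _)); rewrite ReD ImD ReN ImN /=.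
  by move: (lerD (Hlr n) (Hli n)); rewrite -!(mulrA 2); lra.
have xD : unit_disc x.
  rewrite /unit_disc /=; apply: le_lt_trans r1; apply/ler_addgt0Pr => e e0.
  have [n Hn] := geo_small (4 * d) e0.
  have [+ _] := inv n; case: (T n) (Hx n) => [[a' b'] c'] /= h [[ar' _ _] _].
  rewrite -(subrK a' x); apply: (le_trans (modulusD _ _)); rewrite addrC.
  by apply: lerD => //; rewrite modulusB (le_trans h)// mulrA ltW.
apply/eqP; rewrite -modulus_eq0 eq_le modulus_ge0 andbT.
apply/ler_addgt0Pr => e e0; rewrite add0r -/M.
(* 30 = 3 * 2 * 5: three sides, the factor of [seg_le], and points of the n-th triangle within 5 d /
   2^n of [x]. The summand 1 keeps the denominator positive when the triangle is a point. *)
have e1 : 0 < e / (30 * (d ^+ 2 + 1)).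
  by rewrite divr_gt0// mulr_gt0// ltr_wpDl// sqr_ge0.
have [dl dl0 Hdl] := analytic_cdiff fa xD e1.
have [n Hn] := geo_small (5 * d) dl0.
have [H1 H2] := inv n; have := Hx n.
case: (T n) H1 H2 => [[a' b'] c'] [/= [ar' br' cr'] [ab bc ca]] H2 hx.
set dn := d / 2 ^+ n in ab bc ca hx.
have dn0 : 0 <= dn by exact: le_trans (modulus_ge0 _) ab.
have D y : modulus y <= r -> unit_disc y by move=> /le_lt_trans; exact.
have [aD' bD' cD'] := And3 (D _ ar') (D _ br') (D _ cr').
move: H2; rewrite /tri_int /= (@tri_affine0 f _ _ _ x (f x) (cderiv f x))//.
set h := fun z => _.
have hc z : unit_disc z -> ccont h z.
  move=> zD; have H0 y : cdiff (fun=> y : R[i]) z 0 := gdiff_cst _ _ _.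
  have dz := @cdiff_id R z.
  have H := gdiffD (gdiffD (analytic_cdiff fa zD) (H0 (- f x)))
    (gdiffM (gdiffD dz (H0 (- x))) (H0 (- cderiv f x))).
  have -> : h = (fun y => f y + - f x + (id y + - x) * - cderiv f x).
    by apply: funext => y; rewrite /h mulrN.
  exact: gdiff_cont H.
have near y : modulus (y - a') <= dn -> modulus (h y) <= e / (30 * (d ^+ 2 + 1)) * (5 * dn).
  move=> ya.
  have yx : modulus (y - x) <= 5 * dn.
    rewrite (_ : y - x = (y - a') + (a' - x)); last ring.
    by apply: (le_trans (modulusD _ _)); lra.
  apply: le_trans (Hdl _ _) _; first by apply: le_lt_trans yx _; rewrite /dn mulrA.
  by rewrite ler_wpM2l// ltW.
have S y z : unit_disc y -> unit_disc z -> modulus (y - a') <= dn -> modulus (z - a') <= dn ->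
   modulus (y - z) <= dn ->
   modulus (seg h y z) <= 2 * (e / (30 * (d ^+ 2 + 1)) * (5 * dn)) * dn.
  move=> yD zD ya za yz; apply: le_trans (seg_le (M := e / (30 * (d ^+ 2 + 1)) * (5 * dn)) _ _) _.
  - exact: disc_seg_cont.
  - by move=> t t01; apply: near; exact: seg_dist_le.
  rewrite modulusB ler_wpM2l// mulr_ge0// mulr_ge0//; first exact: ltW.
  by rewrite mulr_ge0.
have a0 : modulus (a' - a') <= dn by rewrite subrr modulus0.
have ba : modulus (b' - a') <= dn by rewrite modulusB.
have S1 := S _ _ aD' bD' a0 ba ab; have S2 := S _ _ bD' cD' ba ca bc.
have S3 := S _ _ cD' aD' ca a0 ca.
move=> H.
have : M / 4 ^+ n <= 30 * (e / (30 * (d ^+ 2 + 1))) * dn ^+ 2.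
  apply: (le_trans H); rewrite /tri; apply: (le_trans (modulusD _ _)).
  by have := modulusD (seg h a' b') (seg h b' c'); nra.
rewrite /dn expr_div_n -exprM mulnC exprM (_ : 2 ^+ 2 = 4 :> R); last by ring.
rewrite (mulrA (30 * _)) ler_pM2r ?invr_gt0 ?exprn_gt0// => /le_trans; apply.
have -> : 30 * (e / (30 * (d ^+ 2 + 1))) * d ^+ 2 = e * (d ^+ 2 / (d ^+ 2 + 1)).
  by field; apply/negP => /eqP; have := sqr_ge0 d; lra.
rewrite -[leRHS]mulr1 ler_wpM2l ?(ltW e0)// ler_pdivrMr ?mul1r ?lerDl//.
by rewrite ltr_wpDl// sqr_ge0.
Qed.

Lemma disc0 : unit_disc (0 : R[i]).
Proof. by rewrite /unit_disc /= modulus0. Qed.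

Lemma disc_open z : unit_disc z -> exists2 d : R, 0 < d &
  forall w, modulus (w - z) < d -> unit_disc w.
Proof.
rewrite /unit_disc /= => zD; exists (1 - modulus z); first by rewrite subr_gt0.
move=> w; have := modulusD (w - z) z; rewrite subrK; lra.
Qed.

(** Goursat's theorem on the triangle 0, z, w identifies the increment of the primitive with the
    integral from z to w, where [f] stays close to [f z]. *)
Lemma cdiff_seg0 f z : analytic f -> unit_disc z -> cdiff (seg f 0) z (f z).
Proof.
move=> fa zD e e0; have fc y : unit_disc y -> ccont f y by exact: analytic_ccont.
have e2 : 0 < e / 2 by rewrite divr_gt0.
have [d d0 Hd] := fc z zD _ e2; have [d' d'0 Hd'] := disc_open zD.
exists (Num.min d d'); first by rewrite lt_min d0.
move=> w; rewrite lt_min => /andP[wd /Hd' wD].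
have := goursat fa disc0 zD wD; rewrite /tri (@seg_anti R f 0 w); last exact: disc_seg_cont disc0 wD.
move=> H; have -> : seg f 0 w - seg f 0 z = seg f z w.
  have -> : seg f 0 w = seg f 0 z + seg f z w.
    by apply/esym/eqP; rewrite -subr_eq0 H.
  ring.
pose h y := f y + - f z.
have hc y : unit_disc y -> ccont h y.
  move=> yD; have H0 : cdiff (fun=> - f z) y 0 := gdiff_cst _ _ _.
  exact: gdiff_cont (gdiffD (analytic_cdiff fa yD) H0).
have -> : seg f z w - (w - z) * f z = seg h z w.
  rewrite /h segD; [|exact: disc_seg_cont|by move=> t _ e' e'0; exists 1 => // y _; rewrite subrr modulus0].
  congr (_ + _); rewrite (@seg_FTC R (fun=> - f z) (fun y => y * - f z)).
  - ring.
  - by move=> t _ e' e'0; exists 1 => // y _; rewrite subrr modulus0.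
  move=> t _; set p := (X in cdiff _ X _).
  have H0 : cdiff (fun=> - f z) p 0 := gdiff_cst _ _ _.
  by have := gdiffM (@cdiff_id R p) H0; rewrite mulr0 addr0 mul1r.
apply: le_trans (seg_le (M := e / 2) _ _) _; first exact: disc_seg_cont.
  move=> t t01; apply/ltW/Hd; move: t01 => /andP[t0 t1].
  rewrite addrAC subrr add0r modulusM modulus_real ger0_norm//.
  by apply: le_lt_trans wd; rewrite ler_piMl// modulus_ge0.
by rewrite (mulrC 2) divfK.
Qed.

End Goursat.

(** * Parameter integrals and Cauchy integrals over a square *)

Section CauchySquare.
Variable R : realType.
Implicit Types (f g : R[i] -> R[i]) (z w h : R[i]) (d e t l : R).

(** Differentiation under the integral sign, with uniformity in [t] as a hypothesis. The parameter
    is complex for the Cauchy kernel and real for the homotopy that contracts the square. *)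
Lemma param_diff (E : zmodType) (emb : E -> R[i]) (Phi : E -> R -> R[i])
    (dPhi : R -> R[i]) (x0 : E) (d0 : R) : 0 < d0 ->
  (forall x, modulus (emb (x - x0)) < d0 -> path_cont (Phi x)) ->
  path_cont (Phi x0) -> path_cont dPhi ->
  (forall e, 0 < e -> exists2 d : R, 0 < d & forall x, modulus (emb (x - x0)) < d ->
    forall t, 0 <= t <= 1 ->
    modulus (Phi x t - Phi x0 t - emb (x - x0) * dPhi t) <= e * modulus (emb (x - x0))) ->
  gdiff emb (fun x => integral01 (Phi x)) x0 (integral01 dPhi).
Proof.
move=> d00 cP cP0 cdP H e e0; have e2 : 0 < e / 2 by rewrite divr_gt0.
have [d d1 Hd] := H _ e2; exists (Num.min d d0); first by rewrite lt_min d1.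
move=> x; rewrite lt_min => /andP[xd /cP cPx].
set k := emb (x - x0).
have cN : path_cont (fun t => -1 * Phi x0 t).
  by move=> t t01; apply: pcontM; [exact: pcont_cst|exact: cP0].
have cN' : path_cont (fun t => - k * dPhi t).
  by move=> t t01; apply: pcontM; [exact: pcont_cst|exact: cdP].
have cD1 : path_cont (fun t => Phi x t + -1 * Phi x0 t).
  by move=> t t01; apply: pcontD; [exact: cPx|exact: cN].
have -> : integral01 (Phi x) - integral01 (Phi x0) - k * integral01 dPhi =
    integral01 (fun t => Phi x t + -1 * Phi x0 t + - k * dPhi t).
  by rewrite integral01D// integral01D// !integral01Z// mulN1r mulNr.
have -> : e * modulus k = 2 * (e / 2 * modulus k) by field.
apply: integral01_le => [t t01|t t01].
  by apply: pcontD; [exact: cD1|exact: cN'].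
by rewrite mulN1r mulNr; exact: Hd.
Qed.

(** Tube lemma: compactness of [0, 1] replaces the radii depending on [t0] by a single one. *)
Lemma tube (P : R -> R -> Prop) l0 :
  (forall t0, 0 <= t0 <= 1 -> exists2 d : R, 0 < d & forall t l,
    `|t - t0| < d -> `|l - l0| < d -> P l t) ->
  exists2 d : R, 0 < d & forall l, `|l - l0| < d -> forall t, 0 <= t <= 1 -> P l t.
Proof.
move=> H.
have /compact_near_coveringP/(_ R (nbhs l0) P _)K := @segment_compact R 0 1.
have : \forall l \near nbhs l0, `[0, 1]%classic `<=` P l.
  apply: K => t0; rewrite /= in_itv /= => /H[d d0 Hd].
  exists (ball t0 d, ball l0 d) => /=; first by split; exact: nbhsx_ballx.
  move=> [t l] [/=]; rewrite /ball /= !(distrC _ t) !(distrC _ l) => h1 h2.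
  exact: Hd.
move=> /nbhs_normP[d /= d0 Hd]; exists d => // l ld t t01.
by apply: (Hd l); rewrite /ball_ /= 1?distrC// in_itv.
Qed.

Lemma path_bounded (F : R -> R[i]) : path_cont F ->
  exists2 B : R, 0 < B & forall t, 0 <= t <= 1 -> modulus (F t) <= B.
Proof.
(* Boundedness is read off the tube lemma: |F t| |l| <= 1 holds for l near 0 uniformly in t, and l =
   d/2 gives the bound 2/d. *)
move=> cF; have [|d d0 Hd] := @tube (fun l t => modulus (F t) * `|l| <= 1) 0.
  move=> t0 t01; have [d d0 Hd] := gcont_bnd (cF t0 t01).
  have M0 : 0 < modulus (F t0) + 1 by rewrite ltr_wpDl ?modulus_ge0.
  exists (Num.min d (modulus (F t0) + 1)^-1); first by rewrite lt_min d0 invr_gt0.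
  move=> t l; rewrite !lt_min subr0 => /andP[td _] /andP[_ ld].
  have h : modulus (F t) <= modulus (F t0) + 1 by apply: Hd; rewrite modulus_real.
  apply: (le_trans (ler_pM (modulus_ge0 _) (normr_ge0 _) h (ltW ld))).
  by rewrite mulfV// gt_eqF.
exists (2 / d); first by rewrite divr_gt0.
move=> t t01; have d2 : 0 <= d / 2 by rewrite divr_ge0// ltW.
have := Hd (d / 2) _ t t01; rewrite subr0 ger0_norm//.
move=> /(_ ltac:(move: d0; lra)); rewrite ler_pdivlMr//.
rewrite mulrA ler_pdivrMr// mul1r; exact.
Qed.

(** The mean value theorem is applied to the real and the imaginary part. The derivative vanishes on
    the open interval only, because in the homotopy below it is computed by dividing by [l]. *)
Lemma pdiff_const01 (H : R -> R[i]) (D : R -> R[i]) :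
  (forall l, 0 <= l <= 1 -> pdiff H l (D l)) ->
  (forall l, 0 < l < 1 -> D l = 0) -> H 0 = H 1.
Proof.
move=> dH D0.
have K (g dg : R -> R) : (forall l, 0 <= l <= 1 -> is_derive l 1 g (dg l)) ->
    (forall l, 0 < l < 1 -> dg l = 0) -> g 0 = g 1.
  move=> Hg H0; have [] := @MVT R g dg 0 1 ltr01.
  - by move=> x; rewrite in_itv /= => /andP[x0 x1]; apply: Hg; rewrite !ltW.
  - by apply: within01 => t t01; exact: is_derive_cont (Hg t t01).
  move=> x; rewrite in_itv /= => /H0 ->; rewrite mul0r => /eqP.
  by rewrite subr_eq0 => /eqP.
apply: complexP.
  apply: (K (fun l => complex.Re (H l)) (fun l => complex.Re (D l))) => l l01; last by rewrite D0.
  by have /pdiff_is_derive[] := dH l l01.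
apply: (K (fun l => complex.Im (H l)) (fun l => complex.Im (D l))) => l l01; last by rewrite D0.
by have /pdiff_is_derive[] := dH l l01.
Qed.

Lemma seg_cont_cst (v p q : R[i]) : seg_cont (fun=> v) p q.
Proof. by move=> t _; exact: gcont_cst. Qed.

Lemma seg_cst (v p q : R[i]) : seg (fun=> v) p q = (q - p) * v.
Proof.
rewrite (@seg_FTC R (fun=> v) (fun y => y * v)); first by ring.
  exact: seg_cont_cst.
move=> t _; set x := (X in cdiff _ X _).
have H0 : cdiff (fun=> v) x 0 := gdiff_cst _ _ _.
by have := gdiffM (@cdiff_id R x) H0; rewrite mulr0 addr0 mul1r.
Qed.

(** Strict differentiability, in which both points move: the increment is the integral of [cderiv f]
    over the segment, hence the continuity hypothesis. The homotopy needs it because its base point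
    moves along the side. *)
Lemma strict_cdiff f z : analytic f -> (forall w, unit_disc w -> ccont (cderiv f) w) ->
  unit_disc z -> forall e, 0 < e -> exists2 d : R, 0 < d & forall x y,
    modulus (x - z) < d -> modulus (y - z) < d ->
    modulus (f y - f x - (y - x) * cderiv f x) <= e * modulus (y - x).
Proof.
(* Two values of [cderiv f] near [z] differ by at most e/2, and [seg_le] costs a factor 2. *)
move=> fa f'c zD e e0; have e4 : 0 < e / 4 by rewrite divr_gt0.
have [d d0 Hd] := f'c z zD _ e4; have [d' d'0 Hd'] := disc_open zD.
exists (Num.min d d'); first by rewrite lt_min d0.
move=> x y xd yd.
have xD : unit_disc x by apply: Hd'; move: xd; rewrite lt_min => /andP[].
have yD : unit_disc y by apply: Hd'; move: yd; rewrite lt_min => /andP[].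
have E : f y - f x = seg (cderiv f) x y.
  rewrite (@seg_FTC R (cderiv f) f)//; first exact: disc_seg_cont.
  by move=> t t01; apply: analytic_cdiff => //; exact: disc_seg.
have sc := @disc_seg_cont R (cderiv f) _ _ f'c xD yD.
have -> : f y - f x - (y - x) * cderiv f x = seg (fun w => cderiv f w + - cderiv f x) x y.
  rewrite segD//; last exact: seg_cont_cst.
  by rewrite E seg_cst mulrN.
have -> : e * modulus (y - x) = 2 * (e / 2) * modulus (y - x) by field.
apply: seg_le => t t01.
  by apply: gcontD; [exact: sc|exact: gcont_cst].
have near v : modulus (v - z) < Num.min d d' -> modulus (cderiv f v - cderiv f z) < e / 4.
  by rewrite lt_min => /andP[/Hd].
have h1 := near _ xd.
have /near h2 : modulus (x + t%:C * (y - x) - z) < Num.min d d'.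
  apply: (@le_lt_trans _ _ (Num.max (modulus (x - z)) (modulus (y - z)))).
    by apply: seg_dist_le => //; rewrite le_max lexx ?orbT.
  by rewrite gt_max xd.
move: h2; move: (x + _) => v h2.
move: h1 h2; move: (cderiv f v) (cderiv f x) (cderiv f z) => y1 y2 y3 h1 h2.
have -> : y1 - y2 = (y1 - y3) - (y2 - y3) by ring.
by apply: (le_trans (modulusD _ _)); rewrite modulusN; move: (ltrD h1 h2); lra.
Qed.

Section Square.
Variables (c : R[i]) (s : R).
Hypothesis s0 : 0 < s.

(** Corners of the square with centre [c] and half-side [s], counterclockwise from the lower right
    one. Side 0 is thus the right-hand side and the others are its rotations by powers of ['i]. *)
Definition pt k : R[i] := c + s%:C * 'i ^+ k * (1 - 'i).

Definition side k t : R[i] := pt k + t%:C * (pt k.+1 - pt k).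

Lemma pt4 : pt 4 = pt 0.
Proof. by rewrite /pt expr0 (_ : 4 = 2 * 2)%N// exprM sqr_i sqrrN expr1n. Qed.

Lemma sideB k : pt k.+1 - pt k = s%:C * 'i ^+ k * (2 * 'i).
Proof.
rewrite /pt exprSr.
have -> : c + s%:C * ('i ^+ k * 'i) * (1 - 'i) - (c + s%:C * 'i ^+ k * (1 - 'i)) =
  s%:C * 'i ^+ k * (2 * 'i - 'i ^+ 2 - 1) by ring.
by rewrite sqr_i opprK addrK.
Qed.

Lemma sideE k t : side k t - c = s%:C * 'i ^+ k * (1 +i* (2 * t - 1)).
Proof.
rewrite /side sideB /pt.
have -> : 1 +i* (2 * t - 1) = 1 - 'i + t%:C * (2 * 'i) :> R[i].
  by apply/eqP; rewrite eq_complex /=; apply/andP; split; apply/eqP; ring.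
ring.
Qed.

Lemma modulus_side k t : modulus (side k t - c) = s * modulus (1 +i* (2 * t - 1)).
Proof.
by rewrite sideE !modulusM modulusX modulus_i expr1n mulr1 modulus_real gtr0_norm.
Qed.

Lemma side_far k t : s <= modulus (side k t - c).
Proof.
rewrite modulus_side ler_peMr ?(ltW s0)//.
by apply: le_trans (Re_le_modulus _); rewrite /= normr1.
Qed.

Lemma side_near k t : 0 <= t <= 1 -> modulus (side k t - c) <= 2 * s.
Proof.
move=> /andP[t0 t1]; rewrite modulus_side mulrC ler_wpM2r ?(ltW s0)//.
apply: (le_trans (modulus_le_ReIm _)); rewrite /= normr1.
have : `|2 * t - 1| <= 1 by rewrite ler_norml; apply/andP; split; lra.
lra.
Qed.

Lemma side_far_w k t w : s - modulus (w - c) <= modulus (side k t - w).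
Proof.
have := side_far k t; have := modulusD (side k t - w) (w - c).
rewrite addrA subrK; lra.
Qed.

Lemma side_neq k t w : modulus (w - c) < s -> side k t - w != 0.
Proof.
by move=> wc; rewrite -modulus_gt0 (lt_le_trans _ (side_far_w k t w))// subr_gt0.
Qed.

Definition sq_cont f := forall k, seg_cont f (pt k) (pt k.+1).

Definition sq_int f := \sum_(k < 4) seg f (pt k) (pt k.+1).

Lemma sq_intZ v f : sq_cont f -> sq_int (fun z => v * f z) = v * sq_int f.
Proof.
by move=> cf; rewrite /sq_int mulr_sumr; apply: eq_bigr => k _; rewrite segZ.
Qed.

Lemma eq_sq_int f g : (forall k t, 0 <= t <= 1 -> f (side k t) = g (side k t)) ->
  sq_int f = sq_int g.
Proof.
move=> H; apply: eq_bigr => k _; rewrite /seg; congr (_ * _).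
by apply: eq_integral01 => t t01; exact: H.
Qed.

Lemma sq_FTC f g : sq_cont f ->
  (forall k t, 0 <= t <= 1 -> cdiff g (side k t) (f (side k t))) -> sq_int f = 0.
Proof.
move=> cf dg; rewrite /sq_int (eq_bigr (fun k : 'I_4 => g (pt k.+1) - g (pt k))).
  rewrite !big_ord_recr big_ord0 /= pt4; ring.
by move=> k _; apply: seg_FTC => // t; exact: dg.
Qed.

Definition cker n f w z := f z * (z - w)^-1 ^+ n.

Definition cint n f w := sq_int (cker n f w).

Lemma ccont_inv_sub w z : z - w != 0 -> ccont (fun z => (z - w)^-1) z.
Proof.
move=> zw; apply: (@gcont_comp _ _ _ (@GRing.inv _) (fun z => z - w)).
  exact: gdiff_cont (cdiff_inv zw).
by apply: gcontD; [exact: gdiff_cont (cdiff_id z)|exact: gcont_cst].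
Qed.

Lemma gcontX (E : zmodType) (emb : E -> R[i]) (f : E -> R[i]) x n : gcont emb f x ->
  gcont emb (fun y => f y ^+ n) x.
Proof.
move=> cf; elim: n => [|n IH]; first exact: gcont_cst.
by rewrite (_ : (fun y => _) = fun y => f y * f y ^+ n);
  [exact: gcontM|apply: funext => y; rewrite exprS].
Qed.

Lemma cker_cont n f w : modulus (w - c) < s -> sq_cont f -> sq_cont (cker n f w).
Proof.
move=> wc cf k t t01; apply: gcontM; first exact: cf.
by apply/gcontX/ccont_inv_sub; exact: (side_neq k t wc).
Qed.

(** The remainder equals h^2 N / (u^(n+1) (u - h)^n) with an explicit polynomial N in u and h. As
    |h| <= |u|/2, one has |N| <= 11 |u|^(n-1), the worst case being n = 3, and |u - h|^n >= |u|^n /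
    8; hence 88 = 11 * 8. Three values of n suffice for differentiating a Cauchy integral three
    times. *)
Lemma inv_pow_diff n u h (r : R) : (0 < n < 4)%N -> 0 < r -> r <= modulus u ->
  modulus h < r / 2 ->
  modulus ((u - h)^-1 ^+ n - u^-1 ^+ n - h * (n%:R * u^-1 ^+ n.+1)) <=
    88 / r ^+ n.+2 * modulus h ^+ 2.
Proof.
move=> n4 r0 ru hr.
have u0 : u != 0 by rewrite -modulus_gt0 (lt_le_trans r0).
have uh : modulus u / 2 <= modulus (u - h).
  by have := ler_modulusB u h; move: hr ru; lra.
have uh0 : u - h != 0 by rewrite -modulus_gt0 (lt_le_trans _ uh)// divr_gt0// modulus_gt0.
have mu : 0 < modulus u by rewrite modulus_gt0.
have key N : (u - h)^-1 ^+ n - u^-1 ^+ n - h * (n%:R * u^-1 ^+ n.+1) =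
    h ^+ 2 * N / (u ^+ n.+1 * (u - h) ^+ n) -> modulus N <= 11 * modulus u ^+ n.-1 ->
    modulus ((u - h)^-1 ^+ n - u^-1 ^+ n - h * (n%:R * u^-1 ^+ n.+1)) <=
    88 / r ^+ n.+2 * modulus h ^+ 2.
  move=> -> HN; rewrite !(modulusM, modulusX, modulusV) mulrC -mulrA mulrA.
  rewrite mulrCA (mulrC (88 / _)) ler_wpM2l ?exprn_ge0 ?modulus_ge0//.
  rewrite mulrC ler_pdivrMr ?mulr_gt0 ?exprn_gt0 ?modulus_gt0//.
  apply: (le_trans HN); rewrite mulrAC ler_pdivlMr ?exprn_gt0//.
  suff : 11 * modulus u ^+ n.-1 * r ^+ n.+2 <= 88 * (modulus u ^+ n.+1 * modulus (u - h) ^+ n) by [].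
  have E : modulus u ^+ n.-1 * modulus u ^+ n.+2 = modulus u ^+ n.+1 * modulus u ^+ n.
    by clear HN; case: n n4 => [//|m _]; rewrite -!exprD /= !addnS !addSn.
  apply: (@le_trans _ _ (11 * (modulus u ^+ n.-1 * modulus u ^+ n.+2))).
    rewrite -mulrA ler_wpM2l// ler_wpM2l ?exprn_ge0 ?modulus_ge0//.
    by rewrite lerXn2r// nnegrE ?modulus_ge0// ltW.
  rewrite E mulrCA (mulrCA 88) ler_wpM2l ?exprn_ge0 ?modulus_ge0//.
  have H1 : (modulus u / 2) ^+ n <= modulus (u - h) ^+ n.
    by rewrite lerXn2r// nnegrE ?modulus_ge0// divr_ge0// modulus_ge0.
  have H2 : 2 ^+ n <= 8 :> R.
    rewrite (_ : 8 = 2 ^+ 3); last by ring.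
    by rewrite ler_eXn2l ?ltr1n// -ltnS; case/andP: n4.
  have H3 : modulus u ^+ n = 2 ^+ n * (modulus u / 2) ^+ n.
    by rewrite -exprMn; congr (_ ^+ _); field.
  have H4 : 0 <= (modulus u / 2) ^+ n by rewrite exprn_ge0// divr_ge0// modulus_ge0.
  rewrite H3; nra.
have h2 : modulus h <= modulus u / 2 by move: hr ru; lra.
have h0 := modulus_ge0 h.
case: n n4 key => [//|[|[|[|//]]]] _ key.
- apply: (key 1); first by field; rewrite uh0 u0.
  by rewrite expr0 mulr1 modulus1 ler1n.
- apply: (key (3 * u - 2 * h)); first by field; rewrite uh0 u0.
  apply: (le_trans (modulusD _ _)); rewrite modulusN !modulusM -!(rmorph_nat (real_complex R)) !modulus_real.
  by rewrite !ger0_norm// expr1; lra.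
apply: (key (6 * u ^+ 2 - 8 * (u * h) + 3 * h ^+ 2)); first by field; rewrite uh0 u0.
apply: (le_trans (modulusD _ _)).
have := modulusD (6 * u ^+ 2) (- (8 * (u * h))).
rewrite modulusN !modulusM -!(rmorph_nat (real_complex R)) !modulus_real ?modulusX.
rewrite !ger0_norm//= !expr2; nra.
Qed.

Lemma cint_diff n f w : (0 < n < 4)%N -> sq_cont f -> modulus (w - c) < s ->
  cdiff (cint n f) w (n%:R * cint n.+1 f w).
Proof.
move=> n4 cf wc; rewrite /cint /sq_int mulr_sumr.
apply: (@gdiff_sum _ _ _ 4 (fun k w => seg (cker n f w) (pt k) (pt k.+1))
  (fun k => n%:R * seg (cker n.+1 f w) (pt k) (pt k.+1))) => k _.
rewrite /seg mulrCA.
have cp := seg_path_cont (cf k).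
have [B B0 HB] := path_bounded cp.
pose r := s - modulus (w - c).
have r0 : 0 < r by rewrite subr_gt0.
have ck m v : modulus (v - c) < s -> path_cont (fun t => cker m f v (side k t)).
  by move=> vc; exact: (seg_path_cont (@cker_cont m f v vc cf k)).
have ck' : path_cont (fun t => n%:R * cker n.+1 f w (side k t)).
  by move=> t t01; apply: pcontM; [exact: pcont_cst|exact: ck].
rewrite -integral01Z; last exact: ck.
have H0 : cdiff (fun=> pt k.+1 - pt k) w 0 := gdiff_cst _ _ _.
have H : cdiff (fun w => integral01 (fun t => cker n f w (side k t))) w
    (integral01 (fun t => n%:R * cker n.+1 f w (side k t))).
  apply: (@param_diff _ id (fun w t => cker n f w (side k t)) _ w r) => //.
  - move=> v /= vw; apply: ck; have := modulusD (v - w) (w - c).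
    by rewrite addrA subrK; move: vw; rewrite /r; lra.
  - exact: ck.
  move=> e e0; pose C := 88 / r ^+ n.+2 * B.
  have C0 : 0 < C by rewrite mulr_gt0// divr_gt0// exprn_gt0.
  exists (Num.min (r / 2) (e / C)); first by rewrite lt_min !divr_gt0.
  move=> v; rewrite /= lt_min => /andP[v1 v2] t t01.
  have := @inv_pow_diff n (side k t - w) (v - w) r n4 r0 (side_far_w k t w) v1.
  have -> : side k t - w - (v - w) = side k t - v by ring.
  move=> K; rewrite /cker.
  set X := f _; have -> : X * (side k t - v)^-1 ^+ n - X * (side k t - w)^-1 ^+ n -
    (v - w) * (n%:R * (X * (side k t - w)^-1 ^+ n.+1)) =
    X * ((side k t - v)^-1 ^+ n - (side k t - w)^-1 ^+ n -
    (v - w) * (n%:R * (side k t - w)^-1 ^+ n.+1)) by ring.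
  rewrite modulusM; apply: (le_trans (ler_pM (modulus_ge0 _) (modulus_ge0 _) (HB t t01) K)).
  rewrite mulrA (mulrC B) -/C expr2 mulrA ler_wpM2r ?modulus_ge0//.
  by rewrite mulrC -ler_pdivlMr// ltW.
by have := gdiffM H0 H; rewrite mul0r add0r.
Qed.

End Square.

End CauchySquare.


(** * Cauchy's formula on a square *)

Section CauchyFormula.
Variable R : realType.
Variables (c : R[i]) (s : R).
Hypothesis s0 : 0 < s.
Implicit Types (f g : R[i] -> R[i]) (w z : R[i]) (t l e : R).
Local Notation pt := (pt c s).
Local Notation side := (side c s).
Hypothesis sqD : forall k t, 0 <= t <= 1 -> unit_disc (side k t).

(** The difference quotient in [l] of f(w + l (z - w)), uniformly for z on a side: strict
    differentiability at each point of the path, then compactness. Membership in the disc is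
    included because [l] may leave [0, 1] slightly. *)
Lemma homotopy_uniform f w l0 : analytic f ->
  (forall z, unit_disc z -> ccont (cderiv f) z) ->
  unit_disc w -> modulus (w - c) < s -> 0 <= l0 <= 1 ->
  forall k e, 0 < e -> exists2 d : R, 0 < d & forall l, `|l - l0| < d ->
    forall t, 0 <= t <= 1 -> unit_disc (w + l%:C * (side k t - w)) /\
    modulus (f (w + l%:C * (side k t - w)) - f (w + l0%:C * (side k t - w))
      - (l - l0)%:C * (side k t - w) * cderiv f (w + l0%:C * (side k t - w)))
    <= e * modulus ((l - l0)%:C * (side k t - w)).
Proof.
move=> fa f'c wD wc /andP[l00 l01] k e e0; apply: tube => t0 t01.
set z0 := w + l0%:C * (side k t0 - w).
have z0D : unit_disc z0 by apply: disc_seg; [exact: wD|exact: sqD|rewrite l00].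
have [d d0 Hd] := strict_cdiff fa f'c z0D e0.
have [d' d'0 Hd'] := disc_open z0D.
(* The bound 1 ensures |l| <= 2; the point then moves by at most 4 s |t - t0| + 3 s |l - l0|, which
   the 8 s absorbs. *)
pose dd := Num.min 1 (Num.min d d' / (8 * s)).
have dd0 : 0 < dd by rewrite lt_min ltr01 divr_gt0 ?lt_min ?d0 ?d'0// mulr_gt0.
exists dd => // t l; rewrite /dd !lt_min => /andP[t1 td] /andP[l1 ld].
have near l' : `|l'| <= 2 -> `|l' - l0| < Num.min d d' / (8 * s) ->
    modulus (w + l'%:C * (side k t - w) - z0) < Num.min d d'.
  move=> l2 ll.
  have -> : w + l'%:C * (side k t - w) - z0 =
    l'%:C * (side k t - side k t0) + (l' - l0)%:C * (side k t0 - w).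
    by rewrite /z0 rmorphB; ring.
  have h1 : modulus (side k t - side k t0) = 2 * s * `|t - t0|.
    have -> : side k t - side k t0 = (t - t0)%:C * (pt k.+1 - pt k).
      by rewrite /side rmorphB; ring.
    rewrite sideB !modulusM modulusX modulus_i expr1n !mulr1 !modulus_real.
    rewrite (gtr0_norm s0) modulus_nat; ring.
  have h2 : modulus (side k t0 - w) <= 3 * s.
    have := side_near c s0 k t01; have := modulusD (side k t0 - c) (c - w).
    rewrite addrA subrK (modulusB c); lra.
  apply: (le_lt_trans (modulusD _ _)); rewrite !modulusM !modulus_real h1.
  have s1 : 0 < 8 * s by rewrite mulr_gt0.
  move: td ll; rewrite !ltr_pdivlMr// => td ll.
  have := ler_wpM2l (normr_ge0 (l' - l0)) h2.
  have : `|l'| * (2 * s * `|t - t0|) <= 2 * (2 * s * `|t - t0|).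
    by rewrite ler_wpM2r// mulr_ge0// mulr_ge0// ltW.
  have : 0 < Num.min d d' by rewrite lt_min d0.
  have : 0 <= `|l' - l0| * s by rewrite mulr_ge0// ltW.
  lra.
have ln : `|l| <= 2.
  by move: l1; rewrite ltr_norml ler_norml => /andP[? ?]; apply/andP; split; lra.
have n1 := near l ln ld.
have n2 : modulus (w + l0%:C * (side k t - w) - z0) < Num.min d d'.
  apply: near; first by rewrite ger0_norm//; lra.
  by rewrite subrr normr0 divr_gt0 ?lt_min ?d0 ?d'0// mulr_gt0.
move: n1 n2; rewrite !lt_min => /andP[n1 n1'] /andP[n2 n2'].
split; first exact: Hd'.
have := Hd _ _ n2 n1.
have -> : w + l%:C * (side k t - w) - (w + l0%:C * (side k t - w)) =
  (l - l0)%:C * (side k t - w) by rewrite rmorphB; ring.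
exact.
Qed.

(** Contract the square to w: the integral H(l) of f(w + l (z - w)) / (z - w) has as derivative the
    integral of f'(w + l (z - w)). For l > 0 this is 0, the integrand having the primitive f(w + l
    (z - w)) / l. The two sides are H(1) and H(0). *)
Lemma cauchy_square f w : analytic f ->
  (forall z, unit_disc z -> ccont (cderiv f) z) ->
  unit_disc w -> modulus (w - c) < s ->
  cint c s 1 f w = f w * cint c s 1 (fun=> 1) w.
Proof.
move=> fa f'c wD wc; have fc z : unit_disc z -> ccont f z by exact: analytic_ccont.
pose Phi l z := f (w + l%:C * (z - w)) * (z - w)^-1.
pose H l := sq_int c s (Phi l).
have inD l k t : 0 <= l <= 1 -> 0 <= t <= 1 -> unit_disc (w + l%:C * (side k t - w)).
  by move=> l01 t01; apply: disc_seg => //; exact: sqD.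
have acont l z : ccont (fun z => w + l%:C * (z - w)) z.
  apply: gcontD; first exact: gcont_cst.
  apply: gcontM; first exact: gcont_cst.
  by apply: gcontD; [exact: gdiff_cont (cdiff_id z)|exact: gcont_cst].
have Pc g l k t : 0 <= t <= 1 -> ccont g (w + l%:C * (side k t - w)) ->
    ccont (fun z => g (w + l%:C * (z - w)) * (z - w)^-1) (side k t).
  move=> t01 gc; apply: gcontM.
    apply: (@gcont_comp _ _ _ g (fun z => w + l%:C * (z - w))); first exact: gc.
    exact: acont.
  by apply: ccont_inv_sub; exact: (side_neq s0 k t wc).
pose dH l := sq_int c s (fun z => cderiv f (w + l%:C * (z - w))).
have dHc l : 0 <= l <= 1 -> sq_cont c s (fun z => cderiv f (w + l%:C * (z - w))).
  move=> l01 k t t01; apply: (@gcont_comp _ _ _ (cderiv f) (fun z => w + l%:C * (z - w))).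
    by apply: f'c; exact: inD.
  exact: acont.
have dHH l : 0 <= l <= 1 -> pdiff H l (dH l).
  move=> l01; apply: (@gdiff_sum _ _ _ 4 (fun k l => seg (Phi l) (pt k) (pt k.+1))
    (fun k => seg (fun z => cderiv f (w + l%:C * (z - w))) (pt k) (pt k.+1))) => k _.
  have [d d0 Hd] := homotopy_uniform fa f'c wD wc l01 k ltr01.
  have H0 : pdiff (fun=> pt k.+1 - pt k) l 0 := gdiff_cst _ _ _.
  have cP l' : `|l' - l| < d -> path_cont (fun t => Phi l' (side k t)).
    move=> ll t t01; apply: (@pcont_comp _ (Phi l') (side k)); last exact: pcont_affine.
    by apply: Pc => //; apply: fc; have [] := Hd l' ll t t01.
  have cdP : path_cont (fun t => cderiv f (w + l%:C * (side k t - w))).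
    exact: (seg_path_cont (dHc l l01 k)).
  have K : pdiff (fun l => integral01 (fun t => Phi l (side k t))) l
      (integral01 (fun t => cderiv f (w + l%:C * (side k t - w)))).
    apply: (@param_diff _ _ _ (fun l t => Phi l (side k t)) _ l d) => //.
    - by move=> x; rewrite modulus_real; exact: cP.
    - by apply: cP; rewrite subrr normr0.
    move=> e e0; have [d1 d10 Hd1] := homotopy_uniform fa f'c wD wc l01 k e0.
    exists d1 => // l'; rewrite modulus_real => /Hd1 {}Hd1 t t01.
    have [_] := Hd1 t t01; rewrite /Phi.
    have u0 : side k t - w != 0 by exact: (side_neq s0 k t wc).
    move: u0; move: (side k t - w) => u u0.
    move: (f (w + l'%:C * u)) (f (w + l%:C * u)) (cderiv f (w + l%:C * u)) => x1 x2 x3 h.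
    have -> : x1 * u^-1 - x2 * u^-1 - (l' - l)%:C * x3 = (x1 - x2 - (l' - l)%:C * u * x3) / u.
      by field.
    rewrite modulusM modulusV ler_pdivrMr ?modulus_gt0//.
    by move: h; rewrite modulusM modulus_real mulrA.
  by have := gdiffM H0 K; rewrite mul0r add0r.
have dH0 l : 0 < l < 1 -> dH l = 0.
  move=> /andP[l0 l1]; have l01 : 0 <= l <= 1 by rewrite !ltW.
  have lC : l%:C != 0 :> R[i] by rewrite -(rmorph0 (real_complex R)) (inj_eq (@complexI R)) gt_eqF.
  apply: (@sq_FTC R c s _ (fun z => l%:C^-1 * f (w + l%:C * (z - w)))); first exact: dHc.
  move=> k t t01; set x := side k t.
  have H0 (y : R[i]) : cdiff (fun=> y : R[i]) x 0 := gdiff_cst _ _ _.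
  have da := gdiffD (H0 w) (gdiffM (H0 l%:C) (gdiffD (@cdiff_id R x) (H0 (- w)))).
  have df := gdiffM (H0 l%:C^-1) (@gdiff_comp _ _ _ f (fun z => w + l%:C * (z - w)) _ _ _ (analytic_cdiff fa (inD l k t l01 t01)) da).
  move: df; congr (gdiff _ _ _ _); rewrite /= !mul0r !add0r !addr0 mulr1 mulrA mulVf ?mul1r//.
have := pdiff_const01 dHH dH0; rewrite /H => E.
rewrite /cint -sq_intZ; last first.
  by apply: cker_cont => // k t t01; exact: gcont_cst.
transitivity (sq_int c s (Phi 1)).
  by apply: eq_sq_int => k t _; rewrite /cker /Phi expr1 mul1r (addrC w) subrK.
rewrite -E; apply: eq_sq_int => k t _.
by rewrite /cker /Phi expr1 mul0r addr0 mul1r.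
Qed.

Definition winding := cint c s 1 (fun=> 1) c.

(** Along the segment from c to w the derivative is governed by the integral of (z - v)^(-2), which
    vanishes since -(z - v)^(-1) is a primitive on the sides. *)
Lemma winding_const w : modulus (w - c) < s -> cint c s 1 (fun=> 1) w = winding.
Proof.
move=> wc; pose G l := cint c s 1 (fun=> 1) (c + l%:C * (w - c)).
have c1 : sq_cont c s (fun=> 1) by move=> k t t01; exact: gcont_cst.
have nc l : 0 <= l <= 1 -> modulus (c + l%:C * (w - c) - c) < s.
  move=> /andP[l0 l1]; rewrite addrAC subrr add0r modulusM modulus_real ger0_norm//.
  by apply: le_lt_trans wc; rewrite ler_piMl// modulus_ge0.
have := @pdiff_const01 R G (fun=> 0).
rewrite [X in _ -> _ -> X = _]/G [X in _ -> _ -> _ = X]/G mul0r addr0 mul1r (addrC c) subrK.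
move=> <- // l l01.
have := @gdiff_comp _ _ _ (cint c s 1 (fun=> 1)) (fun l => c + l%:C * (w - c)) _ _ _ (@cint_diff R c s s0 1 _ _ isT c1 (nc l l01)) (pdiff_affine c (w - c) l).
rewrite /G; congr (gdiff _ _ _ _).
rewrite {1}/cint (@sq_FTC R c s _ (fun z => - (z - (c + l%:C * (w - c)))^-1)) ?mulr0//.
  by apply: cker_cont => //; exact: nc.
move=> k t t01; set v := c + _; set x := side k t.
have x0 : x - v != 0 by exact: (side_neq s0 k t (nc l l01)).
have H0 (y : R[i]) : cdiff (fun=> y : R[i]) x 0 := gdiff_cst _ _ _.
have da := gdiffD (@cdiff_id R x) (H0 (- v)).
have := gdiffM (H0 (-1)) (@gdiff_comp _ _ _ (@GRing.inv _) (fun z => id z + - v) _ _ _ (cdiff_inv x0) da).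
rewrite /cdiff /cker /= (_ : (fun y => -1 * _) = (fun z => - (z - v)^-1)); last first.
  by apply: funext => y; rewrite mulN1r.
by congr (gdiff _ _ _ _); rewrite exprVn; ring.
Qed.

(* The exact value is [2 pi i]; Cauchy's formula only divides by it. *)
Lemma winding_far : 4 <= modulus winding.
Proof.
apply: le_trans (Im_le_modulus _); apply: le_trans (ler_norm _).
have c1 : sq_cont c s (fun=> 1) by move=> k t t01; exact: gcont_cst.
(* Rotation makes the four sides contribute equally, and the imaginary part of the integrand is 2 /
   (1 + (2t - 1)^2) >= 1. *)
have E k : seg (cker 1 (fun=> 1) c) (pt k) (pt k.+1) =
    integral01 (fun t => (2 * 'i) * (1 +i* (2 * t - 1))^-1).
  rewrite /seg -integral01Z; last first.
    apply: (seg_path_cont (f := cker 1 (fun=> 1) c)).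
    by apply: cker_cont => //; rewrite subrr modulus0.
  apply: eq_integral01 => t t01; rewrite /cker mul1r expr1 sideE sideB.
  have z0 : 1 +i* (2 * t - 1) != 0 :> R[i] by rewrite eq_complex /= oner_eq0.
  have s1 : s%:C != 0 :> R[i] by rewrite -(rmorph0 (real_complex R)) (inj_eq (@complexI R)) gt_eqF.
  have i0 : 'i ^+ k != 0 :> R[i] by rewrite expf_neq0// eq_complex /= oner_eq0 andbF.
  by move: ('i : R[i]) ('i ^+ k) i0 => x y y0; field; rewrite z0 y0 s1.
rewrite /winding /cint /sq_int (eq_bigr _ (fun (k : 'I_4) _ => E k)).
set I0 := integral01 _; rewrite sumr_const card_ord.
rewrite (_ : I0 *+ 4 = I0 + I0 + I0 + I0) ?ImD; last by rewrite !mulrS mulr0n; ring.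
have H : 1 <= complex.Im I0.
  have Ie t : complex.Im ((2 * 'i) * (1 +i* (2 * t - 1))^-1 : R[i]) = 2 / (1 + (2 * t - 1) ^+ 2).
    by rewrite /= expr1n; ring.
  have -> : complex.Im I0 =
      \int[lebesgue_measure]_(t in `[0%R, 1%R]) (2 / (1 + (2 * t - 1) ^+ 2)).
    by apply: eq_Rintegral => t _; exact: Ie.
  have ci : forall t, 0 <= t <= 1 -> {for t, continuous (fun t => 2 / (1 + (2 * t - 1) ^+ 2))}.
    move=> t _; apply: continuousM; first exact: cst_continuous.
    apply: continuousV; first by rewrite gt_eqF// ltr_pwDl// sqr_ge0.
    apply: continuousD; first exact: cst_continuous.
    have cc : {for t, continuous (fun t : R => 2 * t - 1)}.
      by apply: continuousB; [apply: continuousM; [exact: cst_continuous|exact: cvg_id]|exact: cst_continuous].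
    by rewrite (_ : (fun t => _) = (fun t => (2 * t - 1) * (2 * t - 1)));
      [exact: continuousM|apply: funext => y; rewrite expr2].
  have E1 : \int[lebesgue_measure]_(t in `[0%R, 1%R]) (cst 1 t) = 1 :> R.
    rewrite Rintegral_cst//= lebesgue_measure_itv /= lte_fin ltr01.
    by rewrite oppr0 adde0 /= mulr1.
  rewrite -[leLHS]E1; apply: le_Rintegral => //.
  - by apply: (@cont01_integrable R (cst 1)) => t _; exact: cst_continuous.
  - exact: cont01_integrable ci.
  move=> t; rewrite /= in_itv /= => /andP[t0 t1].
  have q0 := sqr_ge0 (2 * t - 1).
  rewrite ler_pdivlMr ?mul1r; first by nra.
  by rewrite ltr_pwDl.
lra.
Qed.

Lemma cauchy_formula f w : analytic f ->
  (forall z, unit_disc z -> ccont (cderiv f) z) ->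
  unit_disc w -> modulus (w - c) < s -> f w = winding^-1 * cint c s 1 f w.
Proof.
move=> fa f'c wD wc; rewrite cauchy_square// winding_const// mulrCA mulVf ?mulr1//.
by rewrite -modulus_gt0 (lt_le_trans _ winding_far).
Qed.

End CauchyFormula.

(** * The derivative of an analytic function is analytic *)

Section CderivAnalytic.
Variable R : realType.
Implicit Types (f g : R[i] -> R[i]) (z w : R[i]).

(* The primitive [F] of [f] is continuously differentiable, so it is a Cauchy
   integral, which can be differentiated three times. *)
Lemma cderiv_analytic f : analytic f -> analytic (cderiv f).
Proof.
move=> fa z zD; pose F := seg f 0.
have dF w : unit_disc w -> cdiff F w (f w) by exact: cdiff_seg0.
have Fa : analytic F by move=> w /dF /cdiff_derivable.
have F'c w : unit_disc w -> ccont (cderiv F) w.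
  move=> wD e /(analytic_ccont fa wD)[d d0 Hd]; have [d' d'0 Hd'] := disc_open wD.
  exists (Num.min d d'); first by rewrite lt_min d0.
  move=> y; rewrite lt_min => /andP[/Hd h /Hd' /dF/cdiff_cderiv ->].
  by rewrite (cdiff_cderiv (dF _ wD)).
(* Points of the sides lie within 2 s of z, so the square stays inside the disc. *)
pose s := (1 - modulus z) / 4.
have s0 : 0 < s by rewrite divr_gt0// subr_gt0.
have sqD k t : 0 <= t <= 1 -> unit_disc (side z s k t).
  move=> t01; rewrite /unit_disc /=; have := side_near z s0 k t01.
  have := modulusD (side z s k t - z) z; rewrite subrK; have : modulus z < 1 by [].
  rewrite /s; lra.
have Dz w : modulus (w - z) < s -> unit_disc w.
  have := modulusD (w - z) z; rewrite subrK /unit_disc /=; have : modulus z < 1 by [].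
  rewrite /s; lra.
have sF : sq_cont z s F by move=> k t t01; apply: analytic_ccont => //; exact: sqD.
pose K := (winding z s)^-1.
have near w : modulus (w - z) < s -> forall v, modulus (v - w) < s - modulus (w - z) ->
    modulus (v - z) < s.
  by move=> wz v; have := modulusD (v - w) (w - z); rewrite addrA subrK; lra.
have diffK n w : (0 < n < 4)%N -> modulus (w - z) < s ->
    cdiff (fun v => K * cint z s n F v) w (K * (n%:R * cint z s n.+1 F w)).
  move=> n4 wz; have H0 : cdiff (fun=> K) w 0 := gdiff_cst _ _ _.
  by have := gdiffM H0 (cint_diff s0 n4 sF wz); rewrite mul0r add0r.
have loc g h w y : modulus (w - z) < s -> (forall v, modulus (v - z) < s -> g v = h v) ->
    cdiff h w y -> cdiff g w y.
  move=> wz gh; apply: (gdiff_ext (r := s - modulus (w - z))).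
  - by rewrite subr_gt0.
  - by move=> v /(near _ wz)/gh ->.
  - by rewrite gh.
(* The kernels of order 1, 2 and 3 represent [F], [f] and [cderiv f] near z; differentiating the
   last one is the claim. *)
have F1 w : modulus (w - z) < s -> F w = K * cint z s 1 F w.
  by move=> wz; apply: cauchy_formula => //; exact: Dz.
have F2 w : modulus (w - z) < s -> f w = K * (1 * cint z s 2 F w).
  move=> wz; apply: (gdiff_unique (dF _ (Dz _ wz))).
  exact: (loc _ _ _ _ wz F1 (diffK 1%N w isT wz)).
have F3 w : modulus (w - z) < s -> cderiv f w = K * (2%:R * cint z s 3 F w).
  move=> wz; apply: cdiff_cderiv.
  apply: (loc _ (fun v => K * cint z s 2 F v) _ _ wz); last exact: (diffK 2%N w isT wz).
  by move=> v /F2; rewrite mul1r.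
have zz : modulus (z - z) < s by rewrite subrr modulus0.
have H0 : cdiff (fun=> 2%:R : R[i]) z 0 := gdiff_cst _ _ _.
apply: (@cdiff_derivable _ _ _ (0 * (K * cint z s 3 F z) + 2%:R * (K * (3%:R * cint z s 4 F z)))).
apply: (loc _ (fun v => 2%:R * (K * cint z s 3 F v)) _ _ zz).
  by move=> v /F3 ->; rewrite mulrCA.
by apply: (gdiffM H0); exact: diffK.
Qed.

Lemma cderiv_ccont f z : analytic f -> unit_disc z -> ccont (cderiv f) z.
Proof. by move=> fa; exact: (analytic_ccont (cderiv_analytic fa)). Qed.

End CderivAnalytic.

(** * The operator J_g: derivative, value at 0, linearity *)

Section VolterraOperator.
Variable R : realType.
Implicit Types (f g h : R[i] -> R[i]) (z w c : R[i]).

Lemma analyticM f g : analytic f -> analytic g -> analytic (fun z => f z * g z).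
Proof.
move=> fa ga z zD.
exact: cdiff_derivable (gdiffM (analytic_cdiff fa zD) (analytic_cdiff ga zD)).
Qed.

Lemma J_seg g f z : analytic f -> analytic g -> unit_disc z ->
  J g f z = seg (fun w => f w * cderiv g w) 0 z.
Proof.
move=> fa ga zD; have fga := analyticM fa (cderiv_analytic ga).
rewrite /seg -integral01Z; last first.
  apply: (@seg_path_cont _ (fun w => f w * cderiv g w)).
  apply: (disc_seg_cont _ (@disc0 R) zD) => w; exact: analytic_ccont.
by apply: eq_integral01 => t _; rewrite subr0 add0r mulrC.
Qed.

Lemma cdiff_J g f z : analytic f -> analytic g -> unit_disc z ->
  cdiff (J g f) z (f z * cderiv g z).
Proof.
move=> fa ga zD; have fga := analyticM fa (cderiv_analytic ga).
have [d d0 Hd] := disc_open zD.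
apply: (gdiff_ext d0 _ _ (cdiff_seg0 fga zD)); last by rewrite J_seg.
by move=> w /Hd wD; rewrite J_seg.
Qed.

Lemma J_analytic g f : analytic f -> analytic g -> analytic (J g f).
Proof. by move=> fa ga z zD; exact: cdiff_derivable (cdiff_J fa ga zD). Qed.

Lemma cderiv_J g f z : analytic f -> analytic g -> unit_disc z ->
  cderiv (J g f) z = f z * cderiv g z.
Proof. by move=> fa ga zD; exact: cdiff_cderiv (cdiff_J fa ga zD). Qed.

Lemma J0 g f : analytic f -> analytic g -> J g f 0 = 0.
Proof. by move=> fa ga; rewrite J_seg//; [rewrite /seg subrr mul0r|exact: disc0]. Qed.

Lemma J_linear g c f h z : analytic f -> analytic h -> analytic g -> unit_disc z ->
  J g (fun w => c * f w + h w) z = c * J g f z + J g h z.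
Proof.
move=> fa ha ga zD; have g'a := cderiv_analytic ga.
have H0 w : cdiff (fun=> c) w 0 := gdiff_cst _ _ _.
have ca : analytic (fun w => c * f w + h w).
  move=> w wD; apply: cdiff_derivable.
  exact: gdiffD (gdiffM (H0 w) (analytic_cdiff fa wD)) (analytic_cdiff ha wD).
have S f1 : analytic f1 -> seg_cont (fun w => f1 w * cderiv g w) 0 z.
  move=> fa1; apply: (disc_seg_cont _ (@disc0 R) zD) => w; apply: analytic_ccont.
  exact: analyticM.
have E : (fun w => (c * f w + h w) * cderiv g w) =
    (fun w => c * (f w * cderiv g w) + h w * cderiv g w).
  by apply: funext => w; rewrite mulrDl mulrA.
rewrite !J_seg// E -segZ; last exact: S.
rewrite segD//; last exact: S.
by move=> t t01; apply: gcontM; [exact: gcont_cst|exact: S].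
Qed.

End VolterraOperator.

(** * The involutions phi_a of the disc *)

Section MobiusMap.
Variable R : realType.
Implicit Types (f : R[i] -> R[i]) (a z w c : R[i]).

Definition mden a z : R[i] := 1 - a^* * z.

Definition dphi a z : R[i] := - (1 - (modulus a ^+ 2)%:C) / mden a z ^+ 2.

Lemma conj_mul a : a^* * a = (modulus a ^+ 2)%:C.
Proof.
rewrite sqr_modulus; case: a => x y /=.
by apply: complexP => /=; ring.
Qed.

Lemma mden_ge_a a z : unit_disc z -> 1 - modulus a <= modulus (mden a z).
Proof.
rewrite /unit_disc /= => zD; rewrite /mden.
have := ler_modulusB 1 (a^* * z); rewrite modulus1 modulusM modulusJ.
have : modulus a * modulus z <= modulus a by rewrite ler_piMr ?modulus_ge0// ltW.
lra.
Qed.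

Lemma mden_ge_z a z : unit_disc a -> 1 - modulus z <= modulus (mden a z).
Proof.
rewrite /unit_disc /= => aD; rewrite /mden.
have := ler_modulusB 1 (a^* * z); rewrite modulus1 modulusM modulusJ.
have : modulus a * modulus z <= modulus z by rewrite ler_piMl ?modulus_ge0// ltW.
lra.
Qed.

Lemma mden_gt0 a z : unit_disc a -> unit_disc z -> 0 < modulus (mden a z).
Proof.
move=> aD zD; apply: lt_le_trans (mden_ge_a a zD).
by rewrite subr_gt0; exact: aD.
Qed.

Lemma mden_neq0 a z : unit_disc a -> unit_disc z -> mden a z != 0.
Proof. by move=> aD zD; rewrite -modulus_gt0 mden_gt0. Qed.

Lemma mden_le2 a z : unit_disc a -> unit_disc z -> modulus (mden a z) <= 2.
Proof.
rewrite /unit_disc /= => aD zD; rewrite /mden.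
have := modulusD 1 (- (a^* * z)); rewrite modulusN modulus1 modulusM modulusJ.
have : modulus a * modulus z <= 1 by rewrite mulr_ile1 ?modulus_ge0// ltW.
lra.
Qed.

Lemma one_minus_sqr a : unit_disc a -> 0 < 1 - modulus a ^+ 2.
Proof.
by rewrite /unit_disc /= => aD; rewrite subr_gt0 expr_lt1// modulus_ge0.
Qed.

Lemma one_minus_phi a z : unit_disc a -> unit_disc z ->
  1 - modulus (phi a z) ^+ 2 =
    (1 - modulus a ^+ 2) * (1 - modulus z ^+ 2) / modulus (mden a z) ^+ 2.
Proof.
move=> aD zD; rewrite /phi modulusM modulusV -/(mden a z) expr_div_n.
have m0 : modulus (mden a z) ^+ 2 != 0.
  by rewrite expf_neq0// gt_eqF// mden_gt0.
have E : modulus (mden a z) ^+ 2 - modulus (a - z) ^+ 2 =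
    (1 - modulus a ^+ 2) * (1 - modulus z ^+ 2).
  rewrite !sqr_modulus /mden; case: a {m0 aD} => a1 a2; case: z {zD} => z1 z2 /=.
  ring.
by rewrite -E mulrBl mulfV.
Qed.

Lemma phi_disc a z : unit_disc a -> unit_disc z -> unit_disc (phi a z).
Proof.
move=> aD zD; have : 0 < 1 - modulus (phi a z) ^+ 2.
  have m0 := mden_gt0 aD zD.
  by rewrite one_minus_phi// divr_gt0 ?exprn_gt0// mulr_gt0// one_minus_sqr.
by rewrite subr_gt0 expr_lt1// modulus_ge0.
Qed.

Lemma mden_phi a z : unit_disc a -> unit_disc z ->
  mden a (phi a z) = (1 - (modulus a ^+ 2)%:C) / mden a z.
Proof.
move=> aD zD; have m0 := mden_neq0 aD zD.
rewrite -conj_mul {1}/mden /phi -/(mden a z).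
have -> : 1 = mden a z / mden a z by rewrite mulfV.
rewrite mulrA -mulrBl; congr (_ / _).
  by rewrite /mden mulfV//; ring.
Qed.

Lemma omC_neq0 a : unit_disc a -> 1 - (modulus a ^+ 2)%:C != 0 :> R[i].
Proof.
move=> aD; rewrite -(rmorph1 (real_complex R)) -rmorphB -(rmorph0 (real_complex R)).
by rewrite (inj_eq (@complexI R)) gt_eqF// one_minus_sqr.
Qed.

Lemma modulus_omC a : unit_disc a ->
  modulus (1 - (modulus a ^+ 2)%:C) = 1 - modulus a ^+ 2.
Proof.
move=> aD; rewrite -(rmorph1 (real_complex R)) -rmorphB modulus_real ger0_norm//.
by rewrite ltW// one_minus_sqr.
Qed.

Lemma phiK a z : unit_disc a -> unit_disc z -> phi a (phi a z) = z.
Proof.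
move=> aD zD; rewrite {1}/phi -/(mden a _) mden_phi//.
have m0 := mden_neq0 aD zD; have o0 := omC_neq0 aD.
apply: (mulIf o0); rewrite -mulrA invf_div divfK//.
rewrite mulrC /phi -/(mden a z) mulrBr mulrCA mulfV// mulr1 -conj_mul /mden.
ring.
Qed.

Lemma phi_at0 a : phi a 0 = a.
Proof. by rewrite /phi subr0 mulr0 subr0 divr1. Qed.

Lemma cdiff_phi a z : unit_disc a -> unit_disc z -> cdiff (phi a) z (dphi a z).
Proof.
move=> aD zD; have m0 := mden_neq0 aD zD.
have H0 c : cdiff (fun=> c) z 0 := gdiff_cst _ _ _.
have dz := @cdiff_id R z.
have dm := gdiffD (H0 1) (gdiffM (H0 (- a^*)) dz).
have dn := gdiffD (H0 a) (gdiffM (H0 (-1)) dz).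
have E : (fun y => 1 + - a^* * id y) = mden a.
  by apply: funext => y; rewrite /mden mulNr.
rewrite E in dm.
have di := @gdiff_comp R R[i] id (@GRing.inv _) (mden a) z _ _ (cdiff_inv m0) dm.
have := gdiffM dn di; rewrite /cdiff.
rewrite (_ : (fun y => _ * (GRing.inv \o mden a) y) = phi a); last first.
  by apply: funext => y; rewrite /phi /= mulN1r.
congr (gdiff _ _ _ _); rewrite /= /dphi -conj_mul.
have aux (b m : R[i]) : m != 0 -> m = 1 - b * z ->
    (0 + (0 * z + -1 * 1)) / m + (a + -1 * z) * ((0 + (0 * z + - b * 1)) * - m ^- 2) =
    - (1 - b * a) / m ^+ 2.
  move=> mN E2; transitivity ((- m + (a - z) * b) / m ^+ 2); first by field.
  by congr (_ / _); rewrite E2; ring.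
exact: aux.
Qed.

Lemma dphi_modulus a z : unit_disc a -> unit_disc z ->
  modulus (dphi a z) = (1 - modulus a ^+ 2) / modulus (mden a z) ^+ 2.
Proof.
move=> aD zD; rewrite /dphi modulusM modulusN modulusV modulusX modulus_omC//.
Qed.

Lemma dphi_phi a z : unit_disc a -> unit_disc z ->
  modulus (dphi a (phi a z)) = (modulus (dphi a z))^-1.
Proof.
move=> aD zD; rewrite !dphi_modulus//; last exact: phi_disc.
rewrite mden_phi// modulusM modulusV modulus_omC//.
have := one_minus_sqr aD; have := mden_gt0 aD zD.
move: (modulus (mden a z)) (1 - modulus a ^+ 2) => m u m0 u0.
by field; rewrite !gt_eqF.
Qed.

(** An exact identity in place of a mean value inequality: it controls the image of a small square
    by |phi'| at the points themselves. *)
Lemma phi_sub a z w : unit_disc a -> unit_disc z -> unit_disc w ->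
  modulus (phi a z - phi a w) ^+ 2 =
    modulus (z - w) ^+ 2 * (modulus (dphi a z) * modulus (dphi a w)).
Proof.
move=> aD zD wD; rewrite !dphi_modulus//.
have mz := mden_neq0 aD zD; have mw := mden_neq0 aD wD.
have -> : phi a z - phi a w =
    - ((1 - (modulus a ^+ 2)%:C) * (z - w) / (mden a z * mden a w)).
  rewrite -conj_mul /phi -/(mden a z) -/(mden a w).
  have aux (b m1 m2 : R[i]) : m1 != 0 -> m2 != 0 -> m1 = 1 - b * z -> m2 = 1 - b * w ->
      (a - z) / m1 - (a - w) / m2 = - ((1 - b * a) * (z - w) / (m1 * m2)).
    move=> m10 m20 E1 E2.
    transitivity (((a - z) * m2 - (a - w) * m1) / (m1 * m2)); first by field; rewrite m10 m20.
    by rewrite -[RHS]mulNr; congr (_ / _); rewrite E1 E2; ring.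
  exact: aux.
rewrite modulusN !modulusM modulusV modulusM modulus_omC//.
have := mden_gt0 aD zD; have := mden_gt0 aD wD.
move: (modulus (mden a z)) (modulus (mden a w)) => m1 m2 m10 m20.
by field; rewrite !gt_eqF.
Qed.

Lemma cdiff_recenter f a z : analytic f -> unit_disc a -> unit_disc z ->
  cdiff (recenter f a) z (dphi a z * cderiv f (phi a z)).
Proof.
move=> fa aD zD; have H0 : cdiff (fun=> - f a) z 0 := gdiff_cst _ _ _.
have := gdiffD (@gdiff_comp _ _ _ f (phi a) z _ _ (analytic_cdiff fa (phi_disc aD zD))
  (cdiff_phi aD zD)) H0.
by rewrite addr0.
Qed.

Lemma cderiv_recenter f a z : analytic f -> unit_disc a -> unit_disc z ->
  cderiv (recenter f a) z = dphi a z * cderiv f (phi a z).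
Proof. by move=> fa aD zD; exact: cdiff_cderiv (cdiff_recenter fa aD zD). Qed.

Lemma recenter_analytic f a : analytic f -> unit_disc a -> analytic (recenter f a).
Proof. by move=> fa aD z zD; exact: cdiff_derivable (cdiff_recenter fa aD zD). Qed.

Lemma recenter0 f a : recenter f a 0 = 0.
Proof. by rewrite /recenter phi_at0 subrr. Qed.

Lemma density_recenter p f a z : analytic f -> unit_disc a -> unit_disc z ->
  dirichlet_density p (recenter f a) z =
    modulus (cderiv f (phi a z)) ^+ 2 * modulus (dphi a z) ^+ 2 *
      (1 - modulus z ^+ 2) `^ p.
Proof.
move=> fa aD zD; rewrite /dirichlet_density cderiv_recenter// modulusM exprMn.
by rewrite (mulrC (modulus (dphi _ _) ^+ 2)).
Qed.

End MobiusMap.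

(** * Continuous real functions on the disc *)

Section DiscContinuity.
Variable R : realType.
Implicit Types (F G : R[i] -> R) (f : R[i] -> R[i]) (z : R[i]).

Definition rcont F z := forall e : R, 0 < e -> exists2 d : R, 0 < d &
  forall y, modulus (y - z) < d -> `|F y - F z| < e.

Definition dcont F := forall z, unit_disc z -> rcont F z.

Lemma rcontE F z : rcont F z <-> ccont (fun z => (F z)%:C) z.
Proof.
by split=> H e /H[d d0 Hd]; exists d => // y /Hd; rewrite -rmorphB modulus_real.
Qed.

Lemma rcontD F G z : rcont F z -> rcont G z -> rcont (fun z => F z + G z) z.
Proof.
move=> /rcontE cF /rcontE cG; apply/rcontE.
by rewrite (_ : (fun z => _) = fun z => (F z)%:C + (G z)%:C);
  [exact: gcontD|apply: funext => y; rewrite rmorphD].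
Qed.

Lemma rcontM F G z : rcont F z -> rcont G z -> rcont (fun z => F z * G z) z.
Proof.
move=> /rcontE cF /rcontE cG; apply/rcontE.
by rewrite (_ : (fun z => _) = fun z => (F z)%:C * (G z)%:C);
  [exact: gcontM|apply: funext => y; rewrite rmorphM].
Qed.

Lemma rcontX F n z : rcont F z -> rcont (fun z => F z ^+ n) z.
Proof.
move=> cF; elim: n => [|n IH].
  by move=> e e0; exists 1 => // y _; rewrite !expr0 subrr normr0.
by rewrite (_ : (fun z => _) = fun z => F z * F z ^+ n);
  [exact: rcontM|apply: funext => y; rewrite exprS].
Qed.

Lemma rcont_cst (r : R) z : rcont (fun=> r) z.
Proof. by move=> e e0; exists 1 => // y _; rewrite subrr normr0. Qed.

Lemma rcont_modulus f z : ccont f z -> rcont (fun z => modulus (f z)) z.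
Proof.
move=> cf e /cf[d d0 Hd]; exists d => // y /Hd; apply: le_lt_trans.
rewrite ler_norml; apply/andP; split; last exact: ler_modulusB.
by rewrite lerNl opprB modulusB; exact: ler_modulusB.
Qed.

Lemma rcont_comp (k : R -> R) F z : {for F z, continuous k} -> rcont F z ->
  rcont (k \o F) z.
Proof.
move=> /real_contP ck cF e /ck[d d0 Hd]; have [d' d'0 Hd'] := cF d d0.
by exists d' => // y /Hd'; exact: Hd.
Qed.

Lemma rcont_compC F f z : rcont F (f z) -> ccont f z -> rcont (F \o f) z.
Proof.
move=> cF cf e /cF[d d0 Hd]; have [d' d'0 Hd'] := cf d d0.
by exists d' => // y /Hd'; exact: Hd.
Qed.

Lemma rcont_id z : ccont id z.
Proof. exact: gdiff_cont (cdiff_id z). Qed.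

Lemma powR_cont (p x : R) : 0 < x -> {for x, continuous (fun x => x `^ p)}.
Proof. by move=> x0; exact: is_derive_cont (is_derive1_powR p x0). Qed.

Lemma rcont_powR (p : R) F z : 0 < F z -> rcont F z -> rcont (fun z => F z `^ p) z.
Proof.
by move=> F0 cF; apply: (@rcont_comp (fun x => x `^ p)) => //; exact: powR_cont.
Qed.

Lemma dcont_weight (p : R) : dcont (fun z => (1 - modulus z ^+ 2) `^ p).
Proof.
move=> z zD; apply: rcont_powR; first exact: one_minus_sqr.
apply: rcontD; first exact: rcont_cst.
rewrite (_ : (fun z => - _) = (fun z => -1 * modulus z ^+ 2)); last first.
  by apply: funext => y; rewrite mulN1r.
apply: rcontM; first exact: rcont_cst.
by apply: rcontX; apply: rcont_modulus; exact: rcont_id.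
Qed.

Lemma dcont_density (p : R) f : analytic f -> dcont (dirichlet_density p f).
Proof.
move=> fa z zD; apply: rcontM; last exact: dcont_weight.
by apply: rcontX; apply: rcont_modulus; exact: cderiv_ccont.
Qed.

Lemma density_ge0 (p : R) f z : 0 <= dirichlet_density p f z.
Proof. by rewrite mulr_ge0 ?sqr_ge0// powR_ge0. Qed.

End DiscContinuity.

(** * Grids, measurability and area integrals on the disc *)

Section AreaMeasure.
Variable R : realType.
Implicit Types (F G : R[i] -> R) (z : R[i]) (w v : R * R) (x y : R).
Local Notation mu2 := (@lebesgue_measure R \x @lebesgue_measure R)%E.

Local Notation RR := (measurableTypeR R * measurableTypeR R)%type.

Definition ofC z : R * R := (complex.Re z, complex.Im z).

Lemma ofCK z : toC (ofC z) = z. Proof. by case: z. Qed.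

(** Side of the cells when [-1, 1) is cut into N + 1 equal parts. *)
Definition mesh (N : nat) : R := 2 / N.+1%:R.

Lemma mesh_gt0 N : 0 < mesh N. Proof. by rewrite divr_gt0. Qed.

Definition cell (N : nat) x : nat := Num.truncn ((x + 1) / mesh N).

Definition cellset (N i : nat) : set R :=
  [set` `[-1 + i%:R * mesh N, -1 + i.+1%:R * mesh N[ ].

(** [Num.truncn] is 0 on negative numbers, so the index alone would place every point left of -1 in
    cell 0; this is what the first conjunct excludes. *)
Lemma in_cellset N i x : cellset N i x <-> (-1 <= x) && (i == cell N x).
Proof.
have m0 := mesh_gt0 N; rewrite /cellset /= in_itv /=.
have E : (-1 + i%:R * mesh N <= x < -1 + i.+1%:R * mesh N) =
    (i%:R <= (x + 1) / mesh N < i.+1%:R).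
  rewrite ler_pdivlMr// ltr_pdivrMr//.
  by apply/andP/andP => -[? ?]; split; lra.
rewrite E; split.
  move=> /andP[h1 h2]; apply/andP; split.
    have : 0 <= (x + 1) / mesh N by exact: le_trans h1.
    by rewrite ler_pdivlMr// mul0r; lra.
  by rewrite /cell (@truncn_def _ _ i) ?h1.
move=> /andP[x1 /eqP ->]; apply: truncn_itv.
by rewrite divr_ge0 ?(ltW m0)//; lra.
Qed.

Lemma cell_lt N x : -1 <= x -> x < 1 -> (cell N x < N.+1)%N.
Proof.
move=> x1 x2; have := truncn_itv (x := (x + 1) / mesh N).
rewrite divr_ge0 ?(ltW (mesh_gt0 N))//; last lra.
move=> /(_ isT) /andP[h _]; rewrite -(ltr_nat R); apply: le_lt_trans h _.
rewrite /mesh invf_div mulrA ltr_pdivrMr// mulrC ltr_pM2l//; lra.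
Qed.

Lemma cellset_dist N i x y : cellset N i x -> cellset N i y -> `|x - y| < mesh N.
Proof.
rewrite /cellset /= !in_itv /= => /andP[h1 h2] /andP[h3 h4].
by move: h2 h4; rewrite -natr1 mulrDl mul1r ltr_norml => h2 h4; apply/andP; split; lra.
Qed.

Lemma cellset_corner N i : cellset N i (-1 + i%:R * mesh N).
Proof.
by rewrite /cellset /= in_itv /= lexx /= ltrD2l ltr_pM2r ?mesh_gt0// ltr_nat.
Qed.

Definition sq N (i j : nat) : set (R * R) := cellset N i `*` cellset N j.

Lemma measurable_cellset N i : measurable (cellset N i).
Proof. exact: measurable_itv. Qed.

Lemma measurable_sq N i j : measurable (sq N i j).
Proof. by apply: measurableX; exact: measurable_cellset. Qed.

Lemma sq_area N i j : mu2 (sq N i j) = (mesh N ^+ 2)%:E.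
Proof.
rewrite product_measure1E; [|exact: measurable_cellset|exact: measurable_cellset].
have E k : lebesgue_measure (cellset N k) = (mesh N)%:E.
  rewrite lebesgue_measure_itv /= lte_fin ltrD2l ltr_pM2r ?mesh_gt0// ltr_nat ltnSn.
  by rewrite -EFinB; congr EFin; rewrite -natr1; ring.
transitivity ((mesh N)%:E * (mesh N)%:E)%E; first by congr (_ * _)%E; exact: E.
by rewrite -EFinM expr2.
Qed.

Lemma sq_dist N i j w v : sq N i j w -> sq N i j v ->
  modulus (toC w - toC v) < 2 * mesh N.
Proof.
move=> [h1 h2] [h3 h4]; apply: (le_lt_trans (modulus_le_ReIm _)) => /=.
by have := cellset_dist h1 h3; have := cellset_dist h2 h4; lra.
Qed.

Lemma planeD_bound w : planeD w -> `|w.1| < 1 /\ `|w.2| < 1.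
Proof.
rewrite /planeD /= => wD; split; apply: le_lt_trans wD.
  exact: Re_le_modulus (toC w).
exact: Im_le_modulus (toC w).
Qed.

Lemma sq_cell N w : planeD w -> sq N (cell N w.1) (cell N w.2) w.
Proof.
move=> /planeD_bound[]; rewrite !ltr_norml => /andP[h1 _] /andP[h2 _].
by split => /=; apply/in_cellset; rewrite eqxx ltW.
Qed.

Lemma mesh_small (d : R) : 0 < d -> exists N0, forall N, (N0 <= N)%N -> 2 * mesh N < d.
Proof.
move=> d0; exists (Num.bound (4 / d)) => N HN.
rewrite /mesh mulrA ltr_pdivrMr// -ltr_pdivrMl// mulrC.
apply: (@lt_le_trans _ _ (Num.bound (4 / d))%:R); last by rewrite ler_nat leqW.
by rewrite (_ : 2 * 2 = 4 :> R); [apply: archi_boundP; rewrite divr_ge0// ltW|ring].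
Qed.

(** An open set is the union of the grid squares it contains, over all meshes; this is a countable
    union of products of intervals. *)
Lemma open_plane_measurable (O : set (R * R)) : O `<=` @planeD R ->
  (forall w, O w -> exists2 d : R, 0 < d &
     forall v, modulus (toC v - toC w) < d -> O v) -> measurable O.
Proof.
move=> OD oO.
have -> : O = \bigcup_N \bigcup_i \bigcup_j
    (if `[< sq N i j `<=` O >] then sq N i j else set0).
  apply/seteqP; split=> [w Ow|w [N _ [i _ [j _]]]]; last first.
    by case: asboolP => // H /H.
  have [d d0 Hd] := oO w Ow; have [N HN] := mesh_small d0.
  exists N => //; exists (cell N w.1) => //; exists (cell N w.2) => //.
  have sw := sq_cell N (OD _ Ow); case: asboolP => // -[] v sv; apply: Hd.
  by apply: lt_trans (HN N _); [exact: sq_dist sv sw|].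
apply: bigcupT_measurable => N; apply: bigcupT_measurable => i.
apply: bigcupT_measurable => j; case: ifP => _ //; exact: measurable_sq.
Qed.

Lemma planeD_measurable : measurable (@planeD R).
Proof.
apply: open_plane_measurable => // w wD; have [d d0 Hd] := disc_open wD.
by exists d => // v /Hd.
Qed.

Lemma dcont_measurable F : dcont F ->
  measurable_fun (@planeD R : set RR) (fun w : RR => F (toC w) : measurableTypeR R).
Proof.
move=> cF; apply: (measurability (@RGenOInfty.G R)).
  exact: RGenOInfty.measurableE.
move=> _ [_ [x ->] <-]; apply: open_plane_measurable; first by move=> w [].
move=> w [wD]; rewrite /= in_itv /= andbT => xF.
have [d d0 Hd] := disc_open wD.
have F0 : 0 < F (toC w) - x by rewrite subr_gt0.
have [d' d'0 Hd'] := cF _ wD _ F0.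
exists (Num.min d d'); first by rewrite lt_min d0.
move=> v; rewrite lt_min => /andP[/Hd vD /Hd' h]; split=> //=.
by rewrite in_itv /= andbT; move: h; rewrite ltr_norml => /andP[h _]; lra.
Qed.

Lemma dcont_emeasurable F : dcont F ->
  measurable_fun (@planeD R : set RR) (fun w : RR => (F (toC w))%:E).
Proof. by move=> cF; apply/measurable_EFinP; exact: dcont_measurable. Qed.

Definition dint F : \bar R := (\int[mu2]_(w in @planeD R) (F (toC w))%:E)%E.

Lemma area_integralE F : area_integral (@planeD R) F = ((pi^-1)%:E * dint F)%E.
Proof. by []. Qed.

Lemma dint_ge0 F : (forall z, unit_disc z -> 0 <= F z) -> (0 <= dint F)%E.
Proof. by move=> F0; apply: integral_ge0 => w wD; rewrite lee_fin F0. Qed.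

Lemma dint_le F G : dcont F -> dcont G -> (forall z, unit_disc z -> 0 <= F z <= G z) ->
  (dint F <= dint G)%E.
Proof.
move=> cF cG FG; apply: ge0_le_integral.
- exact: planeD_measurable.
- by move=> w /FG /andP[F0 _]; rewrite lee_fin.
- exact: dcont_emeasurable.
- exact: dcont_emeasurable.
- by move=> w /FG /andP[_]; rewrite lee_fin.
Qed.

Lemma eq_dint F G : (forall z, unit_disc z -> F z = G z) -> dint F = dint G.
Proof.
by move=> FG; apply: eq_integral => w; rewrite inE => /FG ->.
Qed.

Lemma dintZ (k : R) F : 0 <= k -> dcont F -> (forall z, unit_disc z -> 0 <= F z) ->
  dint (fun z => k * F z) = (k%:E * dint F)%E.
Proof.
move=> k0 cF F0; rewrite /dint -ge0_integralZl//.
- exact: planeD_measurable.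
- exact: dcont_emeasurable.
- by move=> w wD; rewrite lee_fin F0.
Qed.

Lemma dintD F G : dcont F -> dcont G -> (forall z, unit_disc z -> 0 <= F z) ->
  (forall z, unit_disc z -> 0 <= G z) ->
  dint (fun z => F z + G z) = (dint F + dint G)%E.
Proof.
move=> cF cG F0 G0; rewrite /dint -ge0_integralD//.
- exact: planeD_measurable.
- by move=> w wD; rewrite lee_fin F0.
- exact: dcont_emeasurable.
- by move=> w wD; rewrite lee_fin G0.
- exact: dcont_emeasurable.
Qed.

Definition box z (r : R) : set (R * R) :=
  [set` `[complex.Re z - r, complex.Re z + r]] `*`
  [set` `[complex.Im z - r, complex.Im z + r]].

Lemma measurable_box z r : measurable (box z r).
Proof. by apply: measurableX; exact: measurable_itv. Qed.

Lemma box_area z r : 0 < r -> mu2 (box z r) = (4 * r ^+ 2)%:E.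
Proof.
move=> r0; rewrite product_measure1E; [|exact: measurable_itv|exact: measurable_itv].
have E (x : R) : lebesgue_measure [set` `[x - r, x + r]] = (2 * r)%:E.
  rewrite lebesgue_measure_itv /= lte_fin ifT; last lra.
  by rewrite -EFinB; congr EFin; ring.
transitivity ((2 * r)%:E * (2 * r)%:E)%E; first by congr (_ * _)%E; exact: E.
by rewrite -EFinM; congr EFin; ring.
Qed.

Lemma in_box z r w : modulus (toC w - z) <= r -> box z r w.
Proof.
move=> h; have := le_trans (Re_le_modulus _) h; have := le_trans (Im_le_modulus _) h.
rewrite ReD ImD ReN ImN /= !ler_norml => /andP[h1 h2] /andP[h3 h4].
by split; rewrite /= in_itv /=; apply/andP; split; lra.
Qed.

Lemma planeD_area : (mu2 (@planeD R) <= 4%:E)%E.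
Proof.
rewrite (_ : 4 = 4 * 1 ^+ 2 :> R); last by rewrite expr1n mulr1.
rewrite -(@box_area 0)//; apply: le_measure; rewrite ?inE.
- exact: planeD_measurable.
- exact: measurable_box.
by move=> w wD; apply: in_box; rewrite subr0; exact: ltW.
Qed.

Lemma dint_cst_le (k : R) : 0 <= k -> (dint (fun=> k) <= (4 * k)%:E)%E.
Proof.
move=> k0; rewrite /dint integral_cst; last exact: planeD_measurable.
by rewrite mulrC EFinM lee_wpmul2l// planeD_area.
Qed.

Lemma le_limn_einf (u : (\bar R)^nat) (l : \bar R) N0 :
  (forall n, (N0 <= n)%N -> (l <= u n)%E) -> (l <= limn_einf u)%E.
Proof.
move=> H; rewrite limn_einf_lim; apply: lime_ge; first exact: is_cvg_einfs.
exists N0 => // n /= Hn; apply: le_ereal_inf_tmp => _ [k /= nk <-].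
by apply: H; exact: leq_trans nk.
Qed.

Lemma limn_einf_le (u : (\bar R)^nat) (l : \bar R) :
  (forall n, (u n <= l)%E) -> (limn_einf u <= l)%E.
Proof.
move=> H; rewrite limn_einf_lim; apply: lime_le; first exact: is_cvg_einfs.
exists 0%N => // n _; apply: le_trans (H n); apply: ereal_inf_lbound.
by exists n => /=.
Qed.

End AreaMeasure.

(** * Change of variables under phi_a, up to a constant *)

Section ChangeOfVariables.
Variable R : realType.
Implicit Types (G : R[i] -> R) (z : R[i]) (w v : R * R) (x y : R).
Local Notation mu2 := (@lebesgue_measure R \x @lebesgue_measure R)%E.
Local Notation RR := (measurableTypeR R * measurableTypeR R)%type.

Lemma mden_ccont (a z : R[i]) : ccont (mden a) z.
Proof.
rewrite (_ : mden a = fun z => 1 + - a^* * z); last first.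
  by apply: funext => y; rewrite /mden mulNr.
apply: gcontD; first exact: gcont_cst.
by apply: gcontM; [exact: gcont_cst|exact: rcont_id].
Qed.

Lemma phi_ccont (a z : R[i]) : unit_disc a -> unit_disc z -> ccont (phi a) z.
Proof. by move=> aD zD; exact: gdiff_cont (cdiff_phi aD zD). Qed.

Lemma dcont_dphi (a : R[i]) : unit_disc a -> dcont (fun z => modulus (dphi a z)).
Proof.
move=> aD z zD; apply: rcont_modulus; apply: gcontM; first exact: gcont_cst.
apply: (@gcont_comp _ _ _ (@GRing.inv _) (fun z => mden a z ^+ 2)).
  by apply: gdiff_cont (cdiff_inv _); rewrite expf_neq0// mden_neq0.
by apply: gcontX; exact: mden_ccont.
Qed.

(** The squared modulus of phi' is the Jacobian of phi as a map of the plane. *)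
Definition pullback (a : R[i]) G z := G (phi a z) * modulus (dphi a z) ^+ 2.

Lemma dcont_pullback (a : R[i]) G : unit_disc a -> dcont G -> dcont (pullback a G).
Proof.
move=> aD cG z zD; apply: rcontM; last by apply: rcontX; exact: dcont_dphi.
apply: (@rcont_compC _ G (phi a)); last exact: phi_ccont.
by apply: cG; exact: phi_disc.
Qed.

Lemma dphi_gt0 (a z : R[i]) : unit_disc a -> unit_disc z -> 0 < modulus (dphi a z).
Proof.
move=> aD zD; rewrite dphi_modulus// divr_gt0 ?one_minus_sqr//.
by rewrite exprn_gt0// mden_gt0.
Qed.

Definition corner (N : nat) (k : 'I_N.+1 * 'I_N.+1) : R * R :=
  (-1 + (k.1 : nat)%:R * mesh R N, -1 + (k.2 : nat)%:R * mesh R N).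

Lemma corner_sq N (k : 'I_N.+1 * 'I_N.+1) : @sq R N k.1 k.2 (corner k).
Proof. by split; exact: cellset_corner. Qed.

Lemma sum_indic_sq N w :
  \sum_(k : 'I_N.+1 * 'I_N.+1) (\1_(@sq R N k.1 k.2) w : R) <= 1.
Proof.
have [[k0 Hk0]|H] := pselect (exists k : 'I_N.+1 * 'I_N.+1, @sq R N k.1 k.2 w).
  rewrite (bigD1 k0)//= indicE mem_set// big1 ?addr0// => k kk0.
  rewrite indicE memNset// => Hk; move/eqP: kk0; apply.
  have [/in_cellset/andP[_ /eqP a1] /in_cellset/andP[_ /eqP a2]] := Hk0.
  have [/in_cellset/andP[_ /eqP b1] /in_cellset/andP[_ /eqP b2]] := Hk.
  rewrite [k]surjective_pairing [k0]surjective_pairing.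
  by congr pair; apply: ord_inj; rewrite ?b1 ?b2.
rewrite big1 ?ler01// => k _; rewrite indicE memNset// => Hk; apply: H.
by exists k.
Qed.

(* Call a square of the grid of mesh [h] good if [G] and [|phi'|] vary on it by
   a factor of at most 2.  As [phi] is an involution, the preimage of a good
   square then lies in a box of side [O(h |phi'|)].  Every point of the disc is
   in a good square once [h] is small, and Fatou's lemma concludes. *)
Lemma pullback_pos (a : R[i]) G : unit_disc a -> dcont G ->
  (forall z, unit_disc z -> 0 < G z) ->
  (dint (pullback a G) <= 1024%:E * dint G)%E.
Proof.
(* On the preimage of a good square with corner c the integrand is at most 8 G(c) / |phi'(c)|^2, and
   the box around it has area 4 * 16 h^2 |phi'(c)|^2; a last factor 2 replaces G(c) by the values of
   G on the square. The product is 1024. *)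
have L0 : 0 < 512 :> R by rewrite ltr0n.
have LE : 512 = 8 * (4 * 16) :> R by rewrite -!natrM.
have KE : 1024 = 2 * 512 :> R by rewrite -natrM.
have K0 : 0 < 1024 :> R by rewrite ltr0n.
move: L0 LE KE K0; move: (1024 : R) (512 : R) => K L L0 LE KE K0.
move=> aD cG G0; pose d z := modulus (dphi a z).
have d0 z : unit_disc z -> 0 < d z by exact: dphi_gt0.
pose P := pullback a G.
have P0 z : unit_disc z -> 0 <= P z.
  by move=> zD; rewrite mulr_ge0 ?sqr_ge0// ltW//; apply: G0; exact: phi_disc.
have cP : dcont P by exact: dcont_pullback.
pose good N (k : 'I_N.+1 * 'I_N.+1) := @sq R N k.1 k.2 `<=` @planeD R /\
  forall w, @sq R N k.1 k.2 w ->
  [/\ G (toC w) <= 2 * G (toC (corner k)), G (toC (corner k)) <= 2 * G (toC w),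
      d (toC w) <= 2 * d (toC (corner k)) & d (toC (corner k)) <= 2 * d (toC w)].
pose T N (k : 'I_N.+1 * 'I_N.+1) : set RR := if `[< good N k >] then
  [set w | planeD w /\ @sq R N k.1 k.2 (ofC (phi a (toC w)))] else set0.
have mT N k : measurable (T N k).
  rewrite /T; case: ifP => // _.
  have mRe : dcont (fun z => complex.Re (phi a z)).
    move=> z zD e e0; have [r r0 Hr] := phi_ccont aD zD e0; exists r => // y /Hr.
    by apply: le_lt_trans; apply: le_trans (Re_le_modulus _); rewrite ReD ReN.
  have mIm : dcont (fun z => complex.Im (phi a z)).
    move=> z zD e e0; have [r r0 Hr] := phi_ccont aD zD e0; exists r => // y /Hr.
    by apply: le_lt_trans; apply: le_trans (Im_le_modulus _); rewrite ImD ImN.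
  have := measurableI _ _
    (dcont_measurable mRe (@planeD_measurable R) (@measurable_cellset R N k.1))
    (dcont_measurable mIm (@planeD_measurable R) (@measurable_cellset R N k.2)).
  by congr measurable; apply/seteqP; split=> w /=; [move=> [[? ?] [? ?]]|move=> [? [? ?]]].
pose f N w : \bar R := (\sum_(k : 'I_N.+1 * 'I_N.+1) (P (toC w) * \1_(T N k) w)%:E)%E.
have mI N k : measurable_fun (@planeD R : set RR) (fun w : RR => (P (toC w) * \1_(T N k) w)%:E).
  apply/measurable_EFinP; apply: measurable_funM; first exact: dcont_measurable.
  exact: measurable_indic.
have mf N : measurable_fun (@planeD R : set RR) (f N).
  by apply: emeasurable_sum => k; exact: mI.
have f0 N w : planeD w -> (0 <= f N w)%E.
  move=> wD; apply: sume_ge0 => k _; rewrite lee_fin mulr_ge0//.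
  exact: P0.
have step1 : (dint P <= \int[mu2]_(w in @planeD R) limn_einf (f^~ w))%E.
  apply: ge0_le_integral.
  - exact: planeD_measurable.
  - by move=> w wD; rewrite lee_fin P0.
  - exact: dcont_emeasurable.
  - rewrite (_ : (fun w => limn_einf (f^~ w)) = (fun w => - limn_esup (fun n => - f n w))%E).
      by apply: measurableT_comp => //; apply: measurable_fun_limn_esup => n; exact: measurableT_comp.
    by apply: funext => w; rewrite -limn_einfN; congr limn_einf; apply: funext => n /=; rewrite oppeK.
  move=> w wD; set z := phi a (toC w).
  have zD : unit_disc z by exact: phi_disc.
  have [r1 r10 H1] := disc_open zD.
  (* If the values on a square deviate from the one at z by less than a quarter of it, any two have
     ratio below 5/3, hence at most 2. *)
  have e1 : 0 < G z / 4 by rewrite divr_gt0// G0.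
  have [r2 r20 H2] := cG z zD _ e1.
  have e2 : 0 < d z / 4 by rewrite divr_gt0// d0.
  have [r3 r30 H3] := dcont_dphi aD zD e2.
  have r0 : 0 < Num.min r1 (Num.min r2 r3) by rewrite !lt_min r10 r20.
  have [N0 HN0] := mesh_small r0.
  apply: (@le_limn_einf _ _ _ N0) => N /HN0 HN.
  have zP : planeD (ofC z) by rewrite /planeD /= ofCK.
  have [] := planeD_bound zP; rewrite !ltr_norml => /andP[x1 x2] /andP[y1 y2].
  have k1 := cell_lt N (ltW x1) x2; have k2 := cell_lt N (ltW y1) y2.
  pose k := (Ordinal k1, Ordinal k2) : 'I_N.+1 * 'I_N.+1.
  have Hz : @sq R N k.1 k.2 (ofC z) by exact: sq_cell.
  have nearz v : @sq R N k.1 k.2 v -> [/\ unit_disc (toC v),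
      `|G (toC v) - G z| < G z / 4 & `|d (toC v) - d z| < d z / 4].
    move=> vS; have := lt_trans (sq_dist vS Hz) HN; rewrite ofCK.
    by rewrite !lt_min => /and3P[/H1 ? /H2 ? /H3 ?].
  have gk : good N k.
    split; first by move=> v /nearz[].
    have [_ + +] := nearz _ (corner_sq k).
    rewrite !ltr_norml => /andP[? ?] /andP[? ?] v /nearz[_].
    rewrite !ltr_norml => /andP[? ?] /andP[? ?].
    by split; lra.
  rewrite /f (bigD1 k)//= indicE mem_set; last by rewrite /T; case: asboolP.
  rewrite mulr1 leeDl//; apply: sume_ge0 => k' _; rewrite lee_fin mulr_ge0//.
  exact: P0.
apply: (le_trans step1); apply: le_trans (fatou _ _ mf f0) _.
  exact: planeD_measurable.
apply: limn_einf_le => N.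
rewrite ge0_integral_sum//; last 2 first.
- exact: planeD_measurable.
- by move=> k w wD; rewrite lee_fin mulr_ge0//; exact: P0.
have mQ (k : 'I_N.+1 * 'I_N.+1) : measurable_fun (@planeD R : set RR) (fun w : RR =>
    (K * (G (toC w) * \1_(@sq R N k.1 k.2) w))%:E).
  apply/measurable_EFinP; apply: measurable_funM; first exact: measurable_cst.
  apply: measurable_funM; first exact: dcont_measurable.
  by apply: measurable_indic; exact: measurable_sq.
have Q0 (k : 'I_N.+1 * 'I_N.+1) w : planeD w -> (0 <= (K * (G (toC w) * \1_(@sq R N k.1 k.2) w))%:E)%E.
  by move=> wD; rewrite lee_fin mulr_ge0 ?(ltW K0)// mulr_ge0// ltW// G0.
have perk (k : 'I_N.+1 * 'I_N.+1) : (\int[mu2]_(w in @planeD R) (P (toC w) * \1_(T N k) w)%:E <=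
    \int[mu2]_(w in @planeD R) (K * (G (toC w) * \1_(@sq R N k.1 k.2) w))%:E)%E.
  rewrite /T; case: asboolP => [[QD gk]|_]; last first.
    rewrite integral0_eq; first by apply: integral_ge0 => w; exact: Q0.
    by move=> w _; rewrite indic0 mulr0.
  set c := toC (corner k); have cD : unit_disc c by exact: QD (corner_sq k).
  have Gc := G0 c cD; have dc := d0 c cD; have h0 := @mesh_gt0 R N.
  set h := mesh R N in h0.
  (* By [phi_sub], |phi z - phi c|^2 <= (2h)^2 (2 d c) (d c) on a good square, and 8 <= 16. *)
  pose r := 4 * h * d c; have r0 : 0 < r by rewrite !mulr_gt0.
  pose M := 8 * G c / d c ^+ 2.
  have M0 : 0 <= M by rewrite divr_ge0 ?sqr_ge0// mulr_ge0// ltW.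
  set S := [set w | _]; have SB w : S w -> box (phi a c) r w /\ P (toC w) <= M.
    move=> [wD wS]; set z := phi a (toC w) in wS.
    have zD : unit_disc z by exact: phi_disc.
    have [] := gk _ wS; rewrite ofCK -/c => g1 g2 d1 d2.
    have wz : toC w = phi a z by rewrite phiK.
    split.
      apply: in_box; rewrite wz -(ler_pXn2r (n := 2))// ?nnegrE ?modulus_ge0 ?(ltW r0)//.
      rewrite phi_sub// -/(d z) -/(d c).
      have zc : modulus (z - c) <= 2 * h.
        by have := sq_dist wS (corner_sq k); rewrite ofCK => /ltW.
      have zc2 : modulus (z - c) ^+ 2 <= (2 * h) ^+ 2.
        by rewrite lerXn2r ?nnegrE ?modulus_ge0// mulr_ge0// ltW.
      apply: (@le_trans _ _ ((2 * h) ^+ 2 * (2 * d c * d c))).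
        apply: ler_pM => //; rewrite ?sqr_ge0//; first by rewrite mulr_ge0 ?modulus_ge0.
        by rewrite ler_wpM2r// ltW.
      rewrite /r; have : 0 <= h ^+ 2 * d c ^+ 2 by rewrite mulr_ge0 ?sqr_ge0.
      by rewrite !expr2; lra.
    rewrite /P /pullback -/z wz dphi_phi// -/(d z) /M.
    have dz := d0 z zD.
    have : (d z)^-1 <= 2 / d c.
      by rewrite ler_pdivlMr// mulrC ler_pdivrMr.
    move=> di; have : (d z)^-1 ^+ 2 <= (2 / d c) ^+ 2.
      by rewrite lerXn2r// nnegrE ?invr_ge0 ?divr_ge0// ltW.
    move=> di2; apply: (le_trans (ler_pM (ltW (G0 z zD)) (sqr_ge0 _) g1 di2)).
    by rewrite expr_div_n le_eqVlt; apply/orP; left; apply/eqP; field; rewrite gt_eqF.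
  have mS : measurable (S : set RR) by have := mT N k; rewrite /T ifT//; apply/asboolP.
  apply: (@le_trans _ _ (\int[mu2]_(w in @planeD R) (M * \1_(box (phi a c) r) w)%:E)%E).
    apply: ge0_le_integral.
    - exact: planeD_measurable.
    - by move=> w wD; rewrite lee_fin mulr_ge0//; exact: P0.
    - apply/measurable_EFinP; apply: measurable_funM; first exact: dcont_measurable.
      exact: measurable_indic.
    - apply/measurable_EFinP; apply: measurable_funM; first exact: measurable_cst.
      by apply: measurable_indic; exact: measurable_box.
    move=> w wD; rewrite lee_fin !indicE.
    have [/SB[wB PM]|nS] := pselect (S w).
      by rewrite [in leRHS]mem_set// mulr1 (le_trans _ PM)// ler_piMr ?P0// lern1 leq_b1.
    by rewrite [in leLHS]memNset// mulr0 mulr_ge0.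
  have indE (B : set RR) (m : R) : measurable B -> 0 <= m ->
      (\int[mu2]_(w in @planeD R) (m * \1_B w)%:E = m%:E * mu2 (B `&` @planeD R))%E.
    move=> mB m0; under eq_integral do rewrite EFinM.
    rewrite ge0_integralZl//=.
    - by rewrite integral_indic//; exact: planeD_measurable.
    - exact: planeD_measurable.
    - by apply/measurable_EFinP; exact: measurable_indic.
  rewrite indE//; last exact: measurable_box.
  apply: (@le_trans _ _ ((L * G c * h ^+ 2)%:E)).
    apply: (@le_trans _ _ (M%:E * mu2 (box (phi a c) r))%E).
      rewrite lee_wpmul2l ?lee_fin//; apply: le_measure; rewrite ?inE.
      + by apply: measurableI; [exact: measurable_box|exact: planeD_measurable].
      + exact: measurable_box.
      + by move=> w [].
    rewrite box_area// -EFinM lee_fin /M /r LE le_eqVlt; apply/orP; left; apply/eqP.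
    by field; rewrite gt_eqF.
  rewrite EFinM -(@sq_area R N k.1 k.2) -[in leLHS](setIidl QD) -indE; last 2 first.
  - exact: measurable_sq.
  - by rewrite mulr_ge0 ?(ltW L0)// ltW.
  apply: ge0_le_integral.
  - exact: planeD_measurable.
  - by move=> w wD; rewrite lee_fin mulr_ge0// mulr_ge0 ?(ltW L0)// ltW.
  - apply/measurable_EFinP; apply: measurable_funM; first exact: measurable_cst.
    by apply: measurable_indic; exact: measurable_sq.
  - exact: mQ.
  move=> w wD; rewrite lee_fin mulrA !indicE.
  have [/gk[_ + _ _]|nS] := pselect (@sq R N k.1 k.2 w); last by rewrite memNset// !mulr0.
  rewrite -/c => g2; rewrite ler_wpM2r//.
  by have := ler_wpM2l (ltW L0) g2; rewrite KE; lra.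
apply: (le_trans (lee_sum _ (fun k _ => perk k))).
rewrite -ge0_integral_sum//; last exact: planeD_measurable.
rewrite -dintZ ?(ltW K0)//; last by move=> z zD; rewrite ltW// G0.
have cG' : dcont (fun z => K * G z).
  by move=> z zD; apply: rcontM; [exact: rcont_cst|exact: cG].
apply: ge0_le_integral.
- exact: planeD_measurable.
- by move=> w wD; apply: sume_ge0 => k _; exact: Q0.
- by apply: emeasurable_sum => k; exact: mQ.
- exact: (dcont_emeasurable cG').
move=> w wD; rewrite sumEFin lee_fin -mulr_sumr -mulr_sumr ler_wpM2l ?(ltW K0)//.
by rewrite ler_piMr ?sum_indic_sq// ltW// G0.
Qed.

(** Comparing values of G up to a factor required positivity; here the previous bound is applied to
    G + r. The disc has area at most 4, so the constant r contributes at most 4 K r = e. *)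
Lemma pullback_le (a : R[i]) G : unit_disc a -> dcont G ->
  (forall z, unit_disc z -> 0 <= G z) ->
  (dint (pullback a G) <= 1024%:E * dint G)%E.
Proof.
move=> aD cG G0; apply/lee_addgt0Pr => e e0.
have H r : 0 < r -> (dint (pullback a (fun z => (G z + r)%R)) <= 1024%:E * dint (fun z => (G z + r)%R))%E.
  move=> r0; apply: pullback_pos => //.
    by move=> z zD; apply: rcontD; [exact: cG|exact: rcont_cst].
  by move=> z zD; rewrite ltr_wpDl// G0.
have K0 : 0 < 1024 :> R by rewrite ltr0n.
move: H K0; move: (1024 : R) => K H K0.
pose r := e / 4 / K; have r0 : 0 < r by rewrite !divr_gt0.
have cr : dcont (fun z => G z + r).
  by move=> z zD; apply: rcontD; [exact: cG|exact: rcont_cst].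
apply: (@le_trans _ _ (dint (pullback a (fun z => G z + r)))).
  apply: dint_le; [exact: dcont_pullback|exact: dcont_pullback|].
  move=> z zD; have pD := phi_disc aD zD; rewrite /pullback mulr_ge0 ?sqr_ge0 ?G0//=.
  by rewrite ler_wpM2r ?sqr_ge0// lerDl ltW.
apply: (le_trans (H r r0)).
rewrite dintD//; [|by move=> z zD; exact: rcont_cst|by move=> *; exact: ltW].
rewrite ge0_muleDr; last 2 first.
- exact: dint_ge0.
- by apply: dint_ge0 => *; exact: ltW.
apply: leeD2l; apply: (@le_trans _ _ (K%:E * (4 * r)%:E)%E).
  by rewrite lee_wpmul2l ?lee_fin ?(ltW K0)// dint_cst_le// ltW.
by rewrite -EFinM lee_fin /r le_eqVlt; apply/orP; left; apply/eqP; field; rewrite gt_eqF.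
Qed.

Lemma pullback_bound : exists2 K : R, 0 < K & forall (a : R[i]) G,
  unit_disc a -> dcont G -> (forall z, unit_disc z -> 0 <= G z) ->
  (dint (pullback a G) <= K%:E * dint G)%E.
Proof. by exists 1024; [rewrite ltr0n|exact: pullback_le]. Qed.

End ChangeOfVariables.

(** * Sub-mean value inequality by averaging over squares *)

Section SubMean.
Variable R : realType.
Implicit Types (f h F : R[i] -> R[i]) (z : R[i]) (w v : R * R) (x y t s : R).
Local Notation mu := (@lebesgue_measure R).
Local Notation mu2 := (@lebesgue_measure R \x @lebesgue_measure R)%E.
Local Notation RR := (measurableTypeR R * measurableTypeR R)%type.

Lemma integral01_le_int (G : R -> R[i]) (k : R -> R) : path_cont G ->
  (forall t, 0 <= t <= 1 -> {for t, continuous k}) ->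
  (forall t, 0 <= t <= 1 -> modulus (G t) <= k t) ->
  modulus (integral01 G) <= 2 * \int[mu]_(t in `[0%R, 1%R]) k t.
Proof.
move=> cG ck Gk; apply: (le_trans (modulus_le_ReIm _)); rewrite mulr_natl mulr2n.
have ki := cont01_integrable ck.
apply: lerD => /=.
  have Ri := path_Re_integrable cG.
  apply: le_trans (le_normr_Rintegral _ Ri) _ => //; apply: le_Rintegral => //.
    exact: (integrable_norm Ri).
  move=> t; rewrite /= in_itv /= => t01.
  exact: le_trans (Re_le_modulus _) (Gk t t01).
have Ii := path_Im_integrable cG.
apply: le_trans (le_normr_Rintegral _ Ii) _ => //; apply: le_Rintegral => //.
  exact: (integrable_norm Ii).
move=> t; rewrite /= in_itv /= => t01.
exact: le_trans (Im_le_modulus _) (Gk t t01).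
Qed.

Lemma side0_disc s k t : 0 < s -> s <= 1/4 -> 0 <= t <= 1 -> unit_disc (side 0 s k t).
Proof.
move=> s0 s4 t01; have := side_near 0 s0 k t01; rewrite subr0 /unit_disc /=; lra.
Qed.

Lemma pcont_modulus_path f (G : R -> R[i]) t : ccont f (G t) -> pcont G t ->
  {for t, continuous (fun t => modulus (f (G t)))}.
Proof.
move=> cf cG; have cfG : pcont (f \o G) t by exact: gcont_comp.
apply/real_contP => e /cfG[d d0 Hd]; exists d => // y; rewrite -modulus_real => /Hd.
apply: le_lt_trans; rewrite ler_norml; apply/andP; split; last exact: ler_modulusB.
by rewrite lerNl opprB modulusB; exact: ler_modulusB.
Qed.

(** Cauchy's formula at the centre. Each side has length 2 s, the kernel is at most 1/s, and
    splitting into real and imaginary parts costs 2; the resulting 4 is cancelled by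
    [winding_far]. *)
Lemma center_le_sides F s : analytic F -> 0 < s -> s <= 1/4 ->
  modulus (F 0) <= \sum_(k < 4) \int[mu]_(t in `[0%R, 1%R]) modulus (F (side 0 s k t)).
Proof.
move=> Fa s0 s4.
have sD k t : 0 <= t <= 1 -> unit_disc (side 0 s k t) by exact: side0_disc.
have z0 : modulus (0 - 0 : R[i]) < s by rewrite subrr modulus0.
have := cauchy_formula s0 sD Fa (fun z => @cderiv_ccont R F z Fa) (@disc0 R) z0.
have w4 := winding_far 0 s0.
have w0 : 0 < modulus (winding 0 s : R[i]) by exact: lt_le_trans w4.
have cF : sq_cont 0 s F by move=> k t t01; apply: analytic_ccont => //; exact: sD.
have cker1 := cker_cont s0 1 z0 cF.
have side_le k : modulus (seg (cker 1 F 0) (pt 0 s k) (pt 0 s k.+1)) <=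
    4 * \int[mu]_(t in `[0%R, 1%R]) modulus (F (side 0 s k t)).
  rewrite /seg modulusM.
  have -> : modulus (pt 0 s k.+1 - pt 0 s k) = s * 2.
    rewrite sideB !modulusM modulusX modulus_i expr1n modulus_nat.
    by rewrite !mulr1 modulus_real gtr0_norm.
  have ck t : 0 <= t <= 1 -> {for t, continuous (fun t => s^-1 * modulus (F (side 0 s k t)))}.
    move=> t01; apply: continuousM; first exact: cst_continuous.
    apply: pcont_modulus_path; last exact: pcont_affine.
    by apply: analytic_ccont => //; exact: sD.
  have H := @integral01_le_int (fun t => cker 1 F 0 (side 0 s k t)) _
    (seg_path_cont (cker1 k)) ck.
  have : modulus (integral01 (fun t => cker 1 F 0 (side 0 s k t))) <=
      2 * \int[mu]_(t in `[0%R, 1%R]) (s^-1 * modulus (F (side 0 s k t))).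
    apply: H => t t01; rewrite /cker expr1 modulusM modulusV subr0 mulrC.
    have := side_far 0 s0 k t; rewrite subr0 => far.
    by rewrite ler_wpM2r ?modulus_ge0// lef_pV2 ?posrE// (lt_le_trans s0).
  rewrite RintegralZl//; last first.
    apply: cont01_integrable => t t01.
    apply: pcont_modulus_path; last exact: pcont_affine.
    by apply: analytic_ccont => //; exact: sD.
  set I1 := modulus _; set I2 := Rintegral _ _ _ => I12.
  have : s * 2 * I1 <= s * 2 * (2 * (s^-1 * I2)) by rewrite ler_wpM2l// mulr_ge0// ltW.
  move=> /le_trans; apply; rewrite le_eqVlt; apply/orP; left; apply/eqP.
  by field; rewrite gt_eqF.
move=> ->; rewrite modulusM modulusV mulrC ler_pdivrMr//.
have : modulus (cint 0 s 1 F 0) <=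
    4 * \sum_(k < 4) \int[mu]_(t in `[0%R, 1%R]) modulus (F (side 0 s k t)).
  rewrite /cint /sq_int mulr_sumr.
  elim/big_ind2: _ => //; first by rewrite modulus0.
  by move=> x1 x2 y1 y2 h1 h2; apply: (le_trans (modulusD _ _)); exact: lerD.
move=> /le_trans; apply; rewrite mulrC ler_wpM2l//.
apply: sumr_ge0 => k _; apply: Rintegral_ge0 => t _; exact: modulus_ge0.
Qed.

Definition quarter : set R := [set` `[(- (1/4))%R, (1/4)%R]].

(** Substitution y = al + be t, which runs over [-s, s] in one of the two directions; the Jacobian 1
    / (2 s) is at most 4 because s >= 1/8. *)
Lemma affine_int (k : R -> R) al be s : 1/8 <= s -> s <= 1/4 ->
  (al = - s /\ be = 2 * s) \/ (al = s /\ be = - (2 * s)) ->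
  (forall y, `|y| <= 1/4 -> {for y, continuous k}) ->
  (forall y, `|y| <= 1/4 -> 0 <= k y) ->
  ((\int[mu]_(t in `[0%R, 1%R]) k (al + be * t))%:E <=
    4%:E * \int[mu]_(y in quarter) (k y)%:E)%E.
Proof.
move=> s8 s4 albe ck k0; have s0 : 0 < s by lra.
(* [cl] retracts the line onto [-1/4, 1/4], so that [ps] is a continuous extension of [k] and has a
   two-sided antiderivative at the ends. *)
pose cl y := - (1/4) + clamp ((y + 1/4) * 2) / 2.
have clb y : `|cl y| <= 1/4.
  have /andP[c0 c1] := clamp01 ((y + 1/4) * 2); rewrite ler_norml /cl.
  by apply/andP; split; lra.
have cl_id y : `|y| <= 1/4 -> cl y = y.
  rewrite ler_norml => /andP[h1 h2]; rewrite /cl clamp_id; first by field.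
  by apply/andP; split; lra.
have clc y : {for y, continuous cl}.
  apply/real_contP => e e0; exists e => // v; apply: le_lt_trans.
  have := clamp_lip ((v + 1/4) * 2) ((y + 1/4) * 2).
  have -> : (v + 1/4) * 2 - (y + 1/4) * 2 = 2 * (v - y) by ring.
  rewrite normrM (ger0_norm (ler0n _ 2)) => h.
  have -> : cl v - cl y = (clamp ((v + 1/4) * 2) - clamp ((y + 1/4) * 2)) / 2.
    by rewrite /cl; field.
  by rewrite normrM [X in _ * X]ger0_norm ?invr_ge0// ler_pdivrMr// (mulrC `|v - y|).
pose ps := k \o cl.
have psc y : {for y, continuous ps} by apply: continuous_comp; [exact: clc|exact/ck/clb].
pose G x := \int[mu]_(t in `[-1, x]) ps t.
have dG x : -1 < x -> x < 1 -> is_derive x 1 G (ps x).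
  move=> x1 x2; have [||||dG E] := @continuous_FTC1_closed _ ps (-1) x 1.
  - exact: x2.
  - apply: continuous_compact_integrable; first exact: segment_compact.
    by apply: continuous_subspaceT => y; exact: psc.
  - exact: x1.
  - exact: psc.
  by split; [exact: dG|rewrite -derive1E; exact: E].
have inr t : 0 <= t <= 1 -> `|al + be * t| <= s.
  move=> /andP[t0 t1]; have st : 0 <= s * t <= s.
    by rewrite mulr_ge0 ?(ltW s0)//= ler_piMr// ltW.
  by move: st => /andP[? ?]; rewrite ler_norml; case: albe => -[-> ->]; apply/andP; split; lra.
have E1 : be * \int[mu]_(t in `[0%R, 1%R]) k (al + be * t) = G (al + be) - G al.
  have cpa t : {for t, continuous (fun t => ps (al + be * t))}.
    apply: (@continuous_comp _ _ _ (fun t => al + be * t) ps); last exact: psc.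
    by apply: continuousD; [exact: cst_continuous|apply: continuousM; [exact: cst_continuous|exact: cvg_id]].
  have -> : \int[mu]_(t in `[0%R, 1%R]) k (al + be * t) =
      \int[mu]_(t in `[0%R, 1%R]) ps (al + be * t).
    apply: eq_Rintegral => t; rewrite inE /= in_itv /= => /inr h.
    by rewrite /ps /= cl_id// (le_trans h).
  rewrite -RintegralZl//; last by apply: cont01_integrable => t _; exact: cpa.
  have cb t : 0 <= t <= 1 -> {for t, continuous (fun t => be * ps (al + be * t))}.
    by move=> _; apply: continuousM; [exact: cst_continuous|exact: cpa].
  have db t : 0 <= t <= 1 ->
      is_derive t 1 (fun t => G (al + be * t)) (be * ps (al + be * t)).
    move=> /inr h; have da : is_derive t 1 (fun t => al + be * t) be.
      apply/real_diffP => e e0; exists 1 => // w _.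
      by rewrite (_ : _ - _ - _ = 0) ?normr0 ?mulr_ge0// 1?ltW//; ring.
    have dg : is_derive (al + be * t) 1 G (ps (al + be * t)).
      by move: h; rewrite ler_norml => /andP[? ?]; apply: dG; lra.
    have := @is_derive1_comp _ G (fun t => al + be * t) t _ _ dg da.
    by rewrite mulrC.
  by have := real_FTC01 cb db; rewrite mulr1 mulr0 addr0.
have E2 : (\int[mu]_(y in `[(- s)%R, s]) (ps y)%:E = (G s)%:E - (G (- s))%:E)%E.
  apply: continuous_FTC2; first lra.
  - by apply: continuous_subspaceT => y; exact: psc.
  - split.
    + move=> y; rewrite in_itv /= => /andP[? ?].
      by have [] := dG y ltac:(lra) ltac:(lra).
    + by apply: cvg_at_right_filter; exact: is_derive_cont (dG (- s) ltac:(lra) ltac:(lra)).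
    + by apply: cvg_at_left_filter; exact: is_derive_cont (dG s ltac:(lra) ltac:(lra)).
  move=> y; rewrite in_itv /= => /andP[? ?]; rewrite derive1E.
  by have [_ ->] := dG y ltac:(lra) ltac:(lra).
have E3 : (2 * s) * \int[mu]_(t in `[0%R, 1%R]) k (al + be * t) = G s - G (- s).
  case: albe E1 => -[-> ->]; first by move=> ->; congr (G _ - G _); ring.
  by rewrite mulNr => /(congr1 -%R); rewrite opprK opprB => ->; congr (G _ - G _); ring.
have E4 : ((2 * s * \int[mu]_(t in `[0%R, 1%R]) k (al + be * t))%:E <=
    \int[mu]_(y in quarter) (k y)%:E)%E.
  rewrite E3 EFinB -E2.
  have -> : (\int[mu]_(y in quarter) (k y)%:E = \int[mu]_(y in quarter) (ps y)%:E)%E.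
    apply: eq_integral => y; rewrite inE /quarter /= in_itv /= => h.
    by rewrite /ps /= cl_id// ler_norml.
  apply: ge0_subset_integral => //; try exact: measurable_itv.
  - apply/measurable_EFinP; apply: measurable_funTS.
    by apply: continuous_measurable_fun => y; exact: psc.
  - by move=> y _; rewrite lee_fin k0.
  - by move=> y; rewrite /quarter /= !in_itv /= => /andP[? ?]; apply/andP; split; lra.
apply: le_trans (_ : (4%:E * (2 * s * \int[mu]_(t in `[0%R, 1%R]) k (al + be * t))%:E <= _)%E); last first.
  by rewrite lee_wpmul2l.
rewrite -EFinM lee_fin.
have I0 : 0 <= \int[mu]_(t in `[0%R, 1%R]) k (al + be * t).
  apply: Rintegral_ge0 => t; rewrite /= in_itv /= => /inr h; apply: k0.
  exact: le_trans h s4.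
move: (\int[mu]_(t in `[0%R, 1%R]) k (al + be * t)) I0 s8 => X; clear => X0 s8; nra.
Qed.


Definition qbox : set RR := quarter `*` quarter.

Lemma qbox_modulus w : qbox w -> modulus (toC w) ^+ 2 <= 1/8.
Proof.
move=> [] /=; rewrite /quarter /= !in_itv /= => /andP[? ?] /andP[? ?].
by rewrite sqr_modulus /=; nra.
Qed.

Lemma qbox_disc w : qbox w -> planeD w.
Proof.
move=> /qbox_modulus H; rewrite /planeD /unit_disc /=.
by rewrite -(@expr_lt1 _ 2)// ?modulus_ge0//; apply: le_lt_trans H _; lra.
Qed.

Lemma measurable_qbox : measurable qbox.
Proof. by apply: measurableX; exact: measurable_itv. Qed.

Lemma cdiff_neg z : cdiff (fun z => - z) z (-1).
Proof.
have H0 : cdiff (fun=> -1 : R[i]) z 0 := gdiff_cst _ _ _.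
have := gdiffM H0 (@cdiff_id R z); rewrite mul0r add0r mulr1 /cdiff.
by congr (gdiff _ _ _ _); apply: funext => y; rewrite mulN1r.
Qed.

(** The left and lower sides of a square centred at 0 are the negatives of the right and upper ones,
    so they are treated as right and upper sides for the reflected function. *)
Definition negc F : R[i] -> R[i] := fun z => F (- z).

Lemma analytic_neg F : analytic F -> analytic (negc F).
Proof.
move=> Fa z zD; have nD : unit_disc (- z) by rewrite /unit_disc /= modulusN.
exact: cdiff_derivable (@gdiff_comp _ _ _ F (fun z => - z) z _ _ (analytic_cdiff Fa nD) (cdiff_neg z)).
Qed.

(** Extension by 0 off the box lets Tonelli's theorem be used on the whole plane. *)
Definition qabs F (w : RR) : \bar R := (((fun w => (modulus (F (toC w)))%:E) \_ qbox) w)%E.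

Lemma qabs_ge0 F w : (0 <= qabs F w)%E.
Proof. by rewrite /qabs patchE; case: ifP => // _; rewrite lee_fin modulus_ge0. Qed.

Lemma measurable_qabs F : analytic F -> measurable_fun setT (qabs F).
Proof.
move=> Fa; apply/(measurable_restrictT _ measurable_qbox).
apply: measurable_funS (@planeD_measurable R) _ _; first exact: qbox_disc.
apply: (@dcont_emeasurable R (fun z => modulus (F z))) => z zD.
by apply: rcont_modulus; exact: analytic_ccont.
Qed.

(** [b] selects the vertical line of abscissa s or the horizontal one of ordinate s. Passing from
    the side to the full line leaves a function of s alone, which can be integrated in s. *)
Lemma half_line_le F s al be (b : bool) : analytic F -> 1/8 <= s -> s <= 1/4 ->
  (al = - s /\ be = 2 * s) \/ (al = s /\ be = - (2 * s)) ->
  ((\int[mu]_(t in `[0%R, 1%R])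
      modulus (F (if b then s +i* (al + be * t) else (al + be * t) +i* s)))%:E <=
   4%:E * \int[mu]_y (qabs F (if b then (s, y) else (y, s))))%E.
Proof.
move=> Fa s8 s4 albe.
have sq : quarter s by rewrite /quarter /= in_itv /=; apply/andP; split; lra.
pose k y := modulus (F (if b then s +i* y else y +i* s)).
have kD y : `|y| <= 1/4 -> qbox (if b then (s, y) else (y, s)).
  by move=> h; have yq : quarter y by [rewrite /quarter /= in_itv /= -ler_norml]; clear -yq sq; case: b.
have kc y : `|y| <= 1/4 -> {for y, continuous k}.
  move=> /kD /qbox_disc yD.
  apply: (@pcont_modulus_path F (fun y => if b then s +i* y else y +i* s)).
    by apply: analytic_ccont => //; clear -yD; case: b yD.
  clear; move=> e e0; exists e => // y'; rewrite modulus_real; apply: le_lt_trans.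
  by case: b; apply: (le_trans (modulus_le_ReIm _)) => /=;
    rewrite subrr normr0 ?add0r ?addr0.
have := @affine_int k al be s s8 s4 albe kc (fun _ _ => modulus_ge0 _).
move=> /le_trans; apply; rewrite lee_wpmul2l//.
rewrite integral_mkcond; apply: ge0_le_integral => //.
- move=> y _; rewrite patchE; case: ifP => // _; rewrite lee_fin; exact: modulus_ge0.
- apply/(measurable_restrictT _ (measurable_itv _)); apply/measurable_EFinP.
  apply: subspace_continuous_measurable_fun; first exact: measurable_itv.
  apply: continuous_in_subspaceT => y; rewrite inE /= in_itv /= -ler_norml; exact: kc.
- have mQ := measurable_qabs Fa.
  clear -mQ; case: b.
    apply: (measurableT_comp mQ); exact: measurable_fun_pair.
  apply: (measurableT_comp mQ); exact: measurable_fun_pair.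
move=> y _; rewrite patchE; case: ifPn => [|_]; last exact: qabs_ge0.
rewrite inE /quarter /= in_itv /= -ler_norml => h.
rewrite /qabs patchE mem_set; last exact: kD.
by rewrite /k; clear; case: b.
Qed.

Lemma sum4 (u : nat -> R) : \sum_(k < 4) u k = u 0%N + u 1%N + u 2%N + u 3%N.
Proof. by rewrite !big_ord_recr big_ord0 /= add0r. Qed.

(** The inequality for one square is integrated over the half-sides s in [1/8, 1/4], and Tonelli
    turns line integrals into plane integrals. One factor 8 is the inverse length of that interval;
    the other is the 4 of [affine_int], doubled because vertical and horizontal sides each yield the
    same plane integral. *)
Lemma submean_qbox F : analytic F ->
  ((modulus (F 0))%:E <= 64%:E * (\int[mu2]_w qabs F w + \int[mu2]_w qabs (negc F) w))%E.
Proof.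
move=> Fa; have Fn := analytic_neg Fa.
pose V H s := (\int[mu]_y qabs H (s, y))%E.
pose W H s := (\int[mu]_x qabs H (x, s))%E.
pose Q s := (4%:E * (V F s + V (negc F) s + (W F s + W (negc F) s)))%E.
have V0 H s : (0 <= V H s)%E by apply: integral_ge0 => y _; exact: qabs_ge0.
have W0 H s : (0 <= W H s)%E by apply: integral_ge0 => y _; exact: qabs_ge0.
have mV H : analytic H -> measurable_fun setT (V H).
  by move=> Ha; apply: (@measurable_fun_fubini_tonelli_F _ _ _ _ _ mu (qabs H)); [exact: measurable_qabs|exact: qabs_ge0].
have mW H : analytic H -> measurable_fun setT (W H).
  by move=> Ha; apply: (@measurable_fun_fubini_tonelli_G _ _ _ _ _ mu (qabs H)); [exact: measurable_qabs|exact: qabs_ge0].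
have iV H : analytic H -> (\int[mu]_s V H s = \int[mu2]_w qabs H w)%E.
  by move=> Ha; rewrite fubini_tonelli1//; [exact: measurable_qabs|exact: qabs_ge0].
have iW H : analytic H -> (\int[mu]_s W H s = \int[mu2]_w qabs H w)%E.
  by move=> Ha; rewrite fubini_tonelli2//; [exact: measurable_qabs|exact: qabs_ge0].
have key s : 1/8 <= s -> s <= 1/4 -> ((modulus (F 0))%:E <= Q s)%E.
  move=> s8 s4; have s0 : 0 < s by lra.
  have := center_le_sides Fa s0 s4; rewrite -lee_fin => /le_trans; apply.
  have aff1 : - s = - s /\ 2 * s = 2 * s \/ - s = s /\ 2 * s = - (2 * s) by left.
  have aff2 : s = - s /\ - (2 * s) = 2 * s \/ s = s /\ - (2 * s) = - (2 * s) by right.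
  have E0 t : side 0 s 0 t = s +i* (- s + 2 * s * t).
    by rewrite -[LHS]subr0 sideE expr0; apply: complexP => /=; ring.
  have E1 t : side 0 s 1 t = (s + - (2 * s) * t) +i* s.
    by rewrite -[LHS]subr0 sideE expr1; apply: complexP => /=; ring.
  have E2 t : side 0 s 2 t = - (s +i* (- s + 2 * s * t)).
    by rewrite -[LHS]subr0 sideE sqr_i; apply: complexP => /=; ring.
  have E3 t : side 0 s 3 t = - ((s + - (2 * s) * t) +i* s).
    by rewrite -[LHS]subr0 sideE exprS sqr_i; apply: complexP => /=; ring.
  have H0 := half_line_le true Fa s8 s4 aff1.
  have H1 := half_line_le false Fa s8 s4 aff2.
  have H2 := half_line_le true Fn s8 s4 aff1.
  have H3 := half_line_le false Fn s8 s4 aff2.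
  rewrite (sum4 (fun k => \int[mu]_(t in `[0%R, 1%R]) modulus (F (side 0 s k t)))).
  under [X in X + _ + _ + _]eq_Rintegral do rewrite E0.
  under [X in _ + X + _ + _]eq_Rintegral do rewrite E1.
  under [X in _ + _ + X + _]eq_Rintegral do rewrite E2.
  under [X in _ + _ + _ + X]eq_Rintegral do rewrite E3.
  move: H0 H1 H2 H3; rewrite -/(V F s) -/(W F s) -/(V (negc F) s) -/(W (negc F) s).
  rewrite /Q; move: (V F s) (W F s) (V (negc F) s) (W (negc F) s)
    (V0 F s) (W0 F s) (V0 (negc F) s) (W0 (negc F) s) => x1 x2 x3 x4 x10 x20 x30 x40.
  set a0 := Rintegral _ _ _; set a1 := Rintegral _ _ _; set a2 := Rintegral _ _ _.
  set a3 := Rintegral _ _ _ => H0 H1 H2 H3.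
  rewrite -/a0 -/a1 -/a2 -/a3 (_ : a0 + a1 + a2 + a3 = (a0 + a2) + (a1 + a3)); last by ring.
  rewrite !ge0_muleDr ?adde_ge0// !EFinD.
  by apply: leeD; exact: leeD.
pose S1 s := (V F s + V (negc F) s)%E; pose S2 s := (W F s + W (negc F) s)%E.
have mS1 : measurable_fun setT S1.
  by apply: emeasurable_funD; [exact: (mV F Fa)|exact: (mV _ Fn)].
have mS2 : measurable_fun setT S2.
  by apply: emeasurable_funD; [exact: (mW F Fa)|exact: (mW _ Fn)].
have S10 s : (0 <= S1 s)%E by apply: adde_ge0; exact: V0.
have S20 s : (0 <= S2 s)%E by apply: adde_ge0; exact: W0.
have mS : measurable_fun setT (fun s => S1 s + S2 s)%E by exact: emeasurable_funD.
have mQ : measurable_fun setT Q by exact: measurable_funeM mS.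
have Q0 s : (0 <= Q s)%E.
  by apply: mule_ge0; [rewrite lee_fin|apply: adde_ge0; [exact: S10|exact: S20]].
have : ((1/8 * modulus (F 0))%:E <= \int[mu]_s Q s)%E.
  pose A : set R := [set` `[(1/8)%R, (1/4)%R]].
  have mA : measurable A by exact: measurable_itv.
  have A1 : ((1/8 * modulus (F 0))%:E <= \int[mu]_(s in A) (modulus (F 0))%:E)%E.
    rewrite integral_cst//= lebesgue_measure_itv /= lte_fin ifT; last lra.
    by rewrite -EFinB -EFinM lee_fin le_eqVlt; apply/orP; left; apply/eqP; field.
  have A2 : (\int[mu]_(s in A) (modulus (F 0))%:E <= \int[mu]_(s in A) Q s)%E.
    apply: ge0_le_integral => //.
    - by move=> s _; rewrite lee_fin modulus_ge0.
    - exact: measurable_funTS.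
    by move=> s; rewrite /A /= in_itv /= => /andP[? ?]; exact: key.
  have A3 : (\int[mu]_(s in A) Q s <= \int[mu]_s Q s)%E.
    by apply: ge0_subset_integral.
  exact: le_trans A1 (le_trans A2 A3).
have -> : (\int[mu]_s Q s = 8%:E * (\int[mu2]_w qabs F w + \int[mu2]_w qabs (negc F) w))%E.
  transitivity (\int[mu]_s (4%:E * (S1 s + S2 s)))%E; first by [].
  rewrite ge0_integralZl//=; last by move=> s _; apply: adde_ge0; [exact: S10|exact: S20].
  rewrite (@ge0_integralD _ _ _ mu setT measurableT S1 S2)//=.
  rewrite (@ge0_integralD _ _ _ mu setT measurableT (V F) (V (negc F)))//=;
    [|exact: (mV F Fa)|exact: (mV _ Fn)].
  rewrite (@ge0_integralD _ _ _ mu setT measurableT (W F) (W (negc F)))//=;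
    [|exact: (mW F Fa)|exact: (mW _ Fn)].
  rewrite (iV F Fa) (iV _ Fn) (iW F Fa) (iW _ Fn).
  have X0 : (0 <= \int[mu2]_w qabs F w + \int[mu2]_w qabs (negc F) w)%E.
    by apply: adde_ge0; apply: integral_ge0 => w _; exact: qabs_ge0.
  move: X0; move: (_ + _)%E => X X0.
  have -> : (X + X = 2%:E * X)%E by rewrite -[2]/(1 + 1) EFinD ge0_muleDl ?lee_fin// mul1e.
  by rewrite muleA -EFinM; congr (_%:E * _)%E; ring.
have I0 : (0 <= \int[mu2]_w qabs F w + \int[mu2]_w qabs (negc F) w)%E.
  by rewrite adde_ge0// integral_ge0// => w _; exact: qabs_ge0.
move: I0; set X := (_ + _)%E => I0 H.
have -> : (modulus (F 0))%:E = (8%:E * (1/8 * modulus (F 0))%:E)%E.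
  by rewrite -EFinM; congr EFin; field.
apply: (@le_trans _ _ (8%:E * (8%:E * X))%E); first by rewrite lee_wpmul2l.
by rewrite muleA -EFinM (_ : 8 * 8 = 64)//; ring.
Qed.

End SubMean.

(** * Pointwise growth from bounds on the recentred Dirichlet integrals *)

Section Growth.
Variable R : realType.
Implicit Types (f h F : R[i] -> R[i]) (z a : R[i]) (w : R * R) (x y t s p : R).
Local Notation mu2 := (@lebesgue_measure R \x @lebesgue_measure R)%E.

Lemma qabs_le F (G : R[i] -> R) : analytic F -> dcont G ->
  (forall z, unit_disc z -> 0 <= G z) ->
  (forall w, qbox w -> modulus (F (toC w)) <= 2 * G (toC w)) ->
  (\int[mu2]_w qabs F w <= 2%:E * dint G)%E.
Proof.
move=> Fa cG G0 FG; rewrite -dintZ// /dint /qabs -integral_mkcond.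
apply: (@le_trans _ _ (\int[mu2]_(w in @qbox R) (2 * G (toC w))%:E)%E).
  apply: ge0_le_integral.
  - exact: measurable_qbox.
  - by move=> w _; rewrite lee_fin modulus_ge0.
  - apply: measurable_funS (@planeD_measurable R) _ _; first exact: qbox_disc.
    apply: (@dcont_emeasurable R (fun z => modulus (F z))) => z zD.
    by apply: rcont_modulus; exact: analytic_ccont.
  - apply: measurable_funS (@planeD_measurable R) _ _; first exact: qbox_disc.
    apply: (@dcont_emeasurable R (fun z => 2 * G z)) => z zD.
    by apply: rcontM; [exact: rcont_cst|exact: cG].
  by move=> w /FG; rewrite lee_fin.
apply: ge0_subset_integral.
- exact: measurable_qbox.
- exact: planeD_measurable.
- apply: (@dcont_emeasurable R (fun z => 2 * G z)) => z zD.
  by apply: rcontM; [exact: rcont_cst|exact: cG].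
- by move=> w wD; rewrite lee_fin mulr_ge0// G0.
exact: qbox_disc.
Qed.

Lemma mden0 z : mden 0 z = 1.
Proof. by apply: complexP; rewrite /mden; case: z => x y /=; ring. Qed.

Lemma phi0E z : phi 0 z = - z.
Proof. by rewrite /phi sub0r -/(mden 0 z) mden0 divr1. Qed.

Lemma modulus_dphi0 z : modulus (dphi 0 z) = 1.
Proof.
rewrite /dphi mden0 modulus0 expr0n /= rmorph0 subr0 expr1n divr1 modulusN.
exact: modulus1.
Qed.

Lemma submean : exists2 C : R, 0 < C & forall h p, analytic h -> 0 <= p -> p <= 1 ->
  ((modulus (h 0) ^+ 2)%:E <=
    C%:E * dint (fun z => (modulus (h z) ^+ 2 * (1 - modulus z ^+ 2) `^ p)%R))%E.
Proof.
have [K K0 HK] := pullback_bound R.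
exists (64 * (2 + 2 * K)); first by rewrite mulr_gt0// ltr_wpDl// mulr_gt0.
(* The inequality for the analytic function h^2 is the one wanted for |h|^2. On the box |z|^2 <=
   1/8, and p <= 1 makes the weight at least 1/2; hence the factors 2. *)
move=> h p ha p0 p1; pose F z := h z * h z.
have Fa : analytic F by exact: analyticM.
pose G z := modulus (h z) ^+ 2 * (1 - modulus z ^+ 2) `^ p.
have cG : dcont G.
  move=> z zD; apply: rcontM; last exact: dcont_weight.
  by apply: rcontX; apply: rcont_modulus; exact: analytic_ccont.
have G0 z : unit_disc z -> 0 <= G z by move=> _; rewrite mulr_ge0 ?sqr_ge0 ?powR_ge0.
have D0 : unit_disc (0 : R[i]) by exact: disc0.
have qG w : qbox w -> modulus (F (toC w)) <= 2 * G (toC w).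
  move=> wq; have u8 := qbox_modulus wq; have u0 := sqr_ge0 (modulus (toC w)).
  have : 1/2 <= (1 - modulus (toC w) ^+ 2) `^ p.
    apply: le_trans (ger1_powR (a := 1 - modulus (toC w) ^+ 2) _ p1); first lra.
    by apply/andP; split; lra.
  rewrite /F /G modulusM -expr2 => H; rewrite mulrCA ler_peMr ?sqr_ge0//; lra.
(* The reflection z -> -z is [phi 0], so the change of variables bounds the reflected term. *)
have qN w : qbox w -> modulus (negc F (toC w)) <= 2 * pullback 0 G (toC w).
  move=> wq; rewrite /pullback phi0E modulus_dphi0 expr1n mulr1 /negc.
  rewrite -[- toC w]/(toC (- w.1, - w.2)); apply: qG.
  case: wq; rewrite /quarter /= !in_itv /= => /andP[? ?] /andP[? ?].
  by split; rewrite /quarter /= in_itv /=; apply/andP; split; lra.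
have cP : dcont (pullback 0 G) by exact: dcont_pullback.
have P0 z : unit_disc z -> 0 <= pullback 0 G z.
  by move=> zD; rewrite mulr_ge0 ?sqr_ge0//; apply: G0; exact: phi_disc.
have -> : modulus (h 0) ^+ 2 = modulus (F 0) by rewrite /F modulusM expr2.
apply: le_trans (submean_qbox Fa) _.
have H1 := qabs_le Fa cG G0 qG.
have H2 := qabs_le (analytic_neg Fa) cP P0 qN.
have H3 := HK 0 G D0 cG G0.
rewrite EFinM -muleA lee_wpmul2l// EFinD ge0_muleDl ?lee_fin ?mulr_ge0 ?(ltW K0)//.
apply: leeD => //; apply: le_trans H2 _.
by rewrite EFinM -muleA lee_wpmul2l.
Qed.

(** At 0 the derivative of [recenter f a] has modulus (1 - |a|^2) |f'(a)|; dividing by the first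
    factor accounts for the -1 in the exponent. *)
Lemma deriv_bound : exists2 C : R, 0 < C & forall f p sg (M : R), analytic f ->
  0 <= p -> p <= 1 -> 0 <= M ->
  (forall a, unit_disc a -> (dint (dirichlet_density p (recenter f a)) <=
     (M ^+ 2 * (1 - modulus a ^+ 2) `^ (- (2 * sg)))%:E)%E) ->
  forall a, unit_disc a ->
    modulus (cderiv f a) <= C * M * (1 - modulus a ^+ 2) `^ (- sg - 1).
Proof.
have [C C0 HC] := submean; exists (Num.sqrt C); first by rewrite sqrtr_gt0.
move=> f p sg M fa p0 p1 M0 H a aD.
have ra := recenter_analytic fa aD.
have := HC _ p (cderiv_analytic ra) p0 p1.
have CH : (C%:E * dint (dirichlet_density p (recenter f a)) <=
    C%:E * (M ^+ 2 * (1 - modulus a ^+ 2) `^ (- (2 * sg)))%:E)%E.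
  by apply: lee_wpmul2l; [rewrite lee_fin ltW|exact: H].
move=> /le_trans/(_ CH); rewrite -EFinM lee_fin.
have u0 := one_minus_sqr aD.
rewrite cderiv_recenter//; last exact: disc0.
rewrite modulusM phi_at0 dphi_modulus//; last exact: disc0.
rewrite {1}/mden mulr0 subr0 modulus1 expr1n divr1.
move: (1 - modulus a ^+ 2) u0 => u u0 K.
rewrite -(ler_pXn2r (n := 2))// ?nnegrE ?modulus_ge0//; last first.
  by rewrite !mulr_ge0 ?powR_ge0// sqrtr_ge0.
have uN : u != 0 by rewrite gt_eqF.
rewrite exprMn (exprMn _ (Num.sqrt C)) sqr_sqrtr ?(ltW C0)//.
have -> : (u `^ (- sg - 1)) ^+ 2 = u `^ (- (2 * sg)) / u ^+ 2.
  rewrite -powR_mulrn ?powR_ge0// -powRrM -[u ^+ 2]powR_mulrn ?(ltW u0)//.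
  rewrite -powRB ?uN ?implybT//; congr (_ `^ _); ring.
rewrite mulrA ler_pdivlMr ?exprn_gt0// mulrC -exprMn.
by rewrite mulrA in K.
Qed.

Lemma powRN_le (x y s : R) : 0 < x -> x <= y -> 0 <= s -> y `^ (- s) <= x `^ (- s).
Proof.
move=> x0 xy s0; rewrite !powRN lef_pV2 ?posrE ?powR_gt0//; last exact: lt_le_trans xy.
by apply: ge0_ler_powR; rewrite ?nnegrE ?(ltW x0)// ltW// (lt_le_trans x0).
Qed.

Lemma powRX (x c : R) n : 0 <= x -> (x ^+ n) `^ c = (x `^ c) ^+ n.
Proof.
move=> x0; rewrite -(powR_mulrn n x0) -(powR_mulrn n (powR_ge0 x c)).
by rewrite -(powRrM x n%:R) -(powRrM x c) mulrC.
Qed.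

(** With De = f z - f 0, the real function t -> Re(conj(De) f(t z)) increases by exactly |De|^2 over
    [0, 1], so a real comparison along the radius suffices. The factor 2^sg passes from 1 - r to 1 -
    r^2. *)
Lemma integrate_growth f sg (B : R) : analytic f -> 0 < sg -> 0 <= B ->
  (forall a, unit_disc a -> modulus (cderiv f a) <= B * (1 - modulus a ^+ 2) `^ (- sg - 1)) ->
  forall z, unit_disc z ->
    modulus (f z) <= modulus (f 0) + B / sg * 2 `^ sg * (1 - modulus z ^+ 2) `^ (- sg).
Proof.
move=> fa sg0 B0 H z zD; pose De := f z - f 0; pose r := modulus z.
have r0 : 0 <= r by exact: modulus_ge0.
have r1 : r < 1 by exact: zD.
suff K : modulus De <= B / sg * (1 - r) `^ (- sg).
  have -> : f z = De + f 0 by rewrite subrK.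
  apply: (le_trans (modulusD _ _)); rewrite addrC lerD2l (le_trans K)//.
  rewrite -[leRHS]mulrA ler_wpM2l ?divr_ge0 ?(ltW sg0)//.
  have -> : 2 `^ sg = 2^-1 `^ (- sg) :> R.
    by rewrite powRN -[2^-1]powR_inv1// -powRrM mulN1r powRN invrK.
  rewrite -powRM ?subr_ge0 ?expr_le1 ?(ltW r1)//.
  by apply: powRN_le; rewrite ?(ltW sg0)// -/r expr2; nra.
have [->|DeN] := eqVneq De 0.
  by rewrite modulus0 mulr_ge0 ?powR_ge0// divr_ge0// ltW.
have De0 : 0 < modulus De by rewrite modulus_gt0.
pose fz t := f (0 + t%:C * z).
have tD t : 0 <= t <= 1 -> unit_disc (0 + t%:C * z).
  by move=> t01; rewrite -[X in _ * X]subr0; apply: disc_seg => //; exact: disc0.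
have dfz t : 0 <= t <= 1 -> pdiff (fun t => De^* * fz t) t (De^* * (z * cderiv f (0 + t%:C * z))).
  move=> t01; have H0 : pdiff (fun=> De^* : R[i]) t 0 := gdiff_cst _ _ _.
  have H1 := @gdiff_comp _ _ _ f (fun t => 0 + t%:C * z) t _ _
    (analytic_cdiff fa (tD t t01)) (pdiff_affine 0 z t).
  by have := gdiffM H0 H1; rewrite mul0r add0r.
(* A primitive of the bound on the derivative minus the projection of f(t z) on De; the hypothesis
   says that it is nondecreasing. *)
pose psi t := B / sg * modulus De * (1 - r * t) `^ (- sg) - complex.Re (De^* * fz t).
pose dpsi t := B * modulus De * r * (1 - r * t) `^ (- sg - 1)
   - complex.Re (De^* * (z * cderiv f (0 + t%:C * z))).
have rt t : 0 <= t <= 1 -> 0 < 1 - r * t by move=> /andP[? ?]; nra.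
have dpsiP t : 0 <= t <= 1 -> is_derive t 1 psi (dpsi t).
  move=> t01; have /pdiff_is_derive[dr _] := dfz t t01.
  have da : is_derive t 1 (fun t => 1 - r * t) (- r).
    apply/real_diffP => e e0; exists 1 => // w _.
    by rewrite (_ : _ - _ - _ = 0) ?normr0 ?mulr_ge0// 1?ltW//; ring.
  have dp := @is_derive1_comp _ (fun x => x `^ (- sg)) (fun t => 1 - r * t) t _ _
    (is_derive1_powR (- sg) (rt t t01)) da.
  have dk := @is_deriveZ _ _ _ _ (B / sg * modulus De) t 1 _ dp.
  have := is_deriveB dk dr; congr is_derive.
  by rewrite /dpsi /GRing.scale /=; field; rewrite gt_eqF.
have dpsi0 t : 0 <= t <= 1 -> 0 <= dpsi t.
  move=> t01; rewrite subr_ge0; apply: (le_trans (ler_norm _)).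
  apply: (le_trans (Re_le_modulus _)); rewrite !modulusM modulusJ -/r.
  have Ha := H _ (tD t t01); have mt : modulus (0 + t%:C * z) = r * t.
    by rewrite add0r modulusM modulus_real mulrC ger0_norm//; case/andP: t01.
  rewrite mt in Ha; move: t01 => /andP[t0 t1].
  have rt1 : r * t <= 1 by nra.
  have rt0 : 0 <= r * t by exact: mulr_ge0.
  have L : (1 - (r * t) ^+ 2) `^ (- sg - 1) <= (1 - r * t) `^ (- sg - 1).
    have -> : - sg - 1 = - (sg + 1) by rewrite opprD.
    apply: powRN_le; rewrite ?rt ?t0// ?addr_ge0// ?(ltW sg0)//; nra.
  have {Ha L} Ha : modulus (cderiv f (0 + t%:C * z)) <= B * (1 - r * t) `^ (- sg - 1).
    by apply: (le_trans Ha); rewrite ler_wpM2l.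
  have -> : B * modulus De * r * (1 - r * t) `^ (- sg - 1) =
    modulus De * (r * (B * (1 - r * t) `^ (- sg - 1))) by ring.
  by rewrite ler_wpM2l ?modulus_ge0// ler_wpM2l.
have [] := @MVT R psi dpsi 0 1 ltr01.
- by move=> t; rewrite in_itv /= => /andP[t0 t1]; apply: dpsiP; rewrite !ltW.
- by apply: within01 => t t01; exact: is_derive_cont (dpsiP t t01).
move=> t; rewrite in_itv /= => /andP[t0 t1] E.
have : 0 <= psi 1 - psi 0 by rewrite E subr0 mulr1 dpsi0// !ltW.
have -> : psi 1 = B / sg * modulus De * (1 - r) `^ (- sg) - complex.Re (De^* * f z).
  by rewrite /psi /fz rmorph1 mul1r add0r mulr1.
have -> : psi 0 = B / sg * modulus De - complex.Re (De^* * f 0).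
  by rewrite /psi /fz rmorph0 mul0r addr0 mulr0 subr0 powR1 mulr1.
move=> K.
have E2 : complex.Re (De^* * f z) - complex.Re (De^* * f 0) = modulus De ^+ 2.
  rewrite -ReN -ReD -mulrBr -/De sqr_modulus.
  by case: (De) => x y /=; ring.
rewrite -(ler_pM2l De0) -expr2 -E2.
have : 0 <= B / sg * modulus De by rewrite mulr_ge0 ?modulus_ge0// divr_ge0// ltW.
move: K; rewrite -/r; move: ((1 - r) `^ (- sg)) => q.
lra.
Qed.

Lemma growth p sg : 0 <= p -> p <= 1 -> 0 < sg -> exists2 C : R, 0 < C &
  forall f (M : R), analytic f -> 0 <= M -> modulus (f 0) <= M ->
  (forall a, unit_disc a -> (dint (dirichlet_density p (recenter f a)) <=
     (M ^+ 2 * (1 - modulus a ^+ 2) `^ (- (2 * sg)))%:E)%E) ->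
  forall z, unit_disc z -> modulus (f z) <= C * M * (1 - modulus z ^+ 2) `^ (- sg).
Proof.
move=> p0 p1 sg0; have [C C0 HC] := deriv_bound.
exists (1 + C / sg * 2 `^ sg).
  by rewrite ltr_wpDr// mulr_ge0 ?powR_ge0// divr_ge0// ltW.
move=> f M fa M0 f0 H z zD.
have := integrate_growth fa sg0 (mulr_ge0 (ltW C0) M0) (HC f p sg M fa p0 p1 M0 H) zD.
move=> /le_trans; apply.
have u1 : 1 <= (1 - modulus z ^+ 2) `^ (- sg).
  rewrite [leLHS](_ : 1 = 1 `^ (- sg)); last by rewrite powR1.
  apply: powRN_le; rewrite ?(ltW sg0)//.
    exact: one_minus_sqr.
  by rewrite lerBlDr lerDl sqr_ge0.
have : modulus (f 0) <= M * (1 - modulus z ^+ 2) `^ (- sg).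
  by apply: (le_trans f0); rewrite ler_peMr.
have -> : C * M / sg = C / sg * M by rewrite mulrAC.
lra.
Qed.

End Growth.

(** * The Forelli-Rudin estimate *)

Section ForelliRudin.
Variable R : realType.
Implicit Types (z a c : R[i]) (w v : R * R) (x s r : R).
Local Notation mu2 := (@lebesgue_measure R \x @lebesgue_measure R)%E.
Local Notation RR := (measurableTypeR R * measurableTypeR R)%type.

Definition shell a r : set RR := [set w | planeD w /\ modulus (mden a (toC w)) < r].

Lemma measurable_shell a r : measurable (shell a r).
Proof.
apply: open_plane_measurable; first by move=> w [].
move=> w [wD wr]; have [d d0 Hd] := disc_open wD.
have e0 : 0 < r - modulus (mden a (toC w)) by rewrite subr_gt0.
have [d' d'0 Hd'] := rcont_modulus (@mden_ccont R a (toC w)) e0.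
exists (Num.min d d'); first by rewrite lt_min d0.
move=> v; rewrite lt_min => /andP[/Hd ? /Hd' h]; split=> //.
by move: h; rewrite ltr_norml => /andP[_ h]; lra.
Qed.

(** For |a| >= 1/2 the set lies within 2 r of 1 / conj(a). Otherwise |1 - conj(a) z| > 1/2 on the
    disc, so the set is empty for r <= 1/2, and for r > 1/2 the area of the disc, at most 4, is
    below 16 r^2. *)
Lemma shell_area a r : unit_disc a -> 0 < r -> (mu2 (shell a r) <= (16 * r ^+ 2)%:E)%E.
Proof.
move=> aD r0; have [a2|a2] := leP (1/2) (modulus a).
  have aN : a != 0 by rewrite -modulus_gt0; apply: lt_le_trans a2; rewrite divr_gt0.
  have caN : a^* != 0 by rewrite conjc_eq0.
  rewrite (_ : 16 * r ^+ 2 = 4 * (2 * r) ^+ 2); last by ring.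
  rewrite -(@box_area R (a^*)^-1); last by rewrite mulr_gt0.
  apply: le_measure; rewrite ?inE; [exact: measurable_shell|exact: measurable_box|].
  move=> w [wD wr]; apply: in_box.
  have -> : toC w - (a^*)^-1 = - ((a^*)^-1 * mden a (toC w)).
    by rewrite /mden mulrBr mulr1 mulrA mulVf// mul1r opprB.
  rewrite modulusN modulusM modulusV modulusJ mulrC ler_pdivrMr ?modulus_gt0//.
  apply: (le_trans (ltW wr)); have : r * (1/2) <= r * modulus a by rewrite ler_wpM2l// ltW.
  lra.
have [r2|r2] := leP r (1/2).
  have -> : shell a r = set0.
    apply/seteqP; split=> // w [wD wr]; have := mden_ge_a a wD; lra.
  by rewrite measure0 lee_fin mulr_ge0// sqr_ge0.
apply: (@le_trans _ _ (mu2 (@planeD R))).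
  apply: le_measure; rewrite ?inE; [exact: measurable_shell|exact: planeD_measurable|].
  by move=> w [].
apply: (le_trans (@planeD_area R)); rewrite lee_fin; nra.
Qed.

Lemma geo_sum_le (q : R) n : 0 <= q -> q < 1 -> \sum_(k < n) q ^+ k <= (1 - q)^-1.
Proof.
move=> q0 q1; have := subrX1 q n; have := exprn_ge0 n q0.
set S := \sum_(_ < _) _; rewrite -[_^-1]mul1r ler_pdivlMr ?subr_gt0//.
by move=> h1 h2; rewrite mulrC; lra.
Qed.

Lemma dcont_mden_pow a s : unit_disc a -> dcont (fun z => modulus (mden a z) `^ s).
Proof.
move=> aD z zD; apply: rcont_powR; first exact: mden_gt0.
by apply: rcont_modulus; exact: mden_ccont.
Qed.

(* The disc is cut into the shells [2^k d <= |1 - conj a z| < 2^(k+1) d], of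
   area [O((2^k d)^2)], where [d = 1 - |a|]. *)
Lemma forelli_rudin (c : R) : 0 < c -> exists2 C : R, 0 < C & forall a, unit_disc a ->
  (dint (fun z => (modulus (mden a z) `^ (- (2 + c)))%R) <=
    (C * (1 - modulus a ^+ 2) `^ (- c))%:E)%E.
Proof.
move=> c0; pose q : R := 2 `^ (- c).
have q0 : 0 <= q by exact: powR_ge0.
have q1 : q < 1.
  rewrite /q powRN invf_lt1 ?powR_gt0// -[ltLHS](_ : 2 `^ 0 = 1); last by rewrite powRr0.
  by rewrite /powR gt_eqF// ltr_expR mul0r mulr_gt0// ln_gt0// ltr1n.
(* 64 = 16 * 2^2 comes from the area bound at the outer radius 2 r k, 1 / (1 - q) from the geometric
   series, and 2^c from 1 - |a| >= (1 - |a|^2) / 2. *)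
exists (64 / (1 - q) * 2 `^ c).
  by rewrite mulr_gt0 ?powR_gt0// divr_gt0// subr_gt0.
move=> a aD; pose d := 1 - modulus a; have d0 : 0 < d by rewrite subr_gt0; exact: aD.
pose F z := modulus (mden a z) `^ (- (2 + c)).
have cF : dcont F by exact: dcont_mden_pow.
(* As |1 - conj(a) z| <= 2, finitely many shells cover the disc. Their number depends on a, but the
   geometric series bounds the sum independently of it. *)
have [N HN] : exists N, 2 < 2 ^+ N * d.
  have [N HN] := @geo_small R 2 d d0; exists N.
  by move: HN; rewrite ltr_pdivrMr ?exprn_gt0// mulrC.
pose r k : R := 2 ^+ k * d.
have r0 k : 0 < r k by rewrite mulr_gt0// exprn_gt0.
(* The whole sublevel set at the outer radius replaces the k-th shell: its area already has the
   right order. *)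
pose f (k : 'I_N) (w : RR) : \bar R := ((r k `^ (- (2 + c)) * \1_(shell a (r k.+1)) w)%:E).
have mf k : measurable_fun (@planeD R : set RR) (f k).
  apply/measurable_EFinP; apply: measurable_funM; first exact: measurable_cst.
  by apply: measurable_indic; exact: measurable_shell.
have f0 k w : (0 <= f k w)%E by rewrite lee_fin mulr_ge0 ?powR_ge0.
have pw w : planeD w -> ((F (toC w))%:E <= \sum_(k < N) f k w)%E.
  move=> wD; set m := modulus (mden a (toC w)).
  have dm : d <= m by exact: mden_ge_a.
  have m2 : m <= 2 by exact: mden_le2.
  have ex : exists k, m < r k by exists N; apply: le_lt_trans m2 HN.
  have [k mk kmin] := ex_minnP ex.
  case: k mk kmin => [|k] mk kmin.
    by move: mk; rewrite /r expr0 mul1r ltNge dm.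
  have rk : r k <= m.
    by rewrite leNgt; apply/negP => /kmin; rewrite ltnn.
  have kN : (k < N)%N by apply: kmin; exact: le_lt_trans m2 HN.
  rewrite (bigD1 (Ordinal kN))//=; apply: le_trans (_ : (f (Ordinal kN) w <= _)%E); last first.
    by rewrite leeDl// sume_ge0.
  rewrite /f indicE mem_set ?mulr1; last by split.
  rewrite lee_fin; apply: powRN_le => //.
  by rewrite addr_ge0// ltW.
have : (dint F <= \int[mu2]_(w in @planeD R) \sum_(k < N) f k w)%E.
  apply: ge0_le_integral.
  - exact: planeD_measurable.
  - by move=> w wD; rewrite lee_fin powR_ge0.
  - exact: dcont_emeasurable.
  - by apply: emeasurable_sum => k; exact: mf.
  exact: pw.
move=> /le_trans; apply; rewrite ge0_integral_sum//; last exact: planeD_measurable.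
apply: (@le_trans _ _ (\sum_(k < N) (64 * d `^ (- c) * q ^+ k)%:E)%E).
  apply: lee_sum => k _; under eq_integral do rewrite /f EFinM.
  rewrite ge0_integralZl//=; last 3 first.
  - exact: planeD_measurable.
  - by apply/measurable_EFinP/measurable_indic; exact: measurable_shell.
  - by rewrite lee_fin powR_ge0.
  rewrite integral_indic; [|exact: planeD_measurable|exact: measurable_shell].
  apply: (@le_trans _ _ ((r k `^ (- (2 + c)))%:E * (16 * r k.+1 ^+ 2)%:E)%E).
    rewrite lee_wpmul2l ?lee_fin ?powR_ge0//.
    apply: le_trans (shell_area aD (r0 k.+1)).
    apply: le_measure; rewrite ?inE; [|exact: measurable_shell|by move=> w []].
    by apply: measurableI; [exact: measurable_shell|exact: planeD_measurable].
  rewrite -EFinM lee_fin le_eqVlt; apply/orP; left; apply/eqP.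
  have -> : r k.+1 = 2 * r k by rewrite /r exprS mulrA.
  have E1 : r k `^ (- (2 + c)) = (r k ^+ 2)^-1 * (r k `^ c)^-1.
    rewrite powRN powRD; last by rewrite (gt_eqF (r0 k)) implybT.
    by rewrite invfM -[in r k `^ 2](mulr1n 2) powR_mulrn// ltW.
  have E2 : r k `^ c = (2 `^ c) ^+ k * d `^ c.
    rewrite {1}/r powRM ?exprn_ge0 ?(ltW d0)//; congr (_ * _).
    by rewrite powRX.
  rewrite E1 E2 /q !powRN exprVn.
  have p1 : (2 `^ c) ^+ k != 0 :> R by rewrite gt_eqF// exprn_gt0// powR_gt0.
  have p2 : d `^ c != 0 by rewrite gt_eqF// powR_gt0.
  have p3 : r k != 0 by rewrite gt_eqF.
  move: ((2 `^ c) ^+ k : R) (d `^ c) (r k) p1 p2 p3 => x1 x2 x3 p1 p2 p3.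
  by field; rewrite p1 p2 p3.
rewrite sumEFin lee_fin -mulr_sumr.
have H1 : \sum_(k < N) q ^+ k <= (1 - q)^-1 by exact: geo_sum_le.
have H2 : d `^ (- c) <= 2 `^ c * (1 - modulus a ^+ 2) `^ (- c).
  have -> : 2 `^ c = 2^-1 `^ (- c) :> R.
    by rewrite powRN -[2^-1]powR_inv1// -powRrM mulN1r powRN invrK.
  have u0 := one_minus_sqr aD.
  rewrite -powRM ?(ltW u0)//; apply: powRN_le; rewrite ?(ltW c0)//.
    by rewrite mulr_gt0.
  by have := modulus_ge0 a; have : modulus a < 1 by []; rewrite /d expr2; nra.
rewrite (_ : _ / _ * _ * _ = 64 * (2 `^ c * (1 - modulus a ^+ 2) `^ (- c)) * (1 - q)^-1); last by ring.
apply: ler_pM => //; first by rewrite mulr_ge0 ?powR_ge0.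
  by apply: sumr_ge0 => k _; exact: exprn_ge0.
by rewrite ler_wpM2l.
Qed.

End ForelliRudin.

(** * The complex exponential and powers of 1 - conj(a) z *)

Section ComplexPower.
Variable R : realType.
Implicit Types (f : R[i] -> R[i]) (a z w h : R[i]) (x y : R).

Definition cexp z : R[i] :=
  (expR (complex.Re z))%:C * (cos (complex.Im z) +i* sin (complex.Im z)).

Lemma cexpD z w : cexp (z + w) = cexp z * cexp w.
Proof.
rewrite /cexp ReD ImD expRD cosD sinD.
move: (expR _) (expR _) (cos _) (cos _) (sin _) (sin _) => a b c d e f.
by apply: complexP; rewrite !(ReM, ImM) /= ?ReM ?ImM /=; ring.
Qed.

Lemma cexp0 : cexp 0 = 1.
Proof. by rewrite /cexp /= expR0 cos0 sin0 mul1r. Qed.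

Lemma modulus_cis y : modulus (cos y +i* sin y) = 1.
Proof. by rewrite /modulus /= cos2Dsin2 sqrtr1. Qed.

Lemma modulus_cexp z : modulus (cexp z) = expR (complex.Re z).
Proof. by rewrite modulusM modulus_cis mulr1 modulus_real ger0_norm// expR_ge0. Qed.

Lemma cdiff_cexp0 : cdiff cexp 0 1.
Proof.
have H1 : pdiff (fun x => (expR x)%:C) 0 1.
  apply/pdiff_is_derive; split => /=; last exact: is_derive_cst.
  by rewrite -[X in is_derive _ _ _ X](@expR0 R); exact: is_derive_expR.
have H2 : pdiff (fun y => cos y +i* sin y) (0 : R) 'i.
  apply/pdiff_is_derive; split => /=.
    by have := is_derive_cos (0 : R); rewrite sin0 oppr0.
  by have := is_derive_sin (0 : R); rewrite cos0.
move=> e e0; have e3 : 0 < e / 4 by rewrite divr_gt0.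
have [d1 d10 K1] := H1 _ e3; have [d2 d20 K2] := H2 _ e3.
exists (Num.min 1 (Num.min (e / 4) (Num.min d1 d2))).
  by rewrite !lt_min ltr01 e3 d10.
move=> h; rewrite subr0 mulr1 !lt_min => /and4P[h1 he hd1 hd2].
set x := complex.Re h; set y := complex.Im h.
have xh : `|x| <= modulus h := Re_le_modulus h.
have yh : `|y| <= modulus h := Im_le_modulus h.
have := K1 x; rewrite subr0 modulus_real => /(_ (le_lt_trans xh hd1)).
have := K2 y; rewrite subr0 modulus_real => /(_ (le_lt_trans yh hd2)).
rewrite expR0 cos0 sin0 mulr1.
have hE : h = x%:C + y%:C * 'i by apply: complexP; rewrite !(ReD, ReM, ImD, ImM) /=; ring.
rewrite cexp0 /cexp -/x -/y; have := modulus_cis y.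
have -> : (1 +i* 0 : R[i]) = 1 by [].
move: (cos y +i* sin y) (expR x)%:C => B A mB k2 k1.
(* With A = exp x and B = cos y + i sin y, the three terms are at most e/4, e/2 and e/4 times
   |h|. *)
have -> : A * B - 1 - h = (A - 1 - x%:C) * B + (1 + x%:C) * (B - 1 - y%:C * 'i)
    + x%:C * (y%:C * 'i) by rewrite hE; ring.
apply: le_trans (modulusD _ _) _; apply: le_trans (lerD (modulusD _ _) (lexx _)) _.
rewrite !modulusM mB modulus_i !modulus_real !mulr1.
have k3 : modulus (1 + x%:C) <= 2.
  by apply: le_trans (modulusD _ _) _; rewrite modulus1 modulus_real; move: xh h1; lra.
have m0 := modulus_ge0 h.
have k4 : `|x| * `|y| <= e / 4 * modulus h by apply: ler_pM => //; exact: le_trans xh (ltW he).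
have k5 : modulus (1 + x%:C) * modulus (B - 1 - y%:C * 'i) <= 2 * (e / 4 * `|y|).
  by apply: ler_pM => //; exact: modulus_ge0.
by move: k1 k4 k5 xh yh e0; nra.
Qed.

Lemma cdiff_cexp z : cdiff cexp z (cexp z).
Proof.
move=> e e0; have m1 : 0 < modulus (cexp z) by rewrite modulus_cexp expR_gt0.
have [d d0 H] := cdiff_cexp0 (divr_gt0 e0 m1).
exists d => // w wz; have := H (w - z); rewrite subr0 => /(_ wz).
rewrite cexp0 mulr1.
have -> : cexp w - cexp z - (w - z) * cexp z = cexp z * (cexp (w - z) - 1 - (w - z)).
  by rewrite -{1}(subrK z w) cexpD; ring.
by rewrite modulusM mulrAC ler_pdivlMr// mulrC.
Qed.

(* The logarithm of [(1 - a^* z)^-1], normalised to vanish at 0. *)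
Definition logden a := seg (fun w => a^* / mden a w) 0.

Lemma cdiff_mden a z : cdiff (mden a) z (- a^*).
Proof.
have H1 := gdiffM (gdiff_cst id (- a^*) z) (@cdiff_id R z).
have := gdiffD (gdiff_cst id 1 z) H1; rewrite mul0r !add0r mulr1.
apply: (gdiff_ext ltr01) => [y _|]; by rewrite /mden mulNr.
Qed.

Lemma cdiff_logden a z : unit_disc a -> unit_disc z ->
  cdiff (logden a) z (a^* / mden a z).
Proof.
move=> aD zD; apply: (@cdiff_seg0 R (fun w => a^* / mden a w)) => // w wD.
have H1 := @gdiff_comp _ _ id (@GRing.inv _) (mden a) w _ _
  (cdiff_inv (mden_neq0 aD wD)) (cdiff_mden a w).
exact: cdiff_derivable (gdiffM (gdiff_cst id a^* w) H1).
Qed.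

(** The product has derivative 0 on the disc, hence is constant along the radius to z, and equals 1
    at 0. *)
Lemma cexp_logden a z : unit_disc a -> unit_disc z -> cexp (logden a z) * mden a z = 1.
Proof.
move=> aD zD; pose E w := cexp (logden a w) * mden a w.
have dE w : unit_disc w -> cdiff E w 0.
  move=> wD; have n0 := mden_neq0 aD wD.
  have H1 := @gdiff_comp _ _ id cexp (logden a) w _ _ (cdiff_cexp _) (cdiff_logden aD wD).
  have := gdiffM H1 (cdiff_mden a w); rewrite /E /=.
  by rewrite (_ : _ + _ = 0)//; move: n0; move: (cexp _) (mden a w) => u v v0; field.
have H : E ((0 : R)%:C * z) = E ((1 : R)%:C * z).
  apply: (@pdiff_const01 R (fun l => E (l%:C * z)) (fun=> 0)) => // l l01.
  have lz : unit_disc (l%:C * z).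
    by rewrite -[_ * _]add0r -[z in l%:C * z]subr0; apply: disc_seg => //; exact: disc0.
  have := @gdiff_comp _ _ (real_complex R) E (fun l : R => 0 + l%:C * z) l _ _ _ (pdiff_affine 0 z l).
  move=> /(_ 0); rewrite add0r => /(_ (dE _ lz)); rewrite mulr0.
  by apply: (gdiff_ext ltr01) => [y _|] /=; rewrite add0r.
move: H; rewrite mul0r mul1r {2}/E => <-.
by rewrite /E /logden /seg subr0 mul0r cexp0 mul1r /mden mulr0 subr0.
Qed.

(** The branch of (1 - conj(a) z)^(-p) that equals 1 at 0. *)
Definition powden p a z := cexp (p%:C * logden a z).

Lemma cdiff_powden p a z : unit_disc a -> unit_disc z ->
  cdiff (powden p a) z (p%:C * a^* / mden a z * powden p a z).
Proof.
move=> aD zD.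
have H1 := gdiffM (gdiff_cst id p%:C z) (cdiff_logden aD zD).
have := @gdiff_comp _ _ id cexp (fun z => p%:C * logden a z) z _ _ (cdiff_cexp _) H1.
by rewrite (mul0r (logden a z)) add0r (mulrA p%:C).
Qed.

Lemma powden_analytic p a : unit_disc a -> analytic (powden p a).
Proof. by move=> aD z zD; exact: cdiff_derivable (cdiff_powden p aD zD). Qed.

Lemma modulus_powden p a z : unit_disc a -> unit_disc z ->
  modulus (powden p a z) = modulus (mden a z) `^ (- p).
Proof.
move=> aD zD; have m0 := mden_gt0 aD zD.
have := congr1 (@modulus R) (cexp_logden aD zD).
rewrite modulusM !modulus_cexp modulus1 (ReM p%:C) /= mul0r subr0.
move=> /(congr1 (@ln R)); rewrite lnM ?posrE ?expR_gt0// expRK ln1 => /eqP.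
rewrite addr_eq0 => /eqP ->.
by rewrite /powR gt_eqF// mulrN mulNr.
Qed.

Lemma modulus_cderiv_powden p a z : 0 <= p -> unit_disc a -> unit_disc z ->
  modulus (cderiv (powden p a) z) <= p * modulus (mden a z) `^ (- (p + 1)).
Proof.
move=> p0 aD zD; have m0 := mden_gt0 aD zD.
rewrite (cdiff_cderiv (cdiff_powden p aD zD)) (modulusM _ (powden p a z)) modulus_powden// !modulusM modulusV modulus_real modulusJ.
rewrite ger0_norm// opprD powRD; last by rewrite (gt_eqF m0) implybT.
rewrite powR_inv1 ?(ltW m0)//.
have a1 : modulus a <= 1 by exact: ltW.
have q0 : 0 <= modulus (mden a z) `^ (- p) by exact: powR_ge0.
have v0 : 0 <= (modulus (mden a z))^-1 by rewrite invr_ge0 ltW.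
rewrite -!mulrA; apply: ler_wpM2l => //.
by rewrite mulrA mulrC; apply: ler_wpM2l => //; apply: ler_piMl.
Qed.

End ComplexPower.

(** * Integration against a measure given by a density *)

Section DensityMeasure.
Context d (T : measurableType d) (R : realType).
Variables (nu mu : {measure set T -> \bar R}) (E : set T) (g : T -> R).
Hypotheses (mE : measurable E) (mg : measurable_fun E g).
Hypothesis g0 : forall x, E x -> 0 <= g x.
Hypothesis nuE : forall A, measurable A ->
  nu A = (\int[mu]_(x in A `&` E) (g x)%:E)%E.

Import HBNNSimple.

(** Both sides are monotone limits along simple functions increasing to [f]; on the indicator of a
    level set the identity is [nuE]. *)
Lemma integral_density (f : T -> \bar R) : (forall x, E x -> 0 <= f x)%E ->
  measurable_fun E f ->
  (\int[nu]_(x in E) f x = \int[mu]_(x in E) (f x * (g x)%:E))%E.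
Proof.
move=> f0 mf; pose h := nnsfun_approx mE mf.
have mge : measurable_fun E (EFin \o g) by exact/measurable_EFinP.
have mh n : measurable_fun E (EFin \o h n).
  by apply/measurable_EFinP; apply: (measurable_funS measurableT) => //; exact/measurable_funP.
have -> : (\int[nu]_(x in E) f x = lim (\int[nu]_(x in E) (EFin \o h n) x @[n --> \oo]))%E.
  have fE x : E x -> f x = lim ((EFin \o h n) x @[n --> \oo]).
    by move=> Ex; apply/esym/cvg_lim => //; exact: cvg_nnsfun_approx.
  under eq_integral => x /[!inE] /fE -> //.
  apply: monotone_convergence => //.
  - by move=> n x Ex //=; rewrite lee_fin.
  - by move=> x Ex a b ab; rewrite lee_fin; exact/lefP/nd_nnsfun_approx.
have -> : (\int[mu]_(x in E) (f x * (g x)%:E) =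
    lim (\int[mu]_(x in E) ((EFin \o h n) x * (g x)%:E) @[n --> \oo]))%E.
  have fg x : E x -> (f x * (g x)%:E)%E = lim (((EFin \o h n) x * (g x)%:E)%E @[n --> \oo]).
    by move=> Ex; apply/esym/cvg_lim => //; apply: cvgeZr => //; exact: cvg_nnsfun_approx.
  under eq_integral => x /[!inE] /fg -> //.
  apply: monotone_convergence => [//| | |].
  - by move=> n; exact/emeasurable_funM.
  - by move=> n x Ex /=; rewrite mule_ge0 ?lee_fin ?g0.
  - by move=> x Ex a b ab/=; rewrite lee_wpmul2r ?lee_fin ?g0//; exact/lefP/nd_nnsfun_approx.
suff suf n : (\int[nu]_(x in E) (EFin \o h n) x =
    \int[mu]_(x in E) ((EFin \o h n) x * (g x)%:E))%E.
  by under eq_fun do rewrite suf.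
transitivity (\int[nu]_(x in E)
   (\sum_(y \in range (h n)) (y * \1_(h n @^-1` [set y]) x)%:E))%E.
  by apply: eq_integral => t tE; rewrite /= fimfunE -fsumEFin.
have indich m r : measurable_fun E (fun x => (r * \1_(h m @^-1` [set r]) x)%:E).
  by apply: (measurable_comp measurableT) => //; exact: measurable_funM.
rewrite ge0_integral_fsum//; last by move=> m y Ey; exact: nnfun_muleindic_ge0.
transitivity (\int[mu]_(x in E) (\sum_(y \in range (h n))
    (y * \1_(h n @^-1` [set y]) x)%:E * (g x)%:E))%E; last first.
  under eq_integral => x xE.
    rewrite -ge0_mule_fsuml => [|y]; last exact: nnfun_muleindic_ge0.
    rewrite fsumEFin // -(fimfunE _ x); over.
  by [].
rewrite ge0_integral_fsum//; last 2 first.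
  - by move=> y; apply: emeasurable_funM.
  - by move=> m y Ey; apply: mule_ge0; [exact: nnfun_muleindic_ge0|rewrite lee_fin g0].
apply: eq_fsbigr => r rhn.
under eq_integral do rewrite EFinM.
rewrite integralZl_indic_nnsfun => //.
under [RHS]eq_integral do rewrite EFinM -muleA.
rewrite ge0_integralZl//.
- under [in RHS]eq_integral do rewrite muleC.
  rewrite [in RHS](eq_integral ((EFin \o g) \_ (h n @^-1` [set r]))); last first.
    by move=> x xE; rewrite epatch_indic.
  rewrite -integral_mkcondr integral_indic// nuE; last exact: measurableI.
  by congr (_ * _)%E; congr integral; rewrite -setIA setIid setIC.
- by apply: emeasurable_funM => //; exact/measurable_EFinP.
- by move=> t Et; rewrite mule_ge0 ?lee_fin ?g0.
- by move: rhn; rewrite inE => -[t _ <-]; rewrite lee_fin.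
Qed.

End DensityMeasure.

(** * The Carleson integral as a weighted area integral *)

Section CarlesonIntegral.
Variable R : realType.
Local Notation RR := (measurableTypeR R * measurableTypeR R)%type.

Lemma integral_mu_ (p : R) (g : R[i] -> R[i]) (F : R[i] -> R)
    (mu : {measure set (R * R) -> \bar R}) :
  analytic g -> (forall A, measurable A -> mu A = mu_ p g A) ->
  dcont F -> (forall z, unit_disc z -> 0 <= F z) ->
  (\int[mu]_(w in @planeD R) (F (toC w))%:E =
   (pi^-1)%:E * dint (fun z => (F z * dirichlet_density p g z)%R))%E.
Proof.
move=> ga muE cF F0.
have pi0 : 0 <= pi^-1 :> R by rewrite invr_ge0 pi_ge0.
have cd := dcont_density p ga.
(* The identity between two presentations of the plane as a measurable space: the image of [mu]
   lives on the same type as the area measure. *)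
pose iota (w : R * R) : RR := w.
have mi : measurable_fun (setT : set (R * R)) iota.
  by move=> _ A mA; rewrite setTI.
have [nu nuE] : exists nu : {measure set RR -> \bar R}, nu = pushforward mu iota :> (set RR -> \bar R).
  by unshelve eexists (pushforward mu iota : {measure set RR -> \bar R}).
have -> : (\int[mu]_(w in @planeD R) (F (toC w))%:E =
    \int[nu]_(w in (@planeD R : set RR)) (F (toC w))%:E)%E.
  rewrite nuE (ge0_integral_pushforward mi)//.
  - exact: planeD_measurable.
  - exact: dcont_emeasurable.
  - by move=> w; rewrite inE => wD; rewrite lee_fin F0.
rewrite (@integral_density _ RR R nu (@lebesgue_measure R \x @lebesgue_measure R)%E (@planeD R)
  (fun w => pi^-1 * dirichlet_density p g (toC w))).
- rewrite -dintZ//.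
  + by apply: eq_integral => w _; rewrite -EFinM; congr EFin; rewrite mulrCA.
  + by move=> z zD; apply: rcontM; [exact: cF|exact: cd].
  + by move=> z zD; rewrite mulr_ge0 ?F0 ?density_ge0.
- exact: planeD_measurable.
- apply: (@dcont_measurable _ (fun z => pi^-1 * dirichlet_density p g z)) => z zD.
  by apply: rcontM; [exact: rcont_cst|exact: cd].
- by move=> w _; rewrite mulr_ge0 ?density_ge0.
- move=> A mA; rewrite nuE /pushforward muE// /mu_ /area_integral -ge0_integralZl//.
  + exact: measurableI mA (@planeD_measurable R).
  + apply: measurable_funS (dcont_emeasurable cd); first exact: planeD_measurable.
    by move=> w [].
  + by move=> w _; rewrite lee_fin density_ge0.
- by move=> w wD; rewrite lee_fin F0.
- exact: dcont_emeasurable.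
Qed.

End CarlesonIntegral.

(** * Norm bounds as integral bounds, and the Q_q case *)

Section MorreyBound.
Variable R : realType.
Implicit Types (f g h : R[i] -> R[i]) (a z : R[i]) (p q s lam M N : R).

(** The Dirichlet-Morrey norm bound in squared form, with the weight moved to the right and without
    the normalising 1/pi; for the space with parameter lambda, s = p(1 - lambda)/2. *)
Definition morrey_bd p s f M := [/\ analytic f, 0 <= M, modulus (f 0) <= M &
  forall a, unit_disc a -> (dint (dirichlet_density p (recenter f a)) <=
    (M ^+ 2 * (1 - modulus a ^+ 2) `^ (- (2 * s)))%:E)%E].

Lemma pi_le4 : pi <= 4 :> R.
Proof. by have := @pihalf_lt2 R; lra. Qed.

Lemma pi_inv_le1 : pi^-1 <= 1 :> R.
Proof. by rewrite invf_le1 ?pi_gt0//; have := @pi_ge2 R; lra. Qed.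

Lemma powRNsqr (x s : R) : 0 < x -> x `^ (- (2 * s)) = (x `^ s ^+ 2)^-1.
Proof. by move=> x0; rewrite powRN mulrC powRrM powR_mulrn// powR_ge0. Qed.

Lemma Dp_norm2_recenter p f a :
  Dp_norm2 p (recenter f a) = ((pi^-1)%:E * dint (dirichlet_density p (recenter f a)))%E.
Proof. by rewrite /Dp_norm2 recenter0 modulus0 expr0n add0e area_integralE. Qed.

Lemma morrey_norm_ge p lam f a : unit_disc a ->
  (((1 - modulus a ^+ 2) `^ (p / 2 * (1 - lam)))%:E * Dp_norm p (recenter f a) <=
    morrey_norm p lam f)%E.
Proof.
move=> aD; apply: le_trans (leeDr _ _); last by rewrite lee_fin modulus_ge0.
by apply: ereal_sup_ubound; exists a.
Qed.

(** The factor 2 pays for the missing normalisation of [dint], through pi <= 4 = 2^2. *)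
Lemma morrey_norm_bd p lam f : morrey p lam f ->
  exists2 N, morrey_norm p lam f = N%:E & morrey_bd p (p / 2 * (1 - lam)) f (2 * N).
Proof.
move=> [fa fN]; set s := p / 2 * (1 - lam).
have S0 : (0 <= ereal_sup [set ((1 - modulus a ^+ 2) `^ s)%:E * Dp_norm p (recenter f a)
    | a in @unit_disc R])%E.
  apply: le_ereal_sup_tmp; exists (((1 - modulus (0 : R[i]) ^+ 2) `^ s)%:E *
    Dp_norm p (recenter f 0%R))%E.
    by exists 0 => //; exact: disc0.
  by rewrite mule_ge0 ?lee_fin ?powR_ge0 ?sqrte_ge0.
have f0 := modulus_ge0 (f 0).
have Nf : morrey_norm p lam f \is a fin_num.
  by rewrite ge0_fin_numE// adde_ge0.
have N0 : modulus (f 0) <= fine (morrey_norm p lam f).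
  by rewrite -lee_fin fineK// leeDl.
exists (fine (morrey_norm p lam f)); first by rewrite fineK.
have NN := le_trans f0 N0.
split=> //; [by rewrite mulr_ge0|by move: N0 NN; lra|move=> a aD].
have u0 := one_minus_sqr aD; have w0 : 0 < (1 - modulus a ^+ 2) `^ s by exact: powR_gt0.
have := morrey_norm_ge p lam f aD; rewrite -[X in (_ <= X)%E -> _](fineK Nf) -/s /Dp_norm Dp_norm2_recenter.
rewrite powRNsqr//.
have D0 : (0 <= dint (dirichlet_density p (recenter f a)))%E.
  by apply: dint_ge0 => z _; exact: density_ge0.
move: (fine _) NN (_ `^ s) w0 (dint _) D0 => N NN w w0 [d| |//] d0; last first.
  rewrite gt0_muley ?lte_fin ?invr_gt0 ?pi_gt0// /= gt0_muley ?lte_fin//.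
rewrite -(EFinM pi^-1) [sqrte _]/= -EFinM !lee_fin => H.
have pd : 0 <= pi^-1 * d by rewrite mulr_ge0 ?invr_ge0 ?pi_ge0// -lee_fin.
have : (w * Num.sqrt (pi^-1 * d)) ^+ 2 <= N ^+ 2.
  by rewrite lerXn2r ?nnegrE ?mulr_ge0 ?(ltW w0) ?sqrtr_ge0.
rewrite exprMn sqr_sqrtr// => H2; rewrite ler_pdivlMr ?exprn_gt0//.
have -> : d * w ^+ 2 = pi * (w ^+ 2 * (pi^-1 * d)).
  have := lt0r_neq0 (pi_gt0 R); move: (pi : R) => x x0.
  by field.
rewrite exprMn (_ : 2 ^+ 2 = 4); last by rewrite -natrX.
apply: ler_pM => //; [exact: pi_ge0|by rewrite mulr_ge0 ?sqr_ge0|exact: pi_le4].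
Qed.

Lemma morrey_norm_le p lam f M : analytic f -> f 0 = 0 -> 0 <= M ->
  (forall a, unit_disc a -> (dint (dirichlet_density p (recenter f a)) <=
    (M ^+ 2 * (1 - modulus a ^+ 2) `^ (- (2 * (p / 2 * (1 - lam)))))%:E)%E) ->
  (morrey_norm p lam f <= M%:E)%E.
Proof.
move=> fa f0 M0 H; rewrite /morrey_norm f0 modulus0 add0e.
apply: ge_ereal_sup => _ [a aD <-]; have := H a aD.
have u0 := one_minus_sqr aD; rewrite powRNsqr//.
have w0 : 0 < (1 - modulus a ^+ 2) `^ (p / 2 * (1 - lam)) by exact: powR_gt0.
rewrite /Dp_norm Dp_norm2_recenter.
have D0 : (0 <= dint (dirichlet_density p (recenter f a)))%E.
  by apply: dint_ge0 => z _; exact: density_ge0.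
move: (_ `^ _) w0 (dint _) D0 => w w0 [d| |//] d0 //.
rewrite lee_fin => Hd; rewrite -(EFinM pi^-1) [sqrte _]/= -EFinM lee_fin.
have -> : M = w * Num.sqrt ((M / w) ^+ 2).
  by rewrite sqrtr_sqr ger0_norm ?divr_ge0 ?(ltW w0)// mulrC divfK// gt_eqF.
rewrite ler_wpM2l ?(ltW w0)// ler_wsqrtr// expr_div_n; apply: le_trans Hd.
by apply: ler_piMl => //; exact: pi_inv_le1.
Qed.

(** As [J g f] vanishes at 0, its norm is determined by the recentred Dirichlet integrals, so one
    squared estimate gives invariance and boundedness together. *)
Lemma J_bounded_operator p lam g (B : R) : analytic g -> 0 <= B ->
  (forall f M, morrey_bd p (p / 2 * (1 - lam)) f M -> forall a, unit_disc a ->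
    (dint (dirichlet_density p (recenter (J g f) a)) <=
      (B * M ^+ 2 * (1 - modulus a ^+ 2) `^ (- (2 * (p / 2 * (1 - lam)))))%:E)%E) ->
  bounded_operator (morrey p lam) (morrey_norm p lam) (J g).
Proof.
move=> ga B0 H.
have K f : morrey p lam f ->
    (morrey_norm p lam (J g f) <= (Num.sqrt B * 2)%:E * morrey_norm p lam f)%E.
  move=> fm; have [N NE fN] := morrey_norm_bd fm.
  have fa : analytic f by case: fm.
  rewrite NE -EFinM; apply: morrey_norm_le; [exact: J_analytic|exact: J0| |].
    by have [_ N0 _ _] := fN; rewrite -mulrA mulr_ge0 ?sqrtr_ge0.
  move=> a aD; apply: le_trans (H _ _ fN a aD) _.
  by rewrite -(mulrA (Num.sqrt B)) [(Num.sqrt B * _) ^+ 2]exprMn sqr_sqrtr.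
split; last by exists (Num.sqrt B * 2).
- move=> f fm; have fa : analytic f by case: fm.
  split; first exact: J_analytic.
  apply: le_lt_trans (K f fm) _; have [N -> _] := morrey_norm_bd fm.
  by rewrite -EFinM ltry.
- move=> c f h [fa _] [ha _] z zD; exact: J_linear.
Qed.

(** At lambda = 1 the Morrey weight is 1; hence [morrey_norm_bd] also serves for the symbol g. *)
Lemma Qp_morrey q g : Qp q g -> morrey q 1 g.
Proof.
move=> [ga gN]; split => //; rewrite /morrey_norm subrr mulr0.
rewrite (_ : [set _ | _ in _] = [set Dp_norm q (recenter g a) | a in @unit_disc R])//.
by apply: eq_imagel => a aD; rewrite powRr0 mul1e.
Qed.

Lemma J_Qp_bound p q g : 0 < q -> q < p -> p < 1 -> Qp q g ->
  exists2 B, 0 <= B & forall f M, morrey_bd p ((p - q) / 2) f M -> forall a, unit_disc a ->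
    (dint (dirichlet_density p (recenter (J g f) a)) <=
      (B * M ^+ 2 * (1 - modulus a ^+ 2) `^ (- (2 * ((p - q) / 2))))%:E)%E.
Proof.
move=> q0 qp p1 gQ; have p0 := lt_trans q0 qp.
have s0 : 0 < (p - q) / 2 by rewrite divr_gt0// subr_gt0.
have [C C0 HC] := growth (ltW p0) (ltW p1) s0.
have [N _ [ga N0 _ gN]] := morrey_norm_bd (Qp_morrey gQ).
exists (4 * C ^+ 2 * (2 * N) ^+ 2); first by rewrite mulr_ge0 ?sqr_ge0// mulr_ge0 ?sqr_ge0.
move=> f M [fa M0 fM fB] a aD; have va := one_minus_sqr aD.
have Ja := J_analytic fa ga.
have := gN a aD; rewrite subrr mulr0 mulr0 oppr0 powRr0 mulr1 => gNa.
set v := (1 - modulus a ^+ 2) `^ (- (2 * ((p - q) / 2))).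
have v0 : 0 <= v by exact: powR_ge0.
set k := 4 * (C * M) ^+ 2 * v.
have k0 : 0 <= k by rewrite mulr_ge0// mulr_ge0 ?sqr_ge0.
have rga := recenter_analytic ga aD; have rJa := recenter_analytic Ja aD.
apply: (@le_trans _ _ (dint (fun z => k * dirichlet_density q (recenter g a) z))).
  apply: dint_le; first exact: dcont_density.
    by move=> z zD; apply: rcontM; [exact: rcont_cst|exact: (dcont_density q rga)].
  move=> z zD; rewrite density_ge0/= !density_recenter// cderiv_J//; last exact: phi_disc.
  have fz := HC f M fa M0 fM fB _ (phi_disc aD zD).
  have uz := one_minus_sqr zD; have m0 := mden_gt0 aD zD.
  rewrite modulusM exprMn.
  have -> : (1 - modulus z ^+ 2) `^ p =
      (1 - modulus z ^+ 2) `^ (p - q) * (1 - modulus z ^+ 2) `^ q.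
    by rewrite -powRD ?subrK// (gt_eqF uz) implybT.
  (* The powers of 1 - |z|^2 cancel, and what remains beside the power of 1 - |a|^2 is |1 - conj(a)
     z|^(2(p - q)) <= 4^(p - q) <= 4, the 4 in [k]. *)
  have key : modulus (f (phi a z)) ^+ 2 * (1 - modulus z ^+ 2) `^ (p - q) <= k.
    apply: (@le_trans _ _ ((C * M) ^+ 2 * (1 - modulus (phi a z) ^+ 2) `^ (- (p - q))
        * (1 - modulus z ^+ 2) `^ (p - q))).
      rewrite ler_wpM2r ?powR_ge0//.
      have -> : p - q = (p - q) / 2 * 2 by rewrite divfK.
      rewrite -(mulNr ((p - q) / 2)) powRrM powR_mulrn ?powR_ge0// -exprMn lerXn2r ?nnegrE ?modulus_ge0//.
      exact: le_trans (modulus_ge0 _) fz.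
    rewrite one_minus_phi// /k (mulrC 4) -(mulrA _ (_ `^ _)) -(mulrA _ 4).
    rewrite ler_wpM2l ?sqr_ge0//.
    have -> : v = (1 - modulus a ^+ 2) `^ (- (p - q)) by rewrite /v mulrC divfK.
    rewrite powRM ?mulr_ge0 ?(ltW va) ?(ltW uz) ?invr_ge0 ?exprn_ge0 ?(ltW m0)//.
    rewrite powRM ?(ltW va) ?(ltW uz)//.
    have -> : (1 - modulus a ^+ 2) `^ (- (p - q)) * (1 - modulus z ^+ 2) `^ (- (p - q)) *
        ((modulus (mden a z) ^+ 2)^-1) `^ (- (p - q)) * (1 - modulus z ^+ 2) `^ (p - q) =
      ((modulus (mden a z) ^+ 2)^-1) `^ (- (p - q)) * (1 - modulus a ^+ 2) `^ (- (p - q)).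
      rewrite (powRN (1 - modulus z ^+ 2)).
      have := powR_gt0 (p - q) uz; move: (powR _ (p - q)) (powR _ (- (p - q))) => x1 x2 x10.
      move: (powR _ (- (p - q))) => x3.
      by field; rewrite gt_eqF.
    rewrite ler_wpM2r ?powR_ge0//.
    have -> : ((modulus (mden a z) ^+ 2)^-1) `^ (- (p - q)) =
        (modulus (mden a z) ^+ 2) `^ (p - q).
      by rewrite -powR_inv1 ?sqr_ge0// -powRrM mulN1r opprK.
    apply: (@le_trans _ _ (4 `^ (p - q))).
      apply: ge0_ler_powR; rewrite ?nnegrE ?sqr_ge0 ?subr_ge0 ?(ltW qp)//.
      have := mden_le2 aD zD; have := m0; nra.
    rewrite -[leRHS](powRr1 (ler0n R 4)); apply: ler_powR; first by rewrite ler1n.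
    by move: p1 q0; lra.
  have e0 : 0 <= modulus (cderiv g (phi a z)) ^+ 2 * modulus (dphi a z) ^+ 2
     * (1 - modulus z ^+ 2) `^ q by rewrite mulr_ge0 ?powR_ge0// mulr_ge0 ?sqr_ge0.
  move: key e0; move: (modulus (cderiv g _)) (modulus (f _)) (modulus (dphi a z)).
  move: (powR _ (p - q)) (powR _ q) => x1 x2 x3 x4 x5 H1 H2.
  have := ler_wpM2r H2 H1; lra.
rewrite dintZ//; [|exact: dcont_density|by move=> z _; exact: density_ge0].
apply: le_trans (lee_wpmul2l _ gNa) _; first by rewrite lee_fin.
by rewrite -EFinM lee_fin /k le_eqVlt; apply/orP; left; apply/eqP; ring.
Qed.

End MorreyBound.

(** * The W_p case *)

Section CarlesonBound.
Variable R : realType.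
Implicit Types (f g P : R[i] -> R[i]) (a z : R[i]) (p lam M : R).

(** This identity dictates the exponent in [powden]: |P|^2 must be the factor |1 - conj(a) z|^(-2p)
    of the transported weight. *)
Lemma powden_weight p a z : unit_disc a -> unit_disc z ->
  (1 - modulus (phi a z) ^+ 2) `^ p = (1 - modulus a ^+ 2) `^ p *
    (modulus (powden p a z) ^+ 2 * (1 - modulus z ^+ 2) `^ p).
Proof.
move=> aD zD; have va := one_minus_sqr aD; have uz := one_minus_sqr zD.
have m0 := mden_gt0 aD zD.
rewrite one_minus_phi// modulus_powden//.
rewrite powRM ?mulr_ge0 ?(ltW va) ?(ltW uz) ?invr_ge0 ?exprn_ge0 ?(ltW m0)//.
rewrite powRM ?(ltW va) ?(ltW uz)// -mulrA; congr (_ * _); rewrite mulrC; congr (_ * _).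
have -> : modulus (mden a z) `^ (- p) = (modulus (mden a z))^-1 `^ p.
  by rewrite -(powR_inv1 (ltW m0)) -powRrM mulN1r.
by rewrite -exprVn powRX// invr_ge0 ltW.
Qed.

Lemma density_mul_le p f P z : analytic f -> analytic P -> unit_disc z ->
  dirichlet_density p (fun z => f z * P z) z <=
    2 * (modulus (P z) ^+ 2 * dirichlet_density p f z) +
    2 * (modulus (f z) ^+ 2 * dirichlet_density p P z).
Proof.
move=> fa Pa zD; rewrite /dirichlet_density.
rewrite (cdiff_cderiv (gdiffM (analytic_cdiff fa zD) (analytic_cdiff Pa zD))).
move: (cderiv f z) (cderiv P z) => c d.
have := modulusD (c * P z) (f z * d); rewrite !modulusM.
have := modulus_ge0 (c * P z + f z * d).
have := powR_ge0 (1 - modulus z ^+ 2) p; move: (_ `^ p) (modulus (_ + _)) => w x.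
move: (modulus c) (modulus (P z)) (modulus (f z)) (modulus d) => y1 y2 y3 y4 w0 x0 xy.
have H : x ^+ 2 <= 2 * (y2 ^+ 2 * y1 ^+ 2) + 2 * (y3 ^+ 2 * y4 ^+ 2).
  apply: (@le_trans _ _ ((y1 * y2 + y3 * y4) ^+ 2)).
    by rewrite lerXn2r ?nnegrE// (le_trans x0).
  have := sqr_ge0 (y1 * y2 - y3 * y4); rewrite !expr2; nra.
by have := ler_wpM2r w0 H; rewrite !expr2; lra.
Qed.

(** As phi is an involution, pulling back the density of f o phi cancels the Jacobians, and only the
    weight is transported. *)
Lemma pullback_density p f a z : analytic f -> unit_disc a -> unit_disc z ->
  pullback a (dirichlet_density p (recenter f a)) z = (1 - modulus a ^+ 2) `^ p *
    (modulus (powden p a z) ^+ 2 * dirichlet_density p f z).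
Proof.
move=> fa aD zD; have fD := phi_disc aD zD; have d0 := dphi_gt0 aD zD.
rewrite /pullback density_recenter// phiK// dphi_phi// powden_weight// /dirichlet_density.
move: (modulus (cderiv f z)) (modulus (dphi a z)) d0 => x y y0.
by field; rewrite gt_eqF.
Qed.

(** Here x stands for the constant of the growth bound. Its square times the weight leaves (1 -
    |z|^2)^(p lam), at most 2 |1 - conj(a) z|^(p lam), and |P'|^2 contributes |1 - conj(a) z|^(-2(p
    + 1)). The total exponent has the Forelli-Rudin form -(2 + c). *)
Lemma density_powden_le p lam a z (x : R) : 0 < p -> p < 1 -> 0 < lam -> lam < 1 ->
  unit_disc a -> unit_disc z -> 0 <= x ->
  (x * (1 - modulus z ^+ 2) `^ (- (p / 2 * (1 - lam)))) ^+ 2 *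
    dirichlet_density p (powden p a) z <=
  2 * x ^+ 2 * modulus (mden a z) `^ (- (2 + (2 * p - p * lam))).
Proof.
move=> p0 p1 l0 l1 aD zD x0; have uz := one_minus_sqr zD; have m0 := mden_gt0 aD zD.
rewrite /dirichlet_density exprMn (mulrC 2) -2![x ^+ 2 * _ * _]mulrA.
rewrite ler_wpM2l ?sqr_ge0//.
set u := 1 - modulus z ^+ 2; set m := modulus (mden a z).
have um : u <= 2 * m.
  have := mden_ge_z z aD; rewrite -/m /u.
  have := modulus_ge0 z; have : modulus z < 1 by []; rewrite expr2; nra.
have E1 : u `^ (- (p / 2 * (1 - lam))) ^+ 2 * u `^ p = u `^ (p * lam).
  rewrite -powR_mulrn ?powR_ge0// -powRrM -powRD; last by rewrite (gt_eqF uz) implybT.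
  by congr (_ `^ _); field.
have H1 : modulus (cderiv (powden p a) z) ^+ 2 <= m `^ (- (p + 1)) ^+ 2.
  rewrite lerXn2r ?nnegrE ?modulus_ge0 ?powR_ge0//.
  apply: le_trans (modulus_cderiv_powden (ltW p0) aD zD) _.
  by apply: ler_piMl; rewrite ?powR_ge0// ltW.
have H2 : u `^ (p * lam) <= 2 * m `^ (p * lam).
  have pl0 : 0 <= p * lam by rewrite mulr_ge0 ?(ltW p0) ?(ltW l0).
  apply: (@le_trans _ _ ((2 * m) `^ (p * lam))).
    by apply: ge0_ler_powR => //; rewrite nnegrE ?mulr_ge0 ?(ltW m0) ?(ltW uz).
  rewrite powRM ?(ltW m0)// ler_wpM2r ?powR_ge0//.
  rewrite -[leRHS](powRr1 (ler0n R 2)); apply: ler_powR; first by rewrite ler1n.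
  by move: p0 p1 l0 l1; nra.
have E2 : m `^ (- (2 + (2 * p - p * lam))) = m `^ (- (p + 1)) ^+ 2 * m `^ (p * lam).
  rewrite -powR_mulrn ?powR_ge0// -powRrM -powRD; last by rewrite (gt_eqF m0) implybT.
  by congr (_ `^ _); ring.
rewrite E2 mulrCA E1 (mulrCA 2).
by apply: ler_pM => //; [exact: sqr_ge0|exact: powR_ge0].
Qed.

Lemma powden_at0 p a : unit_disc a -> modulus (powden p a 0) = 1.
Proof. by move=> aD; rewrite modulus_powden//; [rewrite /mden mulr0 subr0 modulus1 powR1|exact: disc0]. Qed.

Lemma powden_energy p lam : 0 < p -> p < 1 -> 0 < lam -> lam < 1 ->
  exists2 A, 0 <= A & forall f M a, morrey_bd p (p / 2 * (1 - lam)) f M -> unit_disc a ->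
    (Dp_norm2 p (fun z => (f z * powden p a z)%R) <=
      (A * M ^+ 2 * (1 - modulus a ^+ 2) `^ (- (2 * p - p * lam)))%:E)%E.
Proof.
move=> p0 p1 l0 l1; have s0 : 0 < p / 2 * (1 - lam).
  by rewrite mulr_gt0 ?divr_gt0// subr_gt0.
have c0 : 0 < 2 * p - p * lam by move: p0 l1; nra.
have [C C0 HC] := growth (ltW p0) (ltW p1) s0.
have [K K0 HK] := pullback_bound R.
have [L L0 HL] := @forelli_rudin R _ c0.
(* The summands come from the value at 0, from f' P through the change of variables, and from f P'
   through the growth and Forelli-Rudin bounds. *)
exists (1 + 2 * K + 4 * C ^+ 2 * L).
  have := mulr_ge0 (sqr_ge0 C) (ltW L0); move: K0; lra.
move=> f M a [fa M0 fM fB] aD; have va := one_minus_sqr aD.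
have Pa := @powden_analytic R p a aD.
set V := (1 - modulus a ^+ 2) `^ (- (2 * p - p * lam)).
have V1 : 1 <= V.
  have u1 : 1 - modulus a ^+ 2 <= 1 by rewrite gerBl sqr_ge0.
  by have := powRN_le va u1 (ltW c0); rewrite powR1.
have cf : dcont (fun z => modulus (f z) ^+ 2).
  by move=> z zD; apply: rcontX; apply: rcont_modulus; exact: analytic_ccont.
have cP : dcont (fun z => modulus (powden p a z) ^+ 2).
  by move=> z zD; apply: rcontX; apply: rcont_modulus; exact: analytic_ccont.
have cdf := dcont_density p fa; have cdP := dcont_density p Pa.
pose T1 z := modulus (powden p a z) ^+ 2 * dirichlet_density p f z.
pose T2 z := modulus (f z) ^+ 2 * dirichlet_density p (powden p a) z.
have cT1 : dcont T1 by move=> z zD; apply: rcontM; [exact: cP|exact: cdf].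
have cT2 : dcont T2 by move=> z zD; apply: rcontM; [exact: cf|exact: cdP].
have T10 z : 0 <= T1 z by rewrite mulr_ge0 ?sqr_ge0 ?density_ge0.
have T20 z : 0 <= T2 z by rewrite mulr_ge0 ?sqr_ge0 ?density_ge0.
have c2T (T : R[i] -> R) : dcont T -> dcont (fun z => 2 * T z).
  by move=> cT z zD; apply: rcontM; [exact: rcont_cst|exact: cT].
have H1 : (dint T1 <= (K * M ^+ 2 * V)%:E)%E.
  have w0 : 0 < (1 - modulus a ^+ 2) `^ p by exact: powR_gt0.
  have rfa := recenter_analytic fa aD.
  have EP : dint (pullback a (dirichlet_density p (recenter f a))) =
      (((1 - modulus a ^+ 2) `^ p)%:E * dint T1)%E.
    rewrite -dintZ ?(ltW w0)//.
    by apply: eq_dint => z zD; exact: pullback_density.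
  have := HK a _ aD (dcont_density p rfa) (fun z _ => density_ge0 p _ z).
  rewrite EP.
  have hK := lee_wpmul2l _ (fB a aD).
  move=> /le_trans /(_ (hK K%:E ltac:(by rewrite lee_fin ltW))).
  rewrite -EFinM -lee_pdivlMl//; move=> /le_trans; apply.
  rewrite -EFinM lee_fin le_eqVlt; apply/orP; left; apply/eqP.
  (* The exponent -p - p(1 - lam) equals -(2p - p lam), so this term has the same order as the
     Forelli-Rudin one. *)
  have -> : V = (1 - modulus a ^+ 2) `^ (- p) *
      (1 - modulus a ^+ 2) `^ (- (2 * (p / 2 * (1 - lam)))).
    rewrite -powRD; last by rewrite (gt_eqF va) implybT.
    by congr (_ `^ _); field.
  rewrite (powRN _ p); move: (powR _ p) (powR _ (- _)) w0 => x y x0.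
  by field; rewrite gt_eqF.
have H2 : (dint T2 <= (2 * (C * M) ^+ 2 * (L * V))%:E)%E.
  have CM0 : 0 <= 2 * (C * M) ^+ 2 by rewrite mulr_ge0 ?sqr_ge0.
  have cm := @dcont_mden_pow R a (- (2 + (2 * p - p * lam))) aD.
  apply: (@le_trans _ _ (dint (fun z => 2 * (C * M) ^+ 2 *
      modulus (mden a z) `^ (- (2 + (2 * p - p * lam)))))).
    apply: dint_le => //.
      by move=> z zD; apply: rcontM; [exact: rcont_cst|exact: cm].
    move=> z zD; rewrite T20/=.
    have CM : 0 <= C * M by rewrite mulr_ge0 ?(ltW C0).
    apply: le_trans (density_powden_le p0 p1 l0 l1 aD zD CM).
    rewrite ler_wpM2r ?density_ge0// lerXn2r ?nnegrE ?modulus_ge0 ?mulr_ge0 ?powR_ge0 ?(ltW C0)//.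
    exact: HC.
  rewrite dintZ//; last by move=> z _; exact: powR_ge0.
  by rewrite (EFinM _ (L * V)) lee_wpmul2l ?lee_fin//; exact: HL.
have fPa := analyticM fa Pa.
have H3 : (dint (dirichlet_density p (fun z => (f z * powden p a z)%R)) <=
    (2 * (K * M ^+ 2 * V) + 2 * (2 * (C * M) ^+ 2 * (L * V)))%:E)%E.
  apply: (@le_trans _ _ (dint (fun z => 2 * T1 z + 2 * T2 z))).
    apply: dint_le; first exact: dcont_density.
      by move=> z zD; apply: rcontD; apply: (c2T _ _ z zD).
    by move=> z zD; rewrite density_ge0/=; exact: density_mul_le.
  clearbody T1 T2.
  have n2 (T : R[i] -> R) : (forall z, 0 <= T z) -> forall z, unit_disc z -> 0 <= 2 * T z.
    by move=> T0 z _; rewrite mulr_ge0.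
  rewrite (dintD (c2T T1 cT1) (c2T T2 cT2) (n2 T1 T10) (n2 T2 T20)).
  rewrite (dintZ (ler0n R 2) cT1 (fun z _ => T10 z)).
  rewrite (dintZ (ler0n R 2) cT2 (fun z _ => T20 z)).
  have e2 : (0 <= 2%:E :> \bar R)%E by rewrite lee_fin.
  exact: leeD (lee_wpmul2l e2 H1) (lee_wpmul2l e2 H2).
rewrite /Dp_norm2 area_integralE modulusM powden_at0// mulr1.
have D0 : (0 <= dint (dirichlet_density p (fun z => (f z * powden p a z)%R)))%E.
  by apply: dint_ge0 => z _; exact: density_ge0.
apply: (@le_trans _ _ ((M ^+ 2 * V)%:E +
    (2 * (K * M ^+ 2 * V) + 2 * (2 * (C * M) ^+ 2 * (L * V)))%:E)%E).
  apply: leeD.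
    rewrite lee_fin; apply: (@le_trans _ _ (M ^+ 2)).
      by rewrite lerXn2r ?nnegrE ?modulus_ge0.
    by rewrite ler_peMr ?sqr_ge0.
  apply: le_trans H3; rewrite -[leRHS]mul1e lee_wpmul2r// lee_fin.
  exact: pi_inv_le1.
by rewrite -EFinD lee_fin le_eqVlt; apply/orP; left; apply/eqP; ring.
Qed.

Lemma J_Wp_bound p lam g : 0 < p -> p < 1 -> 0 < lam -> lam < 1 -> Wp p g ->
  exists2 B, 0 <= B & forall f M, morrey_bd p (p / 2 * (1 - lam)) f M ->
    forall a, unit_disc a ->
    (dint (dirichlet_density p (recenter (J g f) a)) <=
      (B * M ^+ 2 * (1 - modulus a ^+ 2) `^ (- (2 * (p / 2 * (1 - lam)))))%:E)%E.
Proof.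
move=> p0 p1 l0 l1 [ga [mu [muE [Cc HCc]]]].
have [A A0 HA] := powden_energy p0 p1 l0 l1.
have [K K0 HK] := pullback_bound R.
(* The Carleson constant is an arbitrary real, hence the absolute value; pi undoes the normalisation
   of area. *)
exists (K * (pi * (`|Cc| * A))); first by rewrite !mulr_ge0 ?pi_ge0 ?(ltW K0).
move=> f M fM a aD; have [fa M0 _ _] := fM; have va := one_minus_sqr aD.
have Pa := @powden_analytic R p a aD; have fPa := analyticM fa Pa.
have cfP : dcont (fun z => modulus (f z * powden p a z) ^+ 2).
  move=> z zD; apply: rcontX.
  by exact: (@rcont_modulus _ (fun z => f z * powden p a z) _ (analytic_ccont fPa zD)).
have cdg := dcont_density p ga.
pose H z := modulus (f z * powden p a z) ^+ 2 * dirichlet_density p g z.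
have cH : dcont H by move=> z zD; apply: rcontM; [exact: cfP|exact: cdg].
have H0 z : 0 <= H z by rewrite mulr_ge0 ?sqr_ge0 ?density_ge0.
have w0 : 0 < (1 - modulus a ^+ 2) `^ p by exact: powR_gt0.
have HD : (dint H <= (pi * (`|Cc| * (A * M ^+ 2 *
    (1 - modulus a ^+ 2) `^ (- (2 * p - p * lam)))))%:E)%E.
  (* The energy bound also gives the membership in D_p that the Carleson inequality asks for. *)
  have DfP : Dp p (fun z => f z * powden p a z).
    by split => //; apply: le_lt_trans (HA f M a fM aD) _; rewrite ltry.
  have := HCc _ DfP.
  rewrite (integral_mu_ ga muE cfP); last by move=> z _; exact: sqr_ge0.
  have N0 : (0 <= Dp_norm2 p (fun z => (f z * powden p a z)%R))%E.
    apply: adde_ge0; rewrite ?lee_fin ?sqr_ge0// area_integralE mule_ge0//.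
      by rewrite lee_fin invr_ge0 pi_ge0.
    by apply: dint_ge0 => z _; exact: density_ge0.
  rewrite -/H => h1; rewrite EFinM -lee_pdivrMl ?pi_gt0//; apply: (le_trans h1).
  have h2 : (Cc%:E <= `|Cc|%:E)%E by rewrite lee_fin ler_norm.
  apply: (le_trans (lee_wpmul2r N0 h2)); rewrite EFinM lee_wpmul2l ?lee_fin//.
  exact: HA.
have Ja := J_analytic fa ga; have rJa := recenter_analytic Ja aD.
have cvH : dcont (fun z => (1 - modulus a ^+ 2) `^ p * H z).
  by move=> z zD; apply: rcontM; [exact: rcont_cst|exact: cH].
(* Since z = phi (phi z), [powden_weight] at phi z expresses the weight at z through phi z, and the
   integrand becomes a pullback. *)
rewrite (@eq_dint _ _ (pullback a (fun z => (1 - modulus a ^+ 2) `^ p * H z))); last first.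
  move=> z zD; have fD := phi_disc aD zD.
  rewrite /pullback density_recenter// cderiv_J// /H /dirichlet_density.
  have := powden_weight p aD fD; rewrite phiK// => ->; rewrite !(modulusM (f (phi a z))).
  move: (cderiv g (phi a z)) => d; move: (modulus d) (modulus (f _)) (modulus (dphi a z)).
  move: (modulus (powden p a _)) (powR _ p) (powR _ p) => y1 y2 y3 y4 y5 y6.
  ring.
apply: le_trans (HK a _ aD cvH _) _; first by move=> z _; rewrite mulr_ge0 ?(ltW w0).
rewrite dintZ ?(ltW w0)//.
apply: (@le_trans _ _ (K%:E * (((1 - modulus a ^+ 2) `^ p)%:E * (pi * (`|Cc| * (A * M ^+ 2 *
    (1 - modulus a ^+ 2) `^ (- (2 * p - p * lam)))))%:E))%E).
  by rewrite lee_wpmul2l ?lee_fin ?(ltW K0)// lee_wpmul2l ?lee_fin ?(ltW w0).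
rewrite -!EFinM lee_fin le_eqVlt; apply/orP; left; apply/eqP.
(* The exponents balance: p - (2p - p lam) = -p(1 - lam), which is the Morrey weight. *)
have -> : (1 - modulus a ^+ 2) `^ (- (2 * (p / 2 * (1 - lam)))) =
    (1 - modulus a ^+ 2) `^ p * (1 - modulus a ^+ 2) `^ (- (2 * p - p * lam)).
  rewrite -powRD; last by rewrite (gt_eqF va) implybT.
  by congr (_ `^ _); field.
by move: (pi : R) (powR _ p) (powR _ (- _)) => x y1 y2; ring.
Qed.

End CarlesonBound.

Theorem theorem4 (R : realType) (p : R) (hp : 0 < p < 1) :
  (forall (q : R) (g : R[i] -> R[i]),
      0 < q < p -> Qp q g ->
      bounded_operator (morrey p (q / p)) (morrey_norm p (q / p)) (J g)) /\
  (forall (lambda : R) (g : R[i] -> R[i]),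
      0 < lambda < 1 -> Wp p g ->
      bounded_operator (morrey p lambda) (morrey_norm p lambda) (J g)).
Proof.
have /andP[p0 p1] := hp; split=> [q g /andP[q0 qp] gQ|lam g /andP[l0 l1] gW].
  have [B B0 HB] := J_Qp_bound q0 qp p1 gQ; have [ga _] := gQ.
  apply: (J_bounded_operator ga B0).
  have -> // : p / 2 * (1 - q / p) = (p - q) / 2 by field; rewrite gt_eqF.
have [B B0 HB] := J_Wp_bound p0 p1 l0 l1 gW; have [ga _] := gW.
exact: (J_bounded_operator ga B0).
Qed.
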